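(* Let $\omega\in\widehat{\mathcal{D}}$. Then the following statements are equivalent: (i) $T_c(D^1_\omega,H^\infty)$ consists of constant functions only; (ii) $\displaystyle\limsup_{r\to1^-}\frac{1-r}{\widehat\omega(r)}>0$; (iii) $\displaystyle\limsup_{r\to1^-}(1-r)\sum_{k=1}^\infty\frac{r^k}{(k+1)\omega_k}>0$; (iv) the identity map $I:D^1_\omega\to D^1_0$ is not compact.
   Context: $\mathbb{D}$ is the open unit disc, $\mathcal{H}(\mathbb{D})$ the analytic functions on it, $dA(z)=\frac{dx\,dy}{\pi}$. A radial weight is a non-negative $\omega\in L^1([0,1))$ extended by $\omega(z)=\omega(|z|)$; always assume $\widehat\omega(r)=\int_r^1\omega(s)\,ds>0$ for all $0\le r<1$. $\omega\in\widehat{\mathcal{D}}$ means there is $C\ge1$ with $\widehat\omega(r)\le C\widehat\omega(\frac{1+r}{2})$ for all $0\le r<1$. Moments: $\omega_x=\int_0^1 r^x\omega(r)\,dr$. $D^1_\omega$ consists of $f\in\mathcal H(\mathbb D)$ with $\|f\|_{D^1_\omega}=\int_{\mathbb D}|f'|\omega\,dA+|f(0)|<\infty$; $D^1_0$ is the case $\omega\equiv1$. For $g\in\mathcal H(\mathbb D)$, $T_g(f)(z)=\int_0^z f(\zeta)g'(\zeta)\,d\zeta$. $T_c(X,H^\infty)$ is the set of $g\in\mathcal H(\mathbb D)$ such that $T_g:X\to H^\infty$ is compact. *)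

(* Defs.v *)
From mathcomp Require Import all_boot all_order all_algebra.
From mathcomp Require Import all_classical all_reals all_analysis.
From mathcomp Require Import complex.
Import Order.TTheory GRing.Theory Num.Theory.
Import numFieldTopology.Exports numFieldNormedType.Exports.

Set Implicit Arguments.
Unset Strict Implicit.
Unset Printing Implicit Defensive.

Local Open Scope ring_scope.
Local Open Scope classical_set_scope.

(* The complex plane over a real type R, seen as a numClosedFieldType so that
   MathComp-Analysis equips it with its (metric) topology. *)
Definition CC (R : realType) : numClosedFieldType := (R[i])%C.

Section Defs.
Variable R : realType.
Local Notation C := (CC R).
Local Notation mu := (@lebesgue_measure R).

Definition cpt (x y : R) : C := (x +i* y)%C.
Definition cre (z : C) : R := complex.Re (z : R[i]).
Definition cim (z : C) : R := complex.Im (z : R[i]).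
Definition cmod (z : C) : R := Normc.normc (z : R[i]).

Definition disc : set C := [set z | cmod z < 1].

Definition cdifferentiable (f : C -> C) (z : C) : Prop :=
  exists l : C, (fun h : C => (f (z + h) - f z) / h) @ (0 : C)^' --> l.
Definition cderiv (f : C -> C) (z : C) : C :=
  lim ((fun h : C => (f (z + h) - f z) / h) @ (0 : C)^').

Definition analytic_disc (f : C -> C) : Prop :=
  forall z, disc z -> cdifferentiable f z.

Definition constant_disc (f : C -> C) : Prop :=
  exists c : C, forall z, disc z -> f z = c.

Definition omega_hat (w : R -> R) (r : R) : R := Rintegral mu `[r, 1[ w.

Definition radial_weight (w : R -> R) : Prop :=
  [/\ forall r, 0 <= r < 1 -> 0 <= w r,
      mu.-integrable `[0, 1[ (fun r => (w r)%:E)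
    & forall r, 0 <= r < 1 -> 0 < omega_hat w r].

Definition Dhat (w : R -> R) : Prop :=
  exists c : R, 1 <= c /\
    forall r, 0 <= r < 1 -> omega_hat w r <= c * omega_hat w ((1 + r) / 2).

Definition moment (w : R -> R) (k : nat) : R :=
  Rintegral mu `[0, 1[ (fun r => r ^+ k * w r).

Definition disc_integral (F : C -> \bar R) : \bar R :=
  ((\int[(mu \x mu)]_(p in [set p : R * R | (cmod (cpt p.1 p.2) < 1)%R])
      F (cpt p.1 p.2)) * (pi^-1)%:E)%E.

Definition D1_norm (w : R -> R) (f : C -> C) : \bar R :=
  (disc_integral (fun z => (cmod (cderiv f z) * w (cmod z))%:E)
   + (cmod (f 0))%:E)%E.
Definition in_D1 (w : R -> R) (f : C -> C) : Prop :=
  analytic_disc f /\ (D1_norm w f < +oo)%E.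

Definition one_weight : R -> R := fun _ => 1.

Definition Hinf_norm (f : C -> C) : \bar R :=
  ereal_sup [set (cmod (f z))%:E | z in disc].
Definition in_Hinf (f : C -> C) : Prop :=
  analytic_disc f /\ (Hinf_norm f < +oo)%E.

(* T_g f (z) = int_0^z f(zeta) g'(zeta) d zeta, along the segment [0, z] *)
Definition Tg (g f : C -> C) (z : C) : C :=
  let F := fun t : R => f (cpt t 0 * z) * cderiv g (cpt t 0 * z) in
  z * cpt (Rintegral mu `[0, 1] (fun t => cre (F t)))
          (Rintegral mu `[0, 1] (fun t => cim (F t))).

Definition compact_operator (inX : (C -> C) -> Prop) (NX : (C -> C) -> \bar R)
    (inY : (C -> C) -> Prop) (NY : (C -> C) -> \bar R)
    (T : (C -> C) -> (C -> C)) : Prop :=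
  (forall f, inX f -> inY (T f)) /\
  forall u : nat -> (C -> C), (forall n, inX (u n) /\ (NX (u n) <= 1)%E) ->
    exists phi : nat -> nat,
      {homo phi : m n / (m < n)%N >-> (m < n)%N} /\
      exists h, inY h /\
        (fun n => NY (fun z => T (u (phi n)) z - h z)) @ \oo --> 0%E.

End Defs.

(* Main.v *)
(* Write W for omega_hat w.  In polar coordinates the norm of D^1_w is (1/pi) int_0^1 w N_f + |f(0)|, where
   N_f(r), r times the mean of |f'| over the circle of radius r, is nondecreasing by the Poisson formula.

   If (1 - r) / W(r) tends to 0, summation by parts bounds the tails of int N_f by small multiples of
   int w N_f, and with Montel's theorem the identity D^1_w -> D^1_0 is compact.  The operator T_g with g(z) = z
   maps D^1_0 boundedly into H^infty, because
     int_0^1 f(tz) dt = f(0) + z int_0^1 (1 - t) f'(tz) dt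
   and (1 - t) |f'(tz)| <= N_f((1 + t) / 2) / pi; so it is compact on D^1_w whenever the identity is.

   Conversely let 1 - r >= c W(r) for radii r tending to 1, and let T_g be compact with g' not identically 0.
   By doubling, for large n the functions ((1 - |a|) / (1 - conj(a) z))^n / W(|a|) are bounded in D^1_w and tend
   to 0 locally uniformly as |a| tends to 1, so their images under T_g tend to 0 uniformly.  Evaluating the
   derivatives of the images at suitable points a with |a| = r, where |g'(a)| stays away from 0, Cauchy's
   estimate gives (1 - r) / W(r) -> 0 along these radii, a contradiction.

   The moment w_k is comparable with W(1 - 1/k): one bound is elementary, the other is the same kernel
   estimate.  Hence (1 - r) / W(r) and (1 - r) sum_k r^k / ((k + 1) w_k) have positive upper limits together. *)
Require Import Defs.
From mathcomp Require Import all_boot all_order all_algebra.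
From mathcomp Require Import all_classical all_reals all_analysis.
From mathcomp Require Import complex ring lra measurable_realfun.
Import Order.TTheory GRing.Theory Num.Theory.
Import numFieldTopology.Exports numFieldNormedType.Exports.
Local Open Scope ring_scope.
Local Open Scope classical_set_scope.
Set Implicit Arguments.
Unset Strict Implicit.
Unset Printing Implicit Defensive.

(** The pivot is (ii). If it fails, the identity is compact, so (iv) fails, and so does (i) through
    [g(z) = z]; if it holds, (i) follows. Doubling enters through the integral of the kernel powers,
    which serves both the test functions and the moments. Cauchy's theory is needed for a circle
    about 0 and an arbitrary interior point [z]. The map [(x, y) |-> z + x A(y)] carries a rectangle
    onto the region between an arc and its contraction towards [z], so Goursat's bisection is run on
    rectangles for a pulled back form, in place of a homotopy of paths. Contracting fully gives
    Cauchy's formula; a factor with a pole at the reflected point turns it into Poisson's formula.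
    Monotone functions are compared on the intervals between points whose distances to 1 halve, in
    place of Stieltjes integrals; this is the origin of the constants 2 and 4. The test functions
    carry one more power than the kernel bound asks for: after division by the weight, this spare
    power is what tends to 0. *)

Section ComplexBasics.
Variable R : realType.
Local Notation C := (CC R).
Implicit Types (z w : C) (x y : R).

(** * Coordinates, modulus and conjugation in the complex plane *)

Definition rc (x : R) : C := cpt x 0.
Definition ci : C := cpt 0 1.
Definition conj (z : C) : C := cpt (cre z) (- cim z).
Definition cis (t : R) : C := cpt (cos t) (sin t).

Lemma cptE z : z = cpt (cre z) (cim z). Proof. by case: z. Qed.

Lemma ceq z w : cre z = cre w -> cim z = cim w -> z = w.
Proof. by case: z w => [a b] [c d] /= -> ->. Qed.

Lemma creM z w : cre (z * w) = cre z * cre w - cim z * cim w.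
Proof. by case: z w => [a b] [c d]. Qed.
Lemma cimM z w : cim (z * w) = cre z * cim w + cim z * cre w.
Proof. by case: z w => [a b] [c d]. Qed.
Lemma creD z w : cre (z + w) = cre z + cre w.
Proof. by case: z w => [a b] [c d]. Qed.
Lemma cimD z w : cim (z + w) = cim z + cim w.
Proof. by case: z w => [a b] [c d]. Qed.
Lemma creN z : cre (- z) = - cre z.
Proof. by case: z => [a b]. Qed.
Lemma cimN z : cim (- z) = - cim z.
Proof. by case: z => [a b]. Qed.
Lemma cre0 : cre (0 : C) = 0. Proof. by []. Qed.
Lemma cim0 : cim (0 : C) = 0. Proof. by []. Qed.
Lemma cre1 : cre (1 : C) = 1. Proof. by []. Qed.
Lemma cim1 : cim (1 : C) = 0. Proof. by []. Qed.
Lemma cre_cpt x y : cre (cpt x y) = x. Proof. by []. Qed.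
Lemma cim_cpt x y : cim (cpt x y) = y. Proof. by []. Qed.

Definition creimE := (creM, cimM, creD, cimD, creN, cimN, cre0, cim0, cre1, cim1, cre_cpt, cim_cpt).

Lemma normCE z : `|z| = (cmod z)%:C%C. Proof. by []. Qed.

Lemma cmod_ge0 z : 0 <= cmod z.
Proof. by case: z => a b; rewrite /cmod /= sqrtr_ge0. Qed.
Lemma cmodM z w : cmod (z * w) = cmod z * cmod w.
Proof. by have /(congr1 (@cre R)) := normrM z w; rewrite !normCE /= !mul0r subr0. Qed.
Lemma cmodD z w : cmod (z + w) <= cmod z + cmod w.
Proof. by have := ler_normD z w; rewrite !normCE -rmorphD /= lecR. Qed.
Lemma cmodN z : cmod (- z) = cmod z.
Proof. by have /(congr1 (@cre R)) := normrN z; rewrite !normCE /=. Qed.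
Lemma cmodBC z w : cmod (z - w) = cmod (w - z).
Proof. by rewrite -cmodN opprB. Qed.
Lemma cmodB z w : cmod (z - w) <= cmod z + cmod w.
Proof. by rewrite -(cmodN w) cmodD. Qed.
Lemma cmodB_ge z w : cmod z - cmod w <= cmod (z - w).
Proof. by rewrite lerBlDr -{1}(subrK w z) cmodD. Qed.
Lemma cmodB_ge' z w : cmod w - cmod z <= cmod (z - w).
Proof. by rewrite cmodBC cmodB_ge. Qed.
Lemma cmod0 : cmod (0 : C) = 0.
Proof. by have /(congr1 (@cre R)) := normr0 C; rewrite !normCE /=. Qed.
Lemma cmod1 : cmod (1 : C) = 1.
Proof. by have /(congr1 (@cre R)) := normr1 C; rewrite !normCE /=. Qed.
Lemma cmod_eq0 z : (cmod z == 0) = (z == 0).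
Proof.
by rewrite -(normr_eq0 z) normCE; apply/eqP/eqP => [->//|/(congr1 (@cre R))].
Qed.
Lemma cmod_gt0 z : (0 < cmod z) = (z != 0).
Proof. by rewrite lt_neqAle cmod_ge0 andbT eq_sym cmod_eq0. Qed.
Lemma cmodV z : cmod z^-1 = (cmod z)^-1.
Proof.
have [->|z0] := eqVneq z 0; first by rewrite invr0 cmod0 invr0.
have c0 : cmod z != 0 by rewrite cmod_eq0.
by apply: (mulfI c0); rewrite -cmodM divff // cmod1 divff.
Qed.
Lemma cmodX z n : cmod (z ^+ n) = cmod z ^+ n.
Proof. by elim: n => [|n IH]; rewrite ?expr0 ?cmod1 // !exprS cmodM IH. Qed.
Lemma cmod_cpt x y : cmod (cpt x y) = Num.sqrt (x ^+ 2 + y ^+ 2).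
Proof. by []. Qed.
Lemma cmodE z : cmod z = Num.sqrt (cre z ^+ 2 + cim z ^+ 2).
Proof. by rewrite {1}(cptE z). Qed.
Lemma cmod_sqr z : cmod z ^+ 2 = cre z ^+ 2 + cim z ^+ 2.
Proof. by rewrite cmodE sqr_sqrtr // addr_ge0 ?sqr_ge0. Qed.
Lemma cre_le z : `|cre z| <= cmod z.
Proof. by rewrite cmodE -sqrtr_sqr ler_wsqrtr // lerDl sqr_ge0. Qed.
Lemma cim_le z : `|cim z| <= cmod z.
Proof. by rewrite cmodE -sqrtr_sqr ler_wsqrtr // lerDr sqr_ge0. Qed.
Lemma cmod_rc x : cmod (rc x) = `|x|.
Proof. by rewrite cmod_cpt expr0n addr0 sqrtr_sqr. Qed.
Lemma cmod_ci : cmod ci = 1.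
Proof. by rewrite cmod_cpt expr0n /= add0r expr1n sqrtr1. Qed.
Lemma cmod_le z : cmod z <= `|cre z| + `|cim z|.
Proof.
rewrite {1}(_ : z = rc (cre z) + ci * rc (cim z)); last first.
  by apply: ceq; rewrite !creimE; ring.
by apply: le_trans (cmodD _ _) _; rewrite cmodM cmod_ci mul1r !cmod_rc.
Qed.
Lemma cmod_cis t : cmod (cis t) = 1.
Proof. by rewrite cmod_cpt cos2Dsin2 sqrtr1. Qed.
Lemma cmod_conj z : cmod (conj z) = cmod z.
Proof. by rewrite !cmodE !creimE sqrrN. Qed.
Lemma conjM z w : conj (z * w) = conj z * conj w.
Proof. by apply: ceq; rewrite !creimE; ring. Qed.
Lemma conjD z w : conj (z + w) = conj z + conj w.
Proof. by apply: ceq; rewrite !creimE; ring. Qed.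
Lemma conjN z : conj (- z) = - conj z.
Proof. by apply: ceq; rewrite !creimE; ring. Qed.
Lemma conjK z : conj (conj z) = z.
Proof. by apply: ceq; rewrite !creimE; ring. Qed.
Lemma conj1 : conj 1 = 1.
Proof. by apply: ceq; rewrite !creimE; ring. Qed.
Lemma conj0 : conj 0 = 0.
Proof. by apply: ceq; rewrite !creimE; ring. Qed.
Lemma conjV z : conj z^-1 = (conj z)^-1.
Proof.
have [->|z0] := eqVneq z 0; first by rewrite invr0 conj0 invr0.
have c0 : conj z != 0 by rewrite -cmod_eq0 cmod_conj cmod_eq0.
by apply: (mulfI c0); rewrite -conjM divff // conj1 divff.
Qed.
Lemma conj_rc x : conj (rc x) = rc x.
Proof. by apply: ceq; rewrite !creimE; ring. Qed.
Lemma mul_conj z : z * conj z = rc (cmod z ^+ 2).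
Proof. by rewrite cmod_sqr; apply: ceq; rewrite !creimE; ring. Qed.
Lemma rcD x y : rc (x + y) = rc x + rc y.
Proof. by apply: ceq; rewrite !creimE; ring. Qed.
Lemma rcM x y : rc (x * y) = rc x * rc y.
Proof. by apply: ceq; rewrite !creimE; ring. Qed.
Lemma rcN x : rc (- x) = - rc x.
Proof. by apply: ceq; rewrite !creimE; ring. Qed.
Lemma rcB x y : rc (x - y) = rc x - rc y.
Proof. by rewrite rcD rcN. Qed.
Lemma rc1 : rc 1 = 1. Proof. by []. Qed.
Lemma rc0 : rc 0 = 0. Proof. by []. Qed.
Lemma rc_eq0 x : (rc x == 0) = (x == 0).
Proof. by rewrite -cmod_eq0 cmod_rc normr_eq0. Qed.
Lemma rcV x : rc x^-1 = (rc x)^-1.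
Proof.
have [->|z0] := eqVneq x 0; first by rewrite invr0 rc0 invr0.
have c0 : rc x != 0 by rewrite rc_eq0.
by apply: (mulfI c0); rewrite -rcM divff // divff.
Qed.
(** Rotating an integral by such a [c] makes it real and nonnegative; this is how norms of complex
    integrals are bounded. The factor is [conj z / |z|], and any unit serves at [z = 0]. *)
Lemma cmod_unit z : exists2 c : C, cmod c = 1 & c * z = rc (cmod z).
Proof.
have [->|z0] := eqVneq z 0.
  by exists 1; rewrite ?cmod1 // mulr0 cmod0 rc0.
have c0 : rc (cmod z) != 0 by rewrite rc_eq0 cmod_eq0.
exists (conj z / rc (cmod z)).
  by rewrite cmodM cmodV cmod_conj cmod_rc ger0_norm ?cmod_ge0 // divff // cmod_eq0.
by rewrite mulrAC [conj z * z]mulrC mul_conj expr2 rcM mulfK.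
Qed.

(** The norm of [C] takes its values in [C], so radii are complex numbers. A complex [e] with
    [0 < e] has zero imaginary part, hence real radii suffice. *)
Lemma cvgCP T (F : set_system T) (FF : Filter F) (f : T -> C) (l : C) :
  f @ F --> l <-> forall e : R, 0 < e -> \forall x \near F, cmod (f x - l) < e.
Proof.
split=> [/cvgrPdist_lt fl e e0|fl].
  have : 0 < (e%:C%C : C) by rewrite ltcR.
  move=> /fl; apply: filterS => x.
  by rewrite distrC normCE ltcR.
apply/cvgrPdist_lt => /= e e0.
have eE : e = ((cre e)%:C%C : C).
  by move: e0; rewrite ltcE /= => /andP[/eqP h _]; apply: ceq.
rewrite eE ltcR in e0.
have := fl _ e0; apply: filterS => x.
by rewrite distrC normCE eE ltcR.
Qed.

End ComplexBasics.

(** * Limits and continuity of complex-valued functions *)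

Section Continuity.
Variable R : realType.
Local Notation C := (CC R).

Lemma cvg_cmod_le T (F : set_system T) (FF : Filter F) (f : T -> C) (l : C) (u : T -> R) :
  (forall x, cmod (f x - l) <= u x) -> u @ F --> (0 : R) -> f @ F --> l.
Proof.
move=> fu /cvgrPdist_lt u0; apply/cvgCP => e e0.
have := u0 _ e0; apply: filterS => x; rewrite sub0r normrN => h.
by apply: le_lt_trans (fu x) _; apply: le_lt_trans h; rewrite ler_norm.
Qed.

Lemma cvg_cpt T (F : set_system T) (FF : Filter F) (f g : T -> R) (a b : R) :
  f @ F --> a -> g @ F --> b -> (fun x => cpt (f x) (g x) : C) @ F --> (cpt a b : C).
Proof.
move=> fa gb; apply: (@cvg_cmod_le _ _ _ _ _ (fun x => `|f x - a| + `|g x - b|)).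
  by move=> x; apply: le_trans (cmod_le _) _; rewrite !creimE.
rewrite -[X in _ --> X](addr0 0); apply: cvgD; rewrite -[X in _ --> X](normr0 R).
  by apply: cvg_norm; apply/subr_cvg0.
by apply: cvg_norm; apply/subr_cvg0.
Qed.

Lemma cvg_cre T (F : set_system T) (FF : Filter F) (f : T -> C) (a : C) :
  f @ F --> a -> (fun x => cre (f x)) @ F --> cre a.
Proof.
move=> /cvgCP fa; apply/cvgrPdist_lt => e /fa; apply: filterS => x.
by apply: le_lt_trans; rewrite distrC -creN -creD cre_le.
Qed.

Lemma cvg_cim T (F : set_system T) (FF : Filter F) (f : T -> C) (a : C) :
  f @ F --> a -> (fun x => cim (f x)) @ F --> cim a.
Proof.
move=> /cvgCP fa; apply/cvgrPdist_lt => e /fa; apply: filterS => x.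
by apply: le_lt_trans; rewrite distrC -cimN -cimD cim_le.
Qed.

Lemma cvg_cmod T (F : set_system T) (FF : Filter F) (f : T -> C) (a : C) :
  f @ F --> a -> (fun x => cmod (f x)) @ F --> cmod a.
Proof.
move=> /cvgCP fa; apply/cvgrPdist_lt => e /fa; apply: filterS => x.
by apply: le_lt_trans; rewrite ler_norml lerNl opprB cmodB_ge cmodB_ge'.
Qed.

Lemma cvg_rc T (F : set_system T) (FF : Filter F) (f : T -> R) (a : R) :
  f @ F --> a -> (fun x => rc (f x)) @ F --> rc a.
Proof. by move=> fa; apply: cvg_cpt => //; exact: cvg_cst. Qed.

Lemma cvg_cis T (F : set_system T) (FF : Filter F) (f : T -> R) (a : R) :
  f @ F --> a -> (fun x => cis (f x)) @ F --> cis a.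
Proof.
move=> fa; apply: cvg_cpt.
  by apply: (cvg_comp _ _ fa); exact: continuous_cos.
by apply: (cvg_comp _ _ fa); exact: continuous_sin.
Qed.

Lemma cvg_eps (f : C -> C) z : {for z, continuous f} ->
  forall e : R, 0 < e -> exists2 d : R, 0 < d & forall w, cmod (w - z) < d -> cmod (f w - f z) < e.
Proof.
move=> /cvgCP fz e e0; have [d /= d0 H] := (iffLR (nbhs_ballP _ _) (fz e e0)).
have dE : d = ((cre d)%:C%C : C).
  by move: d0; rewrite ltcE /= => /andP[/eqP h _]; apply: ceq.
move: d0; rewrite dE ltcR => d0; exists (cre d) => // w wz; apply: H.
by rewrite /ball /= distrC normCE dE ltcR.
Qed.

Lemma cvg_epsR (f : R -> C) (z : R) : {for z, continuous f} ->
  forall e : R, 0 < e -> exists2 d : R, 0 < d & forall w, `|w - z| < d -> cmod (f w - f z) < e.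
Proof.
move=> /cvgCP fz e e0; have [d /= d0 H] := (iffLR (nbhs_ballP _ _) (fz e e0)).
by exists d => // w wz; apply: H; rewrite /ball /= distrC.
Qed.

Lemma near_cmod (z : C) (d : R) : 0 < d -> \forall w \near z, cmod (w - z) < d.
Proof. by move=> d0; move/cvgCP: (@cvg_id _ (nbhs z)); apply. Qed.

Lemma ccvg_eq T (F : set_system T) (f : T -> C) (a b : C) : f @ F --> a -> a = b -> f @ F --> b.
Proof. by move=> + <-. Qed.
Lemma ccvgM T (F : set_system T) (FF : Filter F) (f g : T -> C) (a b : C) :
  f @ F --> a -> g @ F --> b -> (fun x => f x * g x) @ F --> a * b.
Proof. exact: cvgM. Qed.
Lemma ccvgD T (F : set_system T) (FF : Filter F) (f g : T -> C) (a b : C) :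
  f @ F --> a -> g @ F --> b -> (fun x => f x + g x) @ F --> a + b.
Proof. exact: cvgD. Qed.
Lemma ccvgB T (F : set_system T) (FF : Filter F) (f g : T -> C) (a b : C) :
  f @ F --> a -> g @ F --> b -> (fun x => f x - g x) @ F --> a - b.
Proof. exact: cvgB. Qed.
Lemma ccvg_cst T (F : set_system T) (FF : Filter F) (a : C) : (fun _ : T => a) @ F --> a.
Proof. exact: cvg_cst. Qed.
Section At.
Variables (T : topologicalType) (t : T).
Implicit Types f g : T -> C.
Lemma at_cst (a : C) : {for t, continuous (fun _ : T => a)}.
Proof. exact: cvg_cst. Qed.
Lemma atM f g : {for t, continuous f} -> {for t, continuous g} -> {for t, continuous (fun x => f x * g x)}.
Proof. exact: cvgM. Qed.
Lemma atD f g : {for t, continuous f} -> {for t, continuous g} -> {for t, continuous (fun x => f x + g x)}.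
Proof. exact: cvgD. Qed.
Lemma atB f g : {for t, continuous f} -> {for t, continuous g} -> {for t, continuous (fun x => f x - g x)}.
Proof. exact: cvgB. Qed.
Lemma atN f : {for t, continuous f} -> {for t, continuous (fun x => - f x)}.
Proof. exact: cvgN. Qed.
Lemma atV f : f t != 0 -> {for t, continuous f} -> {for t, continuous (fun x => (f x)^-1)}.
Proof. exact: cvgV. Qed.
Lemma atX f n : {for t, continuous f} -> {for t, continuous (fun x => f x ^+ n)}.
Proof.
move=> cf; elim: n => [|n IH].
  by rewrite (_ : (fun x => _) = fun=> 1); [exact: at_cst|apply/funext => x; rewrite expr0].
by rewrite (_ : (fun x => _) = fun x => f x * f x ^+ n); [exact: atM|apply/funext => x; rewrite exprS].
Qed.
Lemma at_comp f (h : C -> C) : {for t, continuous f} -> {for f t, continuous h} ->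
  {for t, continuous (fun x => h (f x))}.
Proof. exact: cvg_comp. Qed.
Lemma at_rc (f : T -> R) : {for t, continuous f} -> {for t, continuous (fun x => rc (f x))}.
Proof. exact: cvg_rc. Qed.
Lemma at_cis (f : T -> R) : {for t, continuous f} -> {for t, continuous (fun x => cis (f x))}.
Proof. exact: cvg_cis. Qed.
Lemma at_cre f : {for t, continuous f} -> {for t, continuous (fun x => cre (f x))}.
Proof. exact: cvg_cre. Qed.
Lemma at_cim f : {for t, continuous f} -> {for t, continuous (fun x => cim (f x))}.
Proof. exact: cvg_cim. Qed.
Lemma at_cmod f : {for t, continuous f} -> {for t, continuous (fun x => cmod (f x))}.
Proof. exact: cvg_cmod. Qed.
Lemma at_cpt (f g : T -> R) : {for t, continuous f} -> {for t, continuous g} ->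
  {for t, continuous (fun x => cpt (f x) (g x) : C)}.
Proof. exact: cvg_cpt. Qed.
End At.
Lemma dnbhs0_cmod (P : C -> Prop) : (\forall h \near (0 : C)^', P h) <->
  exists2 d : R, 0 < d & forall h, h != 0 -> cmod h < d -> P h.
Proof.
split=> [/nbhs_ballP[d /= d0 H]|[d d0 H]].
  have dE : d = ((cre d)%:C%C : C).
    by move: d0; rewrite ltcE /= => /andP[/eqP h _]; apply: ceq.
  move: d0; rewrite dE ltcR => d0; exists (cre d); first by [].
  move=> h h0 hd; apply: H => //.
  by rewrite /ball /= sub0r normrN normCE dE ltcR.
have : \forall h \near (0 : C)^', cmod (h - 0) < d := nbhs_dnbhs (near_cmod 0 d0).
apply: filterS2 (nbhs_dnbhs_neq (0 : C)) => h h0.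
by rewrite subr0; exact: H.
Qed.

Lemma near_at (T : topologicalType) (t : T) (f g : T -> C) :
  (\forall w \near t, f w = g w) -> {for t, continuous f} -> {for t, continuous g}.
Proof.
move=> fg /cvgCP cf; apply/(@cvgCP _ _ (nbhs t) _) => e e0.
have fgt : f t = g t := nbhs_singleton fg.
by apply: filterS2 fg (cf e e0) => w -> ; rewrite fgt.
Qed.
Lemma at_id (T : topologicalType) (t : T) : {for t, continuous (fun x : T => x)}.
Proof. exact: cvg_id. Qed.

End Continuity.
Arguments ccvg_eq {R T F f a b}.
Arguments ccvgM {R T F FF f g a b}.
Arguments ccvgD {R T F FF f g a b}.
Arguments ccvgB {R T F FF f g a b}.
Arguments ccvg_cst {R T F FF a}.
Arguments cvg_rc {R T F FF f a}.
Arguments cvg_cis {R T F FF f a}.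
Arguments cvg_cre {R T F FF f a}.
Arguments cvg_cim {R T F FF f a}.
Arguments cvg_cmod {R T F FF f a}.

(** * Complex derivatives and velocities of curves *)

Section Derivatives.
Variable R : realType.
Local Notation C := (CC R).
Implicit Types (f g : C -> C) (z l m : C) (u : R -> C) (t : R).

(* Caratheodory's form of complex differentiability: continuity arguments replace estimates. *)
Definition cder f z l := exists g, [/\ forall w, f w - f z = g w * (w - z),
  {for z, continuous g} & g z = l].
Definition vel u t l := exists g : R -> C, [/\ forall s, u s - u t = g s * rc (s - t),
  {for t, continuous g} & g t = l].

Lemma cvg_subid z : (fun w => w - z) @ z --> (0 : C).
Proof. by apply/(@cvgCP _ _ (nbhs z) _) => e e0; have := near_cmod z e0; apply: filterS => w; rewrite subr0. Qed.

Lemma cder_continuous f z l : cder f z l -> {for z, continuous f}.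
Proof.
move=> [g [fg cg gl]].
have H : (fun w => f w - f z) @ z --> (0 : C); last exact: (iffLR (subr_cvg0 f (f z)) H).
rewrite (_ : (fun x => _) = (fun w => g w * (w - z))); last exact/funext.
have H2 : (fun w => w - z) @ z --> (0 : C) := cvg_subid z.
exact: (ccvg_eq (ccvgM cg H2) (mulr0 _)).
Qed.

Lemma vel_continuous u t l : vel u t l -> {for t, continuous u}.
Proof.
move=> [g [fg cg gl]].
have H : (fun w => u w - u t) @ t --> (0 : C); last exact: (iffLR (subr_cvg0 u (u t)) H).
rewrite (_ : (fun x => _) = (fun w => g w * rc (w - t))); last exact/funext.
have H1 : (fun w => w - t) @ t --> t - t by apply: cvgB; [exact: cvg_id|exact: cvg_cst].
have H2 : (fun w => rc (w - t)) @ t --> (0 : C).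
  by apply: (ccvg_eq (cvg_rc H1)); rewrite subrr.
exact: (ccvg_eq (ccvgM cg H2) (mulr0 _)).
Qed.

Lemma cder_cst a z : cder (fun=> a) z 0.
Proof. by exists (fun=> 0); split; [move=> w; rewrite subrr mul0r|exact: at_cst|by []]. Qed.
Lemma cder_id z : cder (fun w => w) z 1.
Proof. by exists (fun=> 1); split; [move=> w; rewrite mul1r|exact: at_cst|by []]. Qed.
Lemma cderD f g z l m : cder f z l -> cder g z m -> cder (fun w => f w + g w) z (l + m).
Proof.
move=> [f' [Hf cf <-]] [g' [Hg cg <-]]; exists (fun w => f' w + g' w); split; last by [].
  by move=> w; rewrite mulrDl -Hf -Hg; ring.
exact: (atD cf cg).
Qed.
Lemma cderM f g z l m : cder f z l -> cder g z m ->
  cder (fun w => f w * g w) z (l * g z + f z * m).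
Proof.
move=> [f' [Hf cf <-]] hg; have cg' := cder_continuous hg.
case: hg => [g' [Hg cg <-]].
exists (fun w => f' w * g w + f z * g' w); split; last by [].
  by move=> w; rewrite mulrDl mulrAC -Hf -mulrA -Hg; ring.
apply: atD; [exact: (atM cf cg')|apply: atM; [exact: at_cst|exact: cg]].
Qed.
Lemma cderN f z l : cder f z l -> cder (fun w => - f w) z (- l).
Proof.
move=> [f' [Hf cf <-]]; exists (fun w => - f' w); split; last by [].
  by move=> w; rewrite mulNr -Hf; ring.
exact: (atN cf).
Qed.
Lemma cderB f g z l m : cder f z l -> cder g z m -> cder (fun w => f w - g w) z (l - m).
Proof. by move=> hf hg; exact: (cderD hf (cderN hg)). Qed.
Lemma cderZ a f z l : cder f z l -> cder (fun w => a * f w) z (a * l).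
Proof.
move=> hf; have := cderM (cder_cst a z) hf; rewrite mul0r add0r; exact.
Qed.
Lemma cder_comp f g z l m : cder g (f z) m -> cder f z l -> cder (fun w => g (f w)) z (m * l).
Proof.
move=> [g' [Hg cg <-]] hf; have cf' := cder_continuous hf.
case: hf => [f' [Hf cf <-]].
exists (fun w => g' (f w) * f' w); split; last by [].
  by move=> w; rewrite Hg Hf mulrA.
exact: (atM (at_comp cf' cg) cf).
Qed.
(** A Caratheodory slope must work for all [w], also where [f] and [g] differ. The global difference
    quotient of [g], completed by the slope of [f] at [z], is such a slope, and continuity at [z]
    only sees the points nearby. *)
Lemma near_cder f g z l : (\forall w \near z, f w = g w) -> cder f z l -> cder g z l.
Proof.
move=> fg [f' [Hf cf <-]].
have fgz : f z = g z := nbhs_singleton fg.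
exists (fun w => if w == z then f' z else (g w - g z) / (w - z)); split.
- move=> w; case: eqVneq => [->|wz]; first by rewrite !subrr mulr0.
  by rewrite divfK // subr_eq0.
- apply: near_at cf; apply: filterS fg => w Ew.
  case: eqVneq => [->//|wz].
  by rewrite -Ew -fgz Hf mulfK // subr_eq0.
- by rewrite eqxx.
Qed.
Lemma cder_inv z : z != 0 -> cder (fun w => w^-1) z (- z ^- 2).
Proof.
(* Since [0^-1 = 0], the slope between [z] and [w = 0] is [- z^-1 / (0 - z) = z^-2], which the
   general formula does not give. *)
move=> z0; exists (fun w => if w == 0 then z ^- 2 else - (w * z)^-1); split.
- move=> w; case: eqVneq => [->|w0]; first by rewrite invr0; field.
  by field; rewrite z0 w0.
- have H1 : {for z, continuous (fun w : C => w * z)} by apply: atM; [exact: at_id|exact: at_cst].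
  have H2 : {for z, continuous (fun w : C => - (w * z)^-1)}.
    by apply: atN; apply: atV H1; rewrite mulf_neq0.
  apply: near_at H2.
  have z1 : 0 < cmod z by rewrite cmod_gt0.
  have := near_cmod z z1; apply: filterS => w; case: eqVneq => [->|//].
  by rewrite sub0r cmodN ltxx.
- by rewrite (negPf z0) expr2.
Qed.
Lemma cderX f z l n : cder f z l -> cder (fun w => f w ^+ n.+1) z (n.+1%:R * f z ^+ n * l).
Proof.
move=> hf; elim: n => [|n IH]; first by rewrite expr0 mulr1 mul1r.
rewrite (_ : (fun w => _) = fun w => f w * f w ^+ n.+1); last by apply/funext => x; rewrite exprS.
have := cderM hf IH; congr (cder _ _ _); rewrite -[in RHS]natr1 exprS; ring.
Qed.

Lemma cderP f z l : cder f z l <->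
  (fun h : C => (f (z + h) - f z) / h) @ (0 : C)^' --> l.
Proof.
split=> [[g [Hg cg <-]]|/cvgCP H].
- apply/cvgCP => e e0; have [d d0 Hd] := cvg_eps cg e0.
  apply/dnbhs0_cmod; exists d => // h h0 hd.
  rewrite Hg addrAC subrr add0r mulfK //; apply: Hd.
  by rewrite addrAC subrr add0r.
- exists (fun w => if w == z then l else (f w - f z) / (w - z)); split.
  + move=> w; case: eqVneq => [->|wz]; first by rewrite !subrr mulr0.
    by rewrite divfK // subr_eq0.
  + apply/(@cvgCP _ _ (nbhs z) _) => e e0; rewrite eqxx.
    have /dnbhs0_cmod[d d0 Hd] := H _ e0.
    have := near_cmod z d0; apply: filterS => w wz.
    case: eqVneq => [_|wz']; first by rewrite subrr cmod0.
    by have := Hd (w - z); rewrite subr_eq0 wz' wz (addrC z) subrK; apply.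
  + by rewrite eqxx.
Qed.

Lemma cdifferentiableP f z : cdifferentiable f z <-> exists l, cder f z l.
Proof. by split=> -[l] /cderP; exists l. Qed.

Lemma cder_cderiv f z l : cder f z l -> cderiv f z = l.
Proof. by move=> /cderP H; apply: cvg_lim => //; exact: norm_hausdorff. Qed.

Lemma cdifferentiable_cder f z : cdifferentiable f z -> cder f z (cderiv f z).
Proof. by move=> /cdifferentiableP[l fl]; rewrite (cder_cderiv fl). Qed.

Lemma vel_comp u f t l m : cder f (u t) m -> vel u t l -> vel (fun s => f (u s)) t (m * l).
Proof.
move=> [g' [Hg cg <-]] hf; have cf' := vel_continuous hf.
case: hf => [f' [Hf cf <-]].
exists (fun w => g' (u w) * f' w); split; last by [].
  by move=> w; rewrite Hg Hf mulrA.
exact: (atM (at_comp cf' cg) cf).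
Qed.
Lemma vel_cst a t : vel (fun=> a) t 0.
Proof. by exists (fun=> 0); split; [move=> w; rewrite subrr mul0r|exact: at_cst|by []]. Qed.
Lemma velM (f g : R -> C) t l m : vel f t l -> vel g t m ->
  vel (fun w => f w * g w) t (l * g t + f t * m).
Proof.
move=> [f' [Hf cf <-]] hg; have cg' := vel_continuous hg.
case: hg => [g' [Hg cg <-]].
exists (fun w => f' w * g w + f t * g' w); split; last by [].
  by move=> w; rewrite mulrDl mulrAC -Hf -mulrA -Hg; ring.
apply: atD; [exact: (atM cf cg')|apply: atM; [exact: at_cst|exact: cg]].
Qed.
Lemma velD (f g : R -> C) t l m : vel f t l -> vel g t m -> vel (fun w => f w + g w) t (l + m).
Proof.
move=> [f' [Hf cf <-]] [g' [Hg cg <-]]; exists (fun w => f' w + g' w); split; last by [].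
  by move=> w; rewrite mulrDl -Hf -Hg; ring.
exact: (atD cf cg).
Qed.
Lemma velZ a (f : R -> C) t l : vel f t l -> vel (fun w => a * f w) t (a * l).
Proof.
move=> hf; have := velM (vel_cst a t) hf; rewrite mul0r add0r; exact.
Qed.
Lemma vel_rc t : vel (@rc R) t 1.
Proof. by exists (fun=> 1); split; [move=> w; rewrite mul1r rcB|exact: at_cst|by []]. Qed.
Lemma vel_cis t : vel (@cis R) t (ci R * cis t).
Proof.
have /is_derive1_caratheodory[gc [Hc cc gct]] := is_derive_cos t.
have /is_derive1_caratheodory[gs [Hs cs gst]] := is_derive_sin t.
exists (fun s => cpt (gc s) (gs s)); split.
- by move=> s; apply: ceq; rewrite !creimE ?Hc ?Hs; ring.
- exact: at_cpt.
- by rewrite gct gst; apply: ceq; rewrite !creimE; ring.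
Qed.
Lemma vel_cre u t l : vel u t l -> is_derive t (1:R) (fun s => cre (u s)) (cre l).
Proof.
move=> [g [Hg cg <-]]; apply/is_derive1_caratheodory.
exists (fun s => cre (g s)); split; [|exact: at_cre|by []].
by move=> s; rewrite -creN -creD Hg !creimE mulr0 subr0.
Qed.
Lemma vel_cim u t l : vel u t l -> is_derive t (1:R) (fun s => cim (u s)) (cim l).
Proof.
move=> [g [Hg cg <-]]; apply/is_derive1_caratheodory.
exists (fun s => cim (g s)); split; [|exact: at_cim|by []].
by move=> s; rewrite -cimN -cimD Hg !creimE mulr0 add0r.
Qed.

End Derivatives.

(** * Integrals of continuous functions over segments *)

Section SegmentIntegrals.
Variable R : realType.
Local Notation C := (CC R).
Local Notation mu := (@lebesgue_measure R).
Implicit Types (a b c d : R) (f g : R -> R) (F G : R -> C).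

Definition RI a b f : R := Rintegral mu `[a, b] f.
Definition CI a b F : C := cpt (RI a b (fun t => cre (F t))) (RI a b (fun t => cim (F t))).

(** Continuity as a function on the whole line at every point of the segment, endpoints included;
    this pointwise form is stable under the operations without passing to subspace topologies. *)
Definition con (T : topologicalType) a b (f : R -> T) :=
  forall t, a <= t <= b -> {for t, continuous f}.

Lemma con_integrable a b f : con a b f -> mu.-integrable `[a, b] (EFin \o f).
Proof.
move=> cf; apply: continuous_compact_integrable; first exact: segment_compact.
by apply: continuous_in_subspaceT => t; rewrite inE /= in_itv /= => /cf.
Qed.

Lemma eq_RI a b f g : (forall t, a <= t <= b -> f t = g t) -> RI a b f = RI a b g.
Proof. by move=> fg; apply: eq_Rintegral => t; rewrite inE /= in_itv /=; exact: fg. Qed.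

Lemma RID a b f g : con a b f -> con a b g ->
  RI a b (fun t => f t + g t) = RI a b f + RI a b g.
Proof. by move=> cf cg; apply: RintegralD => //; exact: con_integrable. Qed.

Lemma RIB a b f g : con a b f -> con a b g ->
  RI a b (fun t => f t - g t) = RI a b f - RI a b g.
Proof. by move=> cf cg; apply: RintegralB => //; exact: con_integrable. Qed.

Lemma RIZ a b k f : con a b f -> RI a b (fun t => k * f t) = k * RI a b f.
Proof. by move=> cf; apply: RintegralZl => //; exact: con_integrable. Qed.

Lemma RI_le a b f g : con a b f -> con a b g -> (forall t, a <= t <= b -> f t <= g t) ->
  RI a b f <= RI a b g.
Proof.
move=> cf cg fg; apply: le_Rintegral; [by []|exact: con_integrable|exact: con_integrable|].
by move=> t; rewrite /= in_itv /=; exact: fg.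
Qed.

Lemma RI_ge0 a b f : (forall t, a <= t <= b -> 0 <= f t) -> 0 <= RI a b f.
Proof. by move=> f0; apply: Rintegral_ge0 => t; rewrite /= in_itv /=; exact: f0. Qed.

Lemma RI_cst a b k : a <= b -> RI a b (fun=> k) = k * (b - a).
Proof.
move=> ab; rewrite /RI Rintegral_cst //= lebesgue_measure_itv /= lte_fin.
case: ltP => [//|ba]; rewrite (_ : b = a) ?subrr ?mulr0 //.
by apply/eqP; rewrite eq_le ba ab.
Qed.

Lemma RI_split a c b f : con a b f -> a <= c <= b -> RI a b f = RI a c f + RI c b f.
Proof.
move=> cf /andP[ac cb].
have E : `[a, b]%classic = `[a, c] `|` `]c, b] :> set R.
  by rewrite -itv_bndbnd_setU // bnd_simp.
rewrite /RI E Rintegral_setU //; first last.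
- apply/disj_setPS => x [] /=; rewrite !in_itv /= => /andP[_ xc] /andP[cx _].
  by move: cx; rewrite ltNge xc.
- by rewrite -E; exact: con_integrable.
congr +%R; rewrite Rintegral_itv_obnd_cbnd //.
apply: (@integrableS _ _ _ mu `[a, b]) => //; last exact: con_integrable.
by rewrite E; exact: subsetUr.
Qed.

Lemma RI_FTC a b f (F' : R -> R) : a <= b -> (forall t, a <= t <= b -> is_derive t (1:R) F' (f t)) ->
  con a b f -> RI a b f = F' b - F' a.
Proof.
rewrite le_eqVlt => /predU1P[->|ab] dF cf.
  by rewrite subrr /RI set_itv1 Rintegral_set1.
rewrite /RI /Rintegral (@continuous_FTC2 _ f F') //.
- by apply: continuous_in_subspaceT => t; rewrite inE /= in_itv /= => /cf.
- have cF t : a <= t <= b -> {for t, continuous F'}.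
    move=> /dF dFt; apply: differentiable_continuous; apply/derivable1_diffP.
    exact: ex_derive.
  split.
  + by move=> t; rewrite in_itv /= => /andP[at_ tb]; apply: (@ex_derive _ _ _ _ _ _ (f t)); apply: dF; rewrite !ltW.
  + by apply: cvg_at_right_filter; apply: cF; rewrite lexx ltW.
  + by apply: cvg_at_left_filter; apply: cF; rewrite lexx ltW.
- move=> t; rewrite in_itv /= => /andP[at_ tb]; rewrite derive1E.
  by have dFt : is_derive t (1:R) F' (f t); [apply: dF; rewrite !ltW|rewrite derive_val].
Qed.

Lemma con_cre a b F : con a b F -> con a b (fun t => cre (F t)).
Proof. by move=> cF t /cF cFt; exact: (at_cre cFt). Qed.
Lemma con_cim a b F : con a b F -> con a b (fun t => cim (F t)).
Proof. by move=> cF t /cF cFt; exact: (at_cim cFt). Qed.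
Lemma con_cmod a b F : con a b F -> con a b (fun t => cmod (F t)).
Proof. by move=> cF t /cF cFt; exact: (at_cmod cFt). Qed.
Lemma conM a b F G : con a b F -> con a b G -> con a b (fun t => F t * G t).
Proof. by move=> cF cG t ab; exact: (atM (cF t ab) (cG t ab)). Qed.
Lemma conD a b F G : con a b F -> con a b G -> con a b (fun t => F t + G t).
Proof. by move=> cF cG t ab; exact: (atD (cF t ab) (cG t ab)). Qed.
Lemma conB a b F G : con a b F -> con a b G -> con a b (fun t => F t - G t).
Proof. by move=> cF cG t ab; exact: (atB (cF t ab) (cG t ab)). Qed.
Lemma conN a b F : con a b F -> con a b (fun t => - F t).
Proof. by move=> cF t ab; exact: (atN (cF t ab)). Qed.
Lemma con_cst (T : topologicalType) a b (k : T) : con a b (fun=> k).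
Proof. by move=> t _; exact: cvg_cst. Qed.
Lemma conZ a b (k : C) F : con a b F -> con a b (fun t => k * F t).
Proof. by move=> cF; apply: conM; [exact: con_cst|exact: cF]. Qed.
Lemma con_sub (T : topologicalType) a b c d (f : R -> T) : a <= c -> d <= b -> con a b f -> con c d f.
Proof.
move=> ac db cf t /andP[ct td]; apply: cf.
by rewrite (le_trans ac ct) (le_trans td db).
Qed.

Lemma eq_CI a b F G : (forall t, a <= t <= b -> F t = G t) -> CI a b F = CI a b G.
Proof. by move=> fg; rewrite /CI; congr cpt; apply: eq_RI => t /fg ->. Qed.

Lemma CID a b F G : con a b F -> con a b G ->
  CI a b (fun t => F t + G t) = CI a b F + CI a b G.
Proof.
move=> cf cg; apply: ceq; rewrite !creimE -RID;
  by [apply: eq_RI => t _; rewrite !creimE|exact: con_cre|exact: con_cim].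
Qed.

Lemma CIZ a b k F : con a b F -> CI a b (fun t => k * F t) = k * CI a b F.
Proof.
move=> cF; have cR := con_cre cF; have cI := con_cim cF.
have cZ u (h : R -> R) : con a b h -> con a b (fun t => u * h t).
  by move=> ch t /ch ?; apply: cvgM => //; exact: cvg_cst.
apply: ceq; rewrite !creimE -!RIZ //.
  rewrite -RIB; try exact: cZ.
  by apply: eq_RI => t _; rewrite !creimE.
rewrite -RID; try exact: cZ.
by apply: eq_RI => t _; rewrite !creimE.
Qed.

Lemma CIN a b F : con a b F -> CI a b (fun t => - F t) = - CI a b F.
Proof. by move=> cF; under eq_fun do rewrite -mulN1r; rewrite CIZ // mulN1r. Qed.

Lemma CIB a b F G : con a b F -> con a b G ->
  CI a b (fun t => F t - G t) = CI a b F - CI a b G.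
Proof.
by move=> cF cG; rewrite (CID cF (conN cG)) (CIN cG).
Qed.

Lemma CI_cst a b k : a <= b -> CI a b (fun=> k) = k * rc (b - a).
Proof. by move=> ab; apply: ceq; rewrite !creimE !RI_cst //; ring. Qed.

Lemma CI_split a c b F : con a b F -> a <= c <= b -> CI a b F = CI a c F + CI c b F.
Proof.
by move=> cf acb; apply: ceq; rewrite !creimE -RI_split //; [exact: con_cre|exact: con_cim].
Qed.

(** Rotated to a nonnegative real number, the integral of [F] is the integral of the real part of
    [k * F], which is at most [cmod (F t)] pointwise. *)
Lemma CI_norm a b F : con a b F -> cmod (CI a b F) <= RI a b (fun t => cmod (F t)).
Proof.
move=> cF; have [k k1 kE] := cmod_unit (CI a b F).
have -> : cmod (CI a b F) = RI a b (fun t => cre (k * F t)).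
  by rewrite -[LHS](cre_cpt _ 0) -/(rc _) -kE -CIZ.
apply: RI_le; [exact/con_cre/conZ|exact: con_cmod|].
move=> t _; apply: le_trans (ler_norm _) _; apply: le_trans (cre_le _) _.
by rewrite cmodM k1 mul1r.
Qed.

Lemma CI_bound a b F (M : R) : a <= b -> con a b F -> (forall t, a <= t <= b -> cmod (F t) <= M) ->
  cmod (CI a b F) <= M * (b - a).
Proof.
move=> ab cF FM; apply: le_trans (CI_norm cF) _; rewrite -RI_cst //.
by apply: RI_le => //; [exact: con_cmod|exact: con_cst].
Qed.

Lemma CI_FTC a b F G : a <= b -> (forall t, a <= t <= b -> vel F t (G t)) ->
  con a b G -> CI a b G = F b - F a.
Proof.
move=> ab dF cG; apply: ceq; rewrite !creimE.
  exact: (RI_FTC ab (fun t h => vel_cre (dF t h)) (con_cre cG)).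
exact: (RI_FTC ab (fun t h => vel_cim (dF t h)) (con_cim cG)).
Qed.

End SegmentIntegrals.

(** * Bisection of rectangles *)

Section Goursat.
Variable R : realType.
Local Notation C := (CC R).

(** The left ends increase and the right ends [x n + L / 2 ^+ n] decrease, so the supremum of the
    left ends lies in all the intervals. *)
Lemma nested_point (x : nat -> R) (L : R) : 0 <= L ->
  (forall n, x n <= x n.+1 <= x n + L / 2 ^+ n.+1) ->
  exists x0, forall n, x n <= x0 <= x n + L / 2 ^+ n.
Proof.
move=> L0 Hx.
have Hm n k : x n <= x (n + k)%N.
  elim: k => [|k IH]; first by rewrite addn0.
  by rewrite addnS; have /andP[h _] := Hx (n + k)%N; exact: le_trans h.
have Hu n k : x (n + k)%N + L / 2 ^+ (n + k) <= x n + L / 2 ^+ n.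
  elim: k => [|k IH]; first by rewrite addn0.
  apply: le_trans IH; rewrite addnS; have /andP[_ h] := Hx (n + k)%N.
  have -> : L / 2 ^+ (n + k) = L / 2 ^+ (n + k).+1 + L / 2 ^+ (n + k).+1.
    by rewrite exprS; field; rewrite expf_neq0.
  by rewrite addrA lerD2r.
have pos n : 0 <= L / 2 ^+ n by rewrite divr_ge0 // exprn_ge0.
have Hnm n m : x m <= x n + L / 2 ^+ n.
  have [mn|/ltnW nm] := leqP m n.
    by rewrite -(subnKC mn); apply: le_trans (Hm m (n - m)%N) _; rewrite lerDl.
  rewrite -(subnKC nm); apply: le_trans (Hu n (m - n)%N); by rewrite lerDl.
exists (sup (range x)) => n; apply/andP; split.
  apply: ub_le_sup; last by exists n.
  by exists (x 0%N + L / 2 ^+ 0) => _ [m _ <-].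
apply: ge_sup; first by exists (x 0%N); exists 0%N.
by move=> _ [m _ <-].
Qed.

(* Goursat's argument: one of the four quarters always carries at least a fourth of [N]. *)
Lemma quadrisection (N : R -> R -> R -> R -> R) (a b c d : R) :
  a <= b -> c <= d ->
  (forall x1 x2 y1 y2, a <= x1 -> x1 <= x2 -> x2 <= b -> c <= y1 -> y1 <= y2 -> y2 <= d ->
    let x := (x1 + x2) / 2 in let y := (y1 + y2) / 2 in
    N x1 x2 y1 y2 <= N x1 x y1 y + N x x2 y1 y + N x1 x y y2 + N x x2 y y2) ->
  (forall x0 y0, a <= x0 <= b -> c <= y0 <= d -> forall e, 0 < e -> exists2 h, 0 < h &
    forall x1 x2 y1 y2, a <= x1 -> x1 <= x0 -> x0 <= x2 -> x2 <= b ->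
      c <= y1 -> y1 <= y0 -> y0 <= y2 -> y2 <= d -> x2 - x1 < h -> y2 - y1 < h ->
      N x1 x2 y1 y2 <= e * ((x2 - x1) + (y2 - y1)) ^+ 2) ->
  N a b c d <= 0.
Proof.
move=> ab cd sub loc; rewrite leNgt; apply/negP => N0.
set k := N a b c d in N0.
pose L := b - a; pose H := d - c.
have L0 : 0 <= L by rewrite subr_ge0.
have H0 : 0 <= H by rewrite subr_ge0.
(* A rectangle of generation [n] is recorded by its lower left corner alone, its sides being
   [L / 2 ^+ n] and [H / 2 ^+ n]. The rule [step] takes the first quarter carrying a fourth of the
   value; if three quarters fail, subadditivity forces the fourth to succeed. *)
pose Nn n (p : R * R) := N p.1 (p.1 + L / 2 ^+ n) p.2 (p.2 + H / 2 ^+ n).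
pose step n (p : R * R) : R * R :=
  let l := L / 2 ^+ n.+1 in let h := H / 2 ^+ n.+1 in
  let q := Nn n p / 4 in
  if q <= Nn n.+1 p then p else
  if q <= Nn n.+1 (p.1 + l, p.2) then (p.1 + l, p.2) else
  if q <= Nn n.+1 (p.1, p.2 + h) then (p.1, p.2 + h) else (p.1 + l, p.2 + h).
pose p := fix p n := if n is m.+1 then step m (p m) else (a, c).
have pS n : p n.+1 = step n (p n) by [].
have half (X : R) n : X / 2 ^+ n = X / 2 ^+ n.+1 + X / 2 ^+ n.+1.
  by rewrite exprS; field; rewrite expf_neq0.
have pos (X : R) n : 0 <= X -> 0 <= X / 2 ^+ n by move=> ?; rewrite divr_ge0 // exprn_ge0.
have px n : (p n).1 <= (p n.+1).1 <= (p n).1 + L / 2 ^+ n.+1.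
  by rewrite pS /step; do !case: ifP => _ /=; rewrite lexx lerDl !pos.
have py n : (p n).2 <= (p n.+1).2 <= (p n).2 + H / 2 ^+ n.+1.
  by rewrite pS /step; do !case: ifP => _ /=; rewrite lexx lerDl !pos.
have rx n : a <= (p n).1 /\ (p n).1 + L / 2 ^+ n <= b.
  elim: n => [|n [IH1 IH2]]; first by rewrite /= expr0 divr1 lexx /L addrC subrK.
  have /andP[h1 h2] := px n; split; first exact: le_trans h1.
  by apply: le_trans IH2; rewrite (half L n) addrA lerD2r.
have ry n : c <= (p n).2 /\ (p n).2 + H / 2 ^+ n <= d.
  elim: n => [|n [IH1 IH2]]; first by rewrite /= expr0 divr1 lexx /H addrC subrK.
  have /andP[h1 h2] := py n; split; first exact: le_trans h1.
  by apply: le_trans IH2; rewrite (half H n) addrA lerD2r.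
have bigN n : k / 4 ^+ n <= Nn n (p n).
  elim: n => [|n IH].
    by rewrite /Nn /= !expr0 !divr1 /L /H !(addrC _ (_ - _)) !subrK.
  have := sub (p n).1 ((p n).1 + L / 2 ^+ n) (p n).2 ((p n).2 + H / 2 ^+ n).
  have [? ?] := rx n; have [? ?] := ry n.
  rewrite /= !lerDl !pos // => /(_ _ _ _ _ _ _)/wrap[]//.
  have -> : ((p n).1 + ((p n).1 + L / 2 ^+ n)) / 2 = (p n).1 + L / 2 ^+ n.+1.
    by rewrite (half L n); field.
  have -> : ((p n).2 + ((p n).2 + H / 2 ^+ n)) / 2 = (p n).2 + H / 2 ^+ n.+1.
    by rewrite (half H n); field.
  rewrite -/(Nn n (p n)) => hsub.
  have ex (X : R) : X + L / 2 ^+ n = X + L / 2 ^+ n.+1 + L / 2 ^+ n.+1 by rewrite (half L n) addrA.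
  have ey (X : R) : X + H / 2 ^+ n = X + H / 2 ^+ n.+1 + H / 2 ^+ n.+1 by rewrite (half H n) addrA.
  have hs : Nn n (p n) <= Nn n.+1 (p n) + Nn n.+1 ((p n).1 + L / 2 ^+ n.+1, (p n).2)
     + Nn n.+1 ((p n).1, (p n).2 + H / 2 ^+ n.+1)
     + Nn n.+1 ((p n).1 + L / 2 ^+ n.+1, (p n).2 + H / 2 ^+ n.+1).
    by move: hsub; rewrite ex ey /Nn /=.
  have k4 : k / 4 ^+ n.+1 = (k / 4 ^+ n) / 4 by rewrite exprS; field; rewrite expf_neq0.
  rewrite k4 ?pS /step.
  case: ifP => [h1|/negbT]; first lra.
  rewrite -ltNge => h1; case: ifP => [h2|/negbT]; first lra.
  rewrite -ltNge => h2; case: ifP => [h3|/negbT]; first lra.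
  rewrite -ltNge => h3; lra.
have [x0 Hx0] := nested_point L0 px.
have [y0 Hy0] := nested_point H0 py.
have x0ab : a <= x0 <= b.
  have /andP[h1 h2] := Hx0 0%N; have [h3 h4] := rx 0%N.
  by rewrite (le_trans h3 h1) (le_trans h2 h4).
have y0cd : c <= y0 <= d.
  have /andP[h1 h2] := Hy0 0%N; have [h3 h4] := ry 0%N.
  by rewrite (le_trans h3 h1) (le_trans h2 h4).
pose S := L + H; have S0 : 0 <= S by rewrite addr_ge0.
(* With this [e] the local bound [e * S ^+ 2 / 4 ^+ n] falls below the value [k / 4 ^+ n] carried by
   generation [n]. The [+ 1] covers [S = 0]. *)
have e0 : 0 < k / (S ^+ 2 + 1) by rewrite divr_gt0 // ltr_wpDl // sqr_ge0.
have [h h0 Hh] := loc x0 y0 x0ab y0cd _ e0.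
have [n Hn] : exists n, S / 2 ^+ n < h.
  have /cvgrPdist_lt/(_ h h0)[n _ Hn] : (fun n => S * (2^-1 : R) ^+ n) @ \oo --> (0 : R).
    rewrite -(mulr0 S); apply: cvgM; first exact: cvg_cst.
    by apply: cvg_expr; rewrite ger0_norm // invf_lt1 // ltr1n.
  exists n; have := Hn n (leqnn n); rewrite /= sub0r normrN ger0_norm.
    by rewrite exprVn.
  by rewrite mulr_ge0 // exprn_ge0.
have [h1 h2] := rx n; have [h3 h4] := ry n.
have /andP[h5 h6] := Hx0 n; have /andP[h7 h8] := Hy0 n.
have t2 : (0:R) < 2 ^+ n by rewrite exprn_gt0.
have LS : L / 2 ^+ n <= S / 2 ^+ n by rewrite ler_pM2r ?invr_gt0 // /S lerDl.
have HS : H / 2 ^+ n <= S / 2 ^+ n by rewrite ler_pM2r ?invr_gt0 // /S lerDr.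
have := Hh _ _ _ _ h1 h5 h6 h2 h3 h7 h8 h4.
rewrite !(addrC _ (_ / _)) !addrK => /(_ (le_lt_trans LS Hn) (le_lt_trans HS Hn)).
rewrite -mulrDl -/S !(addrC (_ / _)) -/(Nn n (p n)) => hle.
have := le_trans (bigN n) hle.
rewrite expr_div_n -exprM mulnC exprM (_ : 2 ^+ 2 = 4 :> R); last by rewrite expr2 -natrM.
have t4 : (0:R) < 4 ^+ n by rewrite exprn_gt0.
rewrite mulrA ler_pM2r ?invr_gt0 // leNgt => /negP; apply.
rewrite mulrAC ltr_pdivrMr ?ltr_wpDl ?sqr_ge0 // mulrDr mulr1 ltrDl //.
Qed.

End Goursat.

(** * Closed forms on rectangles *)

Section Cone.
Variable R : realType.
Local Notation C := (CC R).
Implicit Types (P Q : R -> R -> C).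

(** The counterclockwise integral of the form [P dx + Q dy] around the rectangle [[x1, x2] x
    [y1, y2]]. *)
Definition boundary P Q x1 x2 y1 y2 : C :=
  CI x1 x2 (fun x => P x y1 - P x y2) + CI y1 y2 (fun y => Q x2 y - Q x1 y).

(** The common [k] says that the form is closed at [(x0, y0)], in the uniform sense needed along
    whole edges. The linear parts contribute [k (y1 - y2) (x2 - x1) + k (x2 - x1) (y2 - y1) = 0], so
    only an error of order [e] times the squared half perimeter remains, as [quadrisection]
    requires. *)
Lemma green_goursat P Q (a b c d : R) : a <= b -> c <= d ->
  (forall y, c <= y <= d -> con a b (P^~ y)) ->
  (forall x, a <= x <= b -> con c d (Q x)) ->
  (forall x0 y0, a <= x0 <= b -> c <= y0 <= d -> exists k, forall e, 0 < e -> exists2 h, 0 < h &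
    forall x1 x2 y1 y2, a <= x1 -> x1 <= x0 -> x0 <= x2 -> x2 <= b ->
      c <= y1 -> y1 <= y0 -> y0 <= y2 -> y2 <= d -> x2 - x1 < h -> y2 - y1 < h ->
      (forall x, x1 <= x <= x2 ->
        cmod (P x y1 - P x y2 - k * rc (y1 - y2)) <= e * ((x2 - x1) + (y2 - y1))) /\
      (forall y, y1 <= y <= y2 ->
        cmod (Q x2 y - Q x1 y - k * rc (x2 - x1)) <= e * ((x2 - x1) + (y2 - y1)))) ->
  boundary P Q a b c d = 0.
Proof.
move=> ab cd cP cQ loc; apply/eqP; rewrite -cmod_eq0 eq_le cmod_ge0 andbT.
apply: (@quadrisection _ (fun x1 x2 y1 y2 => cmod (boundary P Q x1 x2 y1 y2))) => //.
- move=> x1 x2 y1 y2 ax1 x12 x2b cy1 y12 y2d; cbv beta zeta.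
  have mid (u v : R) : u <= v -> u <= (u + v) / 2 <= v by move=> uv; apply/andP; split; lra.
  have := mid x1 x2 x12; have := mid y1 y2 y12.
  set x := (x1 + x2) / 2; set y := (y1 + y2) / 2 => yy xx.
  have [x1x xx2] := andP xx; have [y1y yy2] := andP yy.
  have cPy v : y1 <= v <= y2 -> con x1 x2 (P^~ v).
    by move=> /andP[? ?]; apply: (con_sub ax1 x2b); apply: cP; rewrite (le_trans cy1) //= (le_trans _ y2d).
  have cQx v : x1 <= v <= x2 -> con y1 y2 (Q v).
    by move=> /andP[? ?]; apply: (con_sub cy1 y2d); apply: cQ; rewrite (le_trans ax1) //= (le_trans _ x2b).
  have Py1 : con x1 x2 (P^~ y1) by apply: cPy; rewrite lexx.
  have Py : con x1 x2 (P^~ y) by apply: cPy.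
  have Py2 : con x1 x2 (P^~ y2) by apply: cPy; rewrite lexx andbT.
  have Qx1 : con y1 y2 (Q x1) by apply: cQx; rewrite lexx.
  have Qx : con y1 y2 (Q x) by apply: cQx.
  have Qx2 : con y1 y2 (Q x2) by apply: cQx; rewrite lexx andbT.
  have sl (f : R -> C) : con x1 x2 f -> con x1 x f by apply: con_sub.
  have sr (f : R -> C) : con x1 x2 f -> con x x2 f by apply: con_sub.
  have tl (f : R -> C) : con y1 y2 f -> con y1 y f by apply: con_sub.
  have tr (f : R -> C) : con y1 y2 f -> con y y2 f by apply: con_sub.
  (* Each inner edge is traversed twice in opposite directions. *)
  suff -> : boundary P Q x1 x2 y1 y2 = boundary P Q x1 x y1 y + boundary P Q x x2 y1 y
     + boundary P Q x1 x y y2 + boundary P Q x x2 y y2.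
    apply: le_trans (cmodD _ _) _; rewrite lerD2r.
    apply: le_trans (cmodD _ _) _; rewrite lerD2r.
    exact: cmodD.
  rewrite /boundary.
  rewrite (CIB Py1 Py2) (CIB Qx2 Qx1).
  rewrite (CIB (sl _ Py1) (sl _ Py)) (CIB (sr _ Py1) (sr _ Py)).
  rewrite (CIB (sl _ Py) (sl _ Py2)) (CIB (sr _ Py) (sr _ Py2)).
  rewrite (CIB (tl _ Qx) (tl _ Qx1)) (CIB (tl _ Qx2) (tl _ Qx)).
  rewrite (CIB (tr _ Qx) (tr _ Qx1)) (CIB (tr _ Qx2) (tr _ Qx)).
  rewrite (CI_split Py1 xx) (CI_split Py2 xx) (CI_split Qx1 yy) (CI_split Qx2 yy).
  ring.
- move=> x0 y0 hx0 hy0 e e0; have [k Hk] := loc x0 y0 hx0 hy0.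
  have [h h0 Hh] := Hk e e0; exists h => // x1 x2 y1 y2 ax1 x10 x02 x2b cy1 y10 y02 y2d xh yh.
  have x12 := le_trans x10 x02; have y12 := le_trans y10 y02.
  have [HP HQ] := Hh x1 x2 y1 y2 ax1 x10 x02 x2b cy1 y10 y02 y2d xh yh.
  have cPy v : y1 <= v <= y2 -> con x1 x2 (P^~ v).
    by move=> /andP[? ?]; apply: (con_sub ax1 x2b); apply: cP; rewrite (le_trans cy1) //= (le_trans _ y2d).
  have cQx v : x1 <= v <= x2 -> con y1 y2 (Q v).
    by move=> /andP[? ?]; apply: (con_sub cy1 y2d); apply: cQ; rewrite (le_trans ax1) //= (le_trans _ x2b).
  have Py1 : con x1 x2 (P^~ y1) by apply: cPy; rewrite lexx.
  have Py2 : con x1 x2 (P^~ y2) by apply: cPy; rewrite lexx andbT.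
  have Qx1 : con y1 y2 (Q x1) by apply: cQx; rewrite lexx.
  have Qx2 : con y1 y2 (Q x2) by apply: cQx; rewrite lexx andbT.
  pose kP := k * rc (y1 - y2); pose kQ := k * rc (x2 - x1).
  have BP := conB (conB Py1 Py2) (@con_cst R C x1 x2 kP).
  have BQ := conB (conB Qx2 Qx1) (@con_cst R C y1 y2 kQ).
  have -> : boundary P Q x1 x2 y1 y2 = CI x1 x2 (fun x => P x y1 - P x y2 - kP) +
      CI y1 y2 (fun y => Q x2 y - Q x1 y - kQ).
    rewrite (CIB (conB Py1 Py2) (@con_cst R C x1 x2 kP)).
    rewrite (CIB (conB Qx2 Qx1) (@con_cst R C y1 y2 kQ)).
    rewrite !CI_cst // /boundary /kP /kQ !rcB; ring.
  apply: le_trans (cmodD _ _) _.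
  rewrite expr2 mulrA [X in _ <= X]mulrDr; apply: lerD.
    exact: (CI_bound x12 BP HP).
  exact: (CI_bound y12 BQ HQ).
Qed.

End Cone.

(** * The Cauchy form on a cone with vertex [z] *)

Section ConeIntegral.
Variable R : realType.
Local Notation C := (CC R).

(** This identity and the next isolate the deviations of Caratheodory slopes and of [a'] from their
    values at the base point; everything else in the increment is the linear part with the common
    factor [l * a']. *)
Lemma cone_slice_algebra (K : fieldType) (x f0 f1 f2 z1 z2 z0 g1 g2 l a0 a1 a2 b1 b2 d1 d2 a' : K) :
  x != 0 -> f1 - f0 = g1 * (z1 - z0) -> f2 - f0 = g2 * (z2 - z0) ->
  z1 - z2 = x * (a1 - a2) -> a1 - a0 = b1 * d1 -> a2 - a0 = b2 * d2 ->
  f1 / x - f2 / x - l * a' * (d1 - d2) =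
  x^-1 * ((g1 - l) * (z1 - z0) - (g2 - l) * (z2 - z0)) + l * ((b1 - a') * d1 - (b2 - a') * d2).
Proof.
move=> x0 E1 E2 E3 E4 E5.
have -> : f1 / x - f2 / x = x^-1 * (g1 * (z1 - z0) - g2 * (z2 - z0)) by rewrite -E1 -E2; ring.
rewrite !mulrBl -E4 -E5.
have E6 : a1 - a2 = (z1 - z2) / x by rewrite E3 mulrAC mulfV // mul1r.
have E7 : l * (a1 - a0 - a' * d1 - (a2 - a0 - a' * d2)) = l * ((z1 - z2) / x) - l * a' * (d1 - d2).
  by rewrite -E6; ring.
by rewrite E7; ring.
Qed.

Lemma cone_side_algebra (K : fieldType) (f1 f2 z1 z2 z0 f0 g1 g2 l a a' a0' x : K) :
  a != 0 -> f1 - f0 = g1 * (z1 - z0) -> f2 - f0 = g2 * (z2 - z0) -> z2 - z1 = x * a ->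
  f2 * (a' / a) - f1 * (a' / a) - l * a0' * x =
  ((g2 - l) * (z2 - z0) - (g1 - l) * (z1 - z0)) * (a' / a) + l * x * (a' - a0').
Proof.
move=> a0 E1 E2 E3.
have -> : f2 * (a' / a) - f1 * (a' / a) = (g2 * (z2 - z0) - g1 * (z1 - z0)) * (a' / a).
  by rewrite -E1 -E2; ring.
have E4 : l * x * a' = l * (z2 - z1) * (a' / a) by rewrite E3; field.
by rewrite [l * x * _]mulrBr E4; ring.
Qed.

Lemma dist_itv_le (u v s t : R) : u <= s <= v -> u <= t <= v -> `|s - t| <= v - u.
Proof. by move=> /andP[? ?] /andP[? ?]; rewrite ler_norml; apply/andP; split; lra. Qed.

Lemma dist_ends (u v t : R) : u <= t <= v -> `|u - t| + `|v - t| = v - u.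
Proof. by move=> /andP[? ?]; rewrite ler0_norm ?ger0_norm; lra. Qed.

(** The form is the pullback of [F(zeta) / (zeta - z) d zeta] under [zeta = z + x A(y)]: as
    [zeta - z = x A], one has [d zeta / (zeta - z) = dx / x + (A' / A) dy]. The bound [0 < a <= x]
    keeps away from the vertex. Differentiability of [F] at single points is enough, as in Goursat's
    theorem. *)
Lemma cone_integral (F : C -> C) (z : C) (A A' : R -> C) (a c d : R) : 0 < a -> a <= 1 -> c <= d ->
  (forall x y, a <= x <= 1 -> c <= y <= d -> exists l, cder F (z + rc x * A y) l) ->
  (forall y, c <= y <= d -> vel A y (A' y)) -> con c d A' ->
  (forall y, c <= y <= d -> A y != 0) ->
  boundary (fun x y => F (z + rc x * A y) / rc x) (fun x y => F (z + rc x * A y) * (A' y / A y)) a 1 c d = 0.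
Proof.
move=> a0 a1 cd dF dA cA' A0.
have cA y : c <= y <= d -> {for y, continuous A} by move=> /dA; exact: vel_continuous.
have ck y : c <= y <= d -> {for y, continuous (fun y => A' y / A y)}.
  by move=> yy; apply: atM; [exact: cA'|apply: atV; [exact: A0|exact: cA]].
apply: (green_goursat a1 cd).
- move=> y yy x xx; have [l Fl] := dF x y xx yy.
  have x0 : rc x != 0 :> C.
    by rewrite rc_eq0; case/andP: xx => ax _; rewrite gt_eqF // (lt_le_trans a0).
  apply: atM; last exact: (atV x0 (at_rc (@at_id _ x))).
  apply: (@at_comp _ _ _ (fun x => z + rc x * A y)); last exact: cder_continuous Fl.
  apply: atD; first exact: at_cst.
  by apply: atM; [exact: (at_rc (@at_id _ x))|exact: at_cst].
- move=> x xx y yy; have [l Fl] := dF x y xx yy.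
  apply: atM; last exact: ck.
  apply: (@at_comp _ _ _ (fun y => z + rc x * A y)); last exact: cder_continuous Fl.
  apply: atD; first exact: at_cst.
  by apply: atM; [exact: at_cst|exact: cA].
move=> x0 y0 hx0 hy0; have [l [G [HG cG Gl]]] := dF x0 y0 hx0 hy0.
have [B [HB cB BA']] := dA y0 hy0.
exists (l * A' y0) => e e0.
set z0 := z + rc x0 * A y0 in HG cG Gl.
pose k y := A' y / A y.
(* [K] is a Lipschitz constant at [(x0, y0)] for [(x, y) |-> z + x A(y)], and [kk] bounds [A' / A]
   near [y0]. *)
pose K := cmod (A' y0) + 1 + cmod (A y0); pose kk := cmod (k y0) + 1.
have K1 : 1 <= K by rewrite /K addrAC lerDr addr_ge0 // cmod_ge0.
have K0 : 0 < K := lt_le_trans ltr01 K1.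
have kk0 : 0 <= kk by rewrite addr_ge0 // cmod_ge0.
(* [D] dominates the constants of both error estimates below, so slopes accurate up to [eta] give
   increments accurate up to [e]. *)
pose D := cmod l + 2 * K / a + 2 * K * kk + 1.
have Ka0 : 0 <= 2 * K / a by rewrite divr_ge0 ?mulr_ge0 // ltW.
have Kk0 : 0 <= 2 * K * kk by rewrite !mulr_ge0 // ltW.
have D0 : 0 < D by rewrite ltr_wpDl // !addr_ge0 // cmod_ge0.
pose eta := Num.min 1 (e / D).
have eta0 : 0 < eta by rewrite lt_min ltr01 divr_gt0.
have eta1 : eta <= 1 by rewrite ge_min lexx.
have etaD : eta * D <= e by rewrite -ler_pdivlMr // ge_min lexx orbT.
have [d1 d10 H1] := cvg_epsR cB eta0.
have [d2 d20 H2] := cvg_epsR (cA' y0 hy0) eta0.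
have [d3 d30 H3] := cvg_epsR (ck y0 hy0) ltr01.
have [d4 d40 H4] := cvg_eps cG eta0.
pose h := Num.min (Num.min d1 d2) (Num.min d3 (d4 / (2 * K))).
have h0 : 0 < h by rewrite !lt_min d10 d20 d30 divr_gt0 // mulr_gt0.
have hd1 : h <= d1 by rewrite /h !ge_min lexx.
have hd2 : h <= d2 by rewrite /h !ge_min lexx orbT.
have hd3 : h <= d3 by rewrite /h !ge_min lexx !orbT.
have hd4 : h * (2 * K) <= d4 by rewrite -ler_pdivlMr ?mulr_gt0 // /h !ge_min lexx !orbT.
exists h => // x1 x2 y1 y2 ax1 x10 x02 x2b cy1 y10 y02 y2d xh yh.
set s := x2 - x1 + (y2 - y1).
have x12 := le_trans x10 x02; have y12 := le_trans y10 y02.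
have s2h : s < 2 * h by rewrite /s mulrDl mul1r ltrD.
have dy y : y1 <= y <= y2 -> `|y - y0| <= y2 - y1.
  by move=> yy; apply: dist_itv_le; rewrite ?yy // y10 y02.
have dx x : x1 <= x <= x2 -> `|x - x0| <= x2 - x1.
  by move=> xx; apply: dist_itv_le; rewrite ?xx // x10 x02.
have sx : x2 - x1 <= s by rewrite /s lerDl subr_ge0.
have sy : y2 - y1 <= s by rewrite /s lerDr subr_ge0.
have s0 : 0 <= s by rewrite /s addr_ge0 // subr_ge0.
have yh' y : y1 <= y <= y2 -> `|y - y0| < h by move=> /dy hy; apply: le_lt_trans yh.
pose zt x y := z + rc x * A y.
have Z x y : x1 <= x <= x2 -> y1 <= y <= y2 -> cmod (zt x y - z0) <= K * s.
  move=> xx yy.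
  have -> : zt x y - z0 = rc x * (B y * rc (y - y0)) + rc (x - x0) * A y0.
    by rewrite -HB /zt /z0 rcB; ring.
  apply: le_trans (cmodD _ _) _; rewrite !cmodM !cmod_rc /K [X in _ <= X]mulrDl.
  apply: lerD; last first.
    by rewrite mulrC ler_wpM2l ?cmod_ge0 // (le_trans (dx _ xx)).
  have x01 : `|x| <= 1.
    case/andP: xx => ? ?; rewrite ger0_norm; first exact: le_trans x2b.
    by rewrite (le_trans (ltW a0)) // (le_trans ax1).
  rewrite -[X in _ <= X]mul1r; apply: ler_pM => //; first by rewrite mulr_ge0 // cmod_ge0.
  apply: ler_pM => //; [exact: cmod_ge0| |exact: le_trans (dy _ yy) _].
  have := H1 y (lt_le_trans (yh' _ yy) hd1); rewrite BA' => HBy.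
  rewrite -[B y](subrK (A' y0)); apply: le_trans (cmodD _ _) _; rewrite addrC lerD2l.
  exact: le_trans (ltW HBy) _.
have Gz x y : x1 <= x <= x2 -> y1 <= y <= y2 -> cmod (G (zt x y) - l) <= eta.
  move=> xx yy; rewrite -Gl; apply/ltW/H4.
  apply: le_lt_trans (Z _ _ xx yy) _; apply: lt_le_trans hd4.
  by rewrite mulrC [2 * K]mulrC mulrCA [ltLHS]mulrC ltr_pM2l // mulrC.
have E x y : x1 <= x <= x2 -> y1 <= y <= y2 -> cmod ((G (zt x y) - l) * (zt x y - z0)) <= eta * (K * s).
  by move=> xx yy; rewrite cmodM ler_pM ?cmod_ge0 // ?Gz ?Z.
have E2 u v : cmod u <= eta * (K * s) -> cmod v <= eta * (K * s) -> cmod (u - v) <= eta * (2 * K) * s.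
  move=> hu hv; apply: le_trans (cmodB _ _) _; apply: le_trans (lerD hu hv) _.
  by rewrite le_eqVlt; apply/orP; left; apply/eqP; ring.
have y1y : y1 <= y1 <= y2 by rewrite lexx.
have y2y : y1 <= y2 <= y2 by rewrite lexx andbT.
have x1x : x1 <= x1 <= x2 by rewrite lexx.
have x2x : x1 <= x2 <= x2 by rewrite lexx andbT.
split.
- move=> x xx; rewrite -/(zt x y1) -/(zt x y2).
  have ax : a <= x by case/andP: xx => ? ?; exact: le_trans ax1 _.
  have rx0 : rc x != 0 :> C by rewrite rc_eq0 gt_eqF // (lt_le_trans a0).
  have E3 : zt x y1 - zt x y2 = rc x * (A y1 - A y2) by rewrite /zt; ring.
  have -> : rc (y1 - y2) = rc (y1 - y0) - rc (y2 - y0) :> C by rewrite -rcB; congr rc; ring.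
  rewrite (cone_slice_algebra l (A' y0) rx0 (HG (zt x y1)) (HG (zt x y2)) E3 (HB y1) (HB y2)).
  apply: le_trans (cmodD _ _) _; rewrite !cmodM cmodV cmod_rc.
  have xa : `|x|^-1 <= a^-1 by rewrite ger0_norm ?lef_pV2 ?posrE ?(lt_le_trans a0) // (le_trans (ltW a0)).
  have HBy y : y1 <= y <= y2 -> cmod ((B y - A' y0) * rc (y - y0)) <= eta * `|y - y0|.
    move=> yy; rewrite cmodM cmod_rc ler_wpM2r //.
    by have := H1 y (lt_le_trans (yh' _ yy) hd1); rewrite BA' => /ltW.
  have T1 : cmod (((G (zt x y1) - l) * (zt x y1 - z0)) - ((G (zt x y2) - l) * (zt x y2 - z0)))
      <= eta * (2 * K) * s by apply: E2; apply: E.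
  have T2 : cmod ((B y1 - A' y0) * rc (y1 - y0) - (B y2 - A' y0) * rc (y2 - y0)) <= eta * s.
    apply: le_trans (cmodB _ _) _; apply: le_trans (lerD (HBy _ y1y) (HBy _ y2y)) _.
    rewrite -mulrDr ler_pM2l //; apply: le_trans sy.
    by rewrite dist_ends ?y10.
  apply: le_trans (lerD (ler_pM _ _ xa T1) (ler_pM _ _ (lexx _) T2)) _; rewrite ?cmod_ge0 ?invr_ge0 //.
  have -> : a^-1 * (eta * (2 * K) * s) + cmod l * (eta * s) = eta * (cmod l + 2 * K / a) * s by ring.
  rewrite ler_wpM2r //; apply: le_trans etaD; rewrite ler_pM2l // /D -!addrA.
  by rewrite lerD2l lerDl addr_ge0.
- move=> y yy; rewrite -/(zt x2 y) -/(zt x1 y) -/(k y).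
  have Ay0 : A y != 0.
    by apply: A0; case/andP: yy => ? ?; rewrite (le_trans cy1) //= (le_trans _ y2d).
  have E3 : zt x2 y - zt x1 y = rc (x2 - x1) * A y by rewrite /zt rcB; ring.
  rewrite (cone_side_algebra l (A' y) (A' y0) Ay0 (HG (zt x1 y)) (HG (zt x2 y)) E3) -/(k y).
  apply: le_trans (cmodD _ _) _; rewrite cmodM [cmod (l * _ * _)]cmodM [cmod (l * _)]cmodM cmod_rc.
  have T1 : cmod (((G (zt x2 y) - l) * (zt x2 y - z0)) - ((G (zt x1 y) - l) * (zt x1 y - z0)))
      <= eta * (2 * K) * s by apply: E2; apply: E.
  have T2 : cmod (k y) <= kk.
    have := H3 y (lt_le_trans (yh' _ yy) hd3) => Hk.
    rewrite -[k y](subrK (k y0)); apply: le_trans (cmodD _ _) _; rewrite addrC /kk lerD2l.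
    exact: ltW.
  have T3 : cmod (A' y - A' y0) <= eta by apply/ltW/H2; exact: lt_le_trans (yh' _ yy) hd2.
  have T4 : cmod l * `|x2 - x1| <= cmod l * s.
    by rewrite ler_wpM2l ?cmod_ge0 // ger0_norm // subr_ge0.
  apply: le_trans (lerD (ler_pM _ _ T1 T2) (ler_pM _ _ T4 T3)) _; rewrite ?mulr_ge0 ?cmod_ge0 //.
  have -> : eta * (2 * K) * s * kk + cmod l * s * eta = eta * (cmod l + 2 * K * kk) * s by ring.
  rewrite ler_wpM2r //; apply: le_trans etaD; rewrite ler_pM2l // /D.
  have -> : cmod l + 2 * K / a + 2 * K * kk + 1 = cmod l + 2 * K * kk + (2 * K / a + 1) by ring.
  by rewrite lerDl addr_ge0.
Qed.

End ConeIntegral.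

(** * Integrals over the unit circle *)

Section Circle.
Variable R : realType.
Local Notation C := (CC R).
Implicit Types (F G : C -> C) (f g : C -> R) (z u w : C) (r : R).

(* The full circle is the half circle [Re u >= 0] together with its antipode: this spares any
   periodicity argument and matches polar coordinates with a signed radius. *)
Definition circ G : C := CI (- (pi / 2)) (pi / 2) (fun t => G (cis t) + G (- cis t)).
Definition rcirc f : R := RI (- (pi / 2)) (pi / 2) (fun t => f (cis t) + f (- cis t)).
Definition onc (T : topologicalType) (G : C -> T) := forall u, cmod u = 1 -> {for u, continuous G}.

Lemma halfpi_le : - (pi / 2) <= pi / 2 :> R.
Proof. by rewrite ge0_cp // divr_ge0 // pi_ge0. Qed.

Lemma cmod_Ncis t : cmod (- cis t : C) = 1. Proof. by rewrite cmodN cmod_cis. Qed.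

Lemma at_cist (t : R) : {for t, continuous (@cis R)}. Proof. exact: (at_cis (@at_id _ t)). Qed.
Lemma at_Ncist (t : R) : {for t, continuous (fun t => - cis t : C)}. Proof. exact: (atN (@at_cist t)). Qed.

Lemma onc_con1 (T : topologicalType) (G : C -> T) a b : onc G -> con a b (fun t => G (cis t)).
Proof.
move=> cG t _; apply: (@continuous_comp _ _ _ (@cis R) G); first exact: at_cist.
by apply: cG; rewrite cmod_cis.
Qed.
Lemma onc_con2 (T : topologicalType) (G : C -> T) a b : onc G -> con a b (fun t => G (- cis t)).
Proof.
move=> cG t _; apply: (@continuous_comp _ _ _ (fun t => - cis t) G); first exact: at_Ncist.
by apply: cG; rewrite cmod_Ncis.
Qed.
Lemma onc_con G a b : onc G -> con a b (fun t => G (cis t) + G (- cis t)).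
Proof. by move=> cG; exact: (conD (onc_con1 cG) (onc_con2 cG)). Qed.
Lemma onc_rcon f a b : onc f -> con a b (fun t => f (cis t) + f (- cis t)).
Proof.
move=> cf t tt; apply: cvgD; first exact: (onc_con1 cf tt).
exact: (onc_con2 cf tt).
Qed.

Lemma at_rM (T : topologicalType) (t : T) (f g : T -> R) :
  {for t, continuous f} -> {for t, continuous g} -> {for t, continuous (fun x => f x * g x)}.
Proof. exact: cvgM. Qed.
Lemma oncM F G : onc F -> onc G -> onc (fun u => F u * G u).
Proof. by move=> cF cG u u1; exact: (atM (cF u u1) (cG u u1)). Qed.
Lemma oncD F G : onc F -> onc G -> onc (fun u => F u + G u).
Proof. by move=> cF cG u u1; exact: (atD (cF u u1) (cG u u1)). Qed.
Lemma oncB F G : onc F -> onc G -> onc (fun u => F u - G u).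
Proof. by move=> cF cG u u1; exact: (atB (cF u u1) (cG u u1)). Qed.
Lemma onc_cst (T : topologicalType) (k : T) : onc (fun _ : C => k).
Proof. by move=> u _; exact: (@cst_continuous C T k u). Qed.
Lemma onc_id : onc (fun u : C => u).
Proof. by move=> u _; exact: at_id. Qed.
Lemma oncZ k G : onc G -> onc (fun u => k * G u).
Proof. by move=> cG; exact: (oncM (@onc_cst C k) cG). Qed.
Lemma oncV G : (forall u, cmod u = 1 -> G u != 0) -> onc G -> onc (fun u => (G u)^-1).
Proof. by move=> G0 cG u u1; exact: (atV (G0 u u1) (cG u u1)). Qed.
Lemma onc_cmod G : onc G -> onc (fun u => cmod (G u)).
Proof. by move=> cG u u1; exact: (at_cmod (cG u u1)). Qed.
Lemma onc_rc f : onc f -> onc (fun u => rc (f u)).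
Proof. by move=> cf u u1; exact: (at_rc (cf u u1)). Qed.
Lemma onc_rM f g : onc f -> onc g -> onc (fun u => f u * g u).
Proof. by move=> cf cg u u1; exact: (at_rM (cf u u1) (cg u u1)). Qed.
Lemma onc_comp (F G : C -> C) : onc G -> (forall u, cmod u = 1 -> {for G u, continuous F}) ->
  onc (fun u => F (G u)).
Proof. by move=> cG cF u u1; exact: (at_comp (cG u u1) (cF u u1)). Qed.

Lemma eq_circ F G : (forall u, cmod u = 1 -> F u = G u) -> circ F = circ G.
Proof. by move=> FG; apply: eq_CI => t _; rewrite !FG ?cmod_cis ?cmod_Ncis. Qed.
Lemma eq_rcirc f g : (forall u, cmod u = 1 -> f u = g u) -> rcirc f = rcirc g.
Proof. by move=> FG; apply: eq_RI => t _; rewrite !FG ?cmod_cis ?cmod_Ncis. Qed.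
Lemma circZ k G : onc G -> circ (fun u => k * G u) = k * circ G.
Proof.
move=> cG; rewrite /circ -(CIZ k (onc_con cG)).
by apply: eq_CI => t _; rewrite mulrDr.
Qed.
Lemma circB F G : onc F -> onc G -> circ (fun u => F u - G u) = circ F - circ G.
Proof.
move=> cF cG; rewrite /circ -(CIB (onc_con cF) (onc_con cG)).
by apply: eq_CI => t _; rewrite addrACA -opprD.
Qed.
Lemma circ_cst k : circ (fun=> k) = k * rc (2 * pi).
Proof.
rewrite /circ (CI_cst _ halfpi_le) opprK -splitr.
by apply: ceq; rewrite !creimE; ring.
Qed.
Lemma circ_conj G : onc G -> circ (fun u => conj (G u)) = conj (circ G).
Proof.
move=> cG; rewrite /circ; apply: ceq; rewrite !creimE.
  by apply: eq_RI => t _; rewrite !creimE.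
rewrite -[RHS]mulN1r -RIZ; last exact: (con_cim (onc_con cG)).
by apply: eq_RI => t _; rewrite !creimE mulN1r opprD.
Qed.
Lemma circ_norm G : onc G -> cmod (circ G) <= rcirc (fun u => cmod (G u)).
Proof.
move=> cG; apply: le_trans (CI_norm (onc_con cG)) _; apply: RI_le.
- exact: (con_cmod (onc_con cG)).
- exact: onc_rcon (onc_cmod cG).
- by move=> t _; exact: cmodD.
Qed.
Lemma circ_rc f : onc f -> circ (fun u => rc (f u)) = rc (rcirc f).
Proof.
move=> cf; apply: ceq; rewrite !creimE; first by apply: eq_RI => t _; rewrite !creimE.
rewrite -[RHS](mul0r (pi / 2 - - (pi / 2))) -RI_cst ?halfpi_le //.
by apply: eq_RI => t _; rewrite !creimE addr0.
Qed.
Lemma rcirc_le f g : onc f -> onc g -> (forall u, cmod u = 1 -> f u <= g u) -> rcirc f <= rcirc g.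
Proof.
move=> cf cg fg; apply: RI_le; [exact: onc_rcon|exact: onc_rcon|].
by move=> t _; rewrite lerD ?fg ?cmod_cis ?cmod_Ncis.
Qed.
Lemma rcirc_ge0 f : (forall u, cmod u = 1 -> 0 <= f u) -> 0 <= rcirc f.
Proof. by move=> f0; apply: RI_ge0 => t _; rewrite addr_ge0 ?f0 ?cmod_cis ?cmod_Ncis. Qed.
Lemma rcircZ k f : onc f -> rcirc (fun u => k * f u) = k * rcirc f.
Proof.
move=> cf; rewrite /rcirc -RIZ; last exact: onc_rcon.
by apply: eq_RI => t _; rewrite mulrDr.
Qed.
Lemma rcirc_cst r : rcirc (fun=> r) = r * (2 * pi).
Proof. by rewrite /rcirc (RI_cst _ halfpi_le) opprK -splitr; ring. Qed.

End Circle.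

(** * Contraction of a circle towards an interior point *)

Section CauchyFormula.
Variable R : realType.
Local Notation C := (CC R).
Implicit Types (F : C -> C) (z u w : C) (r : R).

Definition analytic_cdisc F r := forall w, cmod w <= r -> exists l, cder F w l.

Lemma analytic_cdisc_onc F r : 0 <= r -> analytic_cdisc F r -> onc (fun u => F (rc r * u)).
Proof.
move=> r0 dF; apply: onc_comp; first exact: oncZ (@onc_id R).
move=> u u1; have [l Fl] : exists l, cder F (rc r * u) l.
  by apply: dF; rewrite cmodM cmod_rc u1 mulr1 ger0_norm.
exact: cder_continuous Fl.
Qed.

Lemma sub_circle_neq0 z r u : cmod z < r -> cmod u = 1 -> rc r * u - z != 0.
Proof.
move=> zr u1; rewrite -cmod_gt0; apply: lt_le_trans (cmodB_ge _ _).
by rewrite cmodM cmod_rc u1 mulr1 subr_gt0 (lt_le_trans zr) ?ler_norm.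
Qed.

Lemma onc_sub_circle z r : onc (fun u => rc r * u - z).
Proof. by apply: oncB; [exact: oncZ (@onc_id R)|exact: onc_cst]. Qed.

Lemma cis_halfpi : cis (pi / 2) = ci R :> CC R.
Proof. by rewrite /cis cos_pihalf sin_pihalf. Qed.
Lemma cis_Nhalfpi : cis (- (pi / 2)) = - ci R :> CC R.
Proof. by rewrite /cis cosN sinN cos_pihalf sin_pihalf; apply: ceq; rewrite !creimE ?oppr0. Qed.

(** Each half circle, [s = 1] or [s = -1], spans a cone with vertex [z], whose boundary integral
    vanishes by [cone_integral]. The kernel is [A' / A], which does not change under contraction
    towards [z], so both arcs carry the same kernel. *)
Lemma circle_deformation F z r a : cmod z < r -> analytic_cdisc F r -> 0 < a -> a <= 1 ->
  circ (fun u => F (z + rc a * (rc r * u - z)) * (ci R * (rc r * u) / (rc r * u - z))) =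
  circ (fun u => F (rc r * u) * (ci R * (rc r * u) / (rc r * u - z))).
Proof.
move=> zr dF a0 a1; have r0 : 0 <= r by rewrite (le_trans (cmod_ge0 z)) // ltW.
pose A (s : C) (t : R) : C := rc r * (s * cis t) - z.
pose A' (s : C) (t : R) : C := ci R * (rc r * (s * cis t)).
have dA s y : vel (A s) y (A' s y).
  have := velD (velZ (rc r) (velZ s (@vel_cis R y))) (vel_cst (- z) y).
  by rewrite addr0 (_ : rc r * _ = A' s y) // /A'; ring.
have cA' s : con (- (pi / 2)) (pi / 2) (A' s).
  by apply: conZ; apply: conZ; apply: conZ => t _; exact: at_cist.
have inr s x y : cmod s = 1 -> 0 <= x -> x <= 1 -> cmod (z + rc x * A s y) <= r.
  move=> s1 x0 x1; have -> : z + rc x * A s y = rc (1 - x) * z + rc x * (rc r * (s * cis y)).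
    by rewrite /A rcB rc1; ring.
  apply: le_trans (cmodD _ _) _; rewrite !cmodM !cmod_rc s1 cmod_cis !mulr1 !ger0_norm ?subr_ge0 //.
  apply: le_trans (lerD (ler_wpM2l _ (ltW zr)) (lexx _)) _; first by rewrite subr_ge0.
  by rewrite -mulrDl subrK mul1r.
have AN0 s y : cmod s = 1 -> A s y != 0.
  by move=> s1; apply: sub_circle_neq0 => //; rewrite cmodM s1 cmod_cis mulr1.
have B s : cmod s = 1 -> boundary (fun x y => F (z + rc x * A s y) / rc x)
    (fun x y => F (z + rc x * A s y) * (A' s y / A s y)) a 1 (- (pi / 2)) (pi / 2) = 0.
  move=> s1; apply: cone_integral => //; first exact: halfpi_le.
  - move=> x y /andP[ax x1] _; apply: dF; apply: inr => //.
    by rewrite (le_trans (ltW a0)).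
  - by move=> y _; exact: AN0.
have cder_at s x y : cmod s = 1 -> 0 <= x -> x <= 1 -> {for z + rc x * A s y, continuous F}.
  by move=> s1 x0 x1; have [l] := dF _ (inr s x y s1 x0 x1); exact: cder_continuous.
have cx s y : cmod s = 1 -> con a 1 (fun x => F (z + rc x * A s y) / rc x).
  move=> s1 x /andP[ax x1]; have x0 := lt_le_trans a0 ax.
  apply: atM; last by apply: atV; [rewrite rc_eq0 gt_eqF|exact: (at_rc (@at_id _ x))].
  apply: (@at_comp _ _ _ (fun x => z + rc x * A s y)); last exact: cder_at s1 (ltW x0) x1.
  apply: atD; first exact: at_cst.
  by apply: atM; [exact: (at_rc (@at_id _ x))|exact: at_cst].
have cA s t : {for t, continuous (A s)} := vel_continuous (dA s t).
have cy s x : cmod s = 1 -> 0 <= x -> x <= 1 ->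
    con (- (pi / 2)) (pi / 2) (fun y => F (z + rc x * A s y) * (A' s y / A s y)).
  move=> s1 x0 x1 y yy.
  apply: atM; last by apply: atM; [exact: (cA' s y yy)|exact: (atV (AN0 s y s1) (cA s y))].
  apply: (@at_comp _ _ _ (fun y => z + rc x * A s y)); last exact: cder_at.
  apply: atD; first exact: at_cst.
  by apply: atM; [exact: at_cst|exact: cA].
have i1 : cmod (1 : C) = 1 := cmod1 R.
have i2 : cmod (-1 : C) = 1 by rewrite cmodN cmod1.
have B1 := B 1 i1; have B2 := B (-1) i2.
(* The two half circles share their endpoints, so the radial edges of the two cones cancel. *)
have AE1 : A 1 (- (pi / 2)) = A (-1) (pi / 2) by rewrite /A cis_halfpi cis_Nhalfpi; ring.
have AE2 : A 1 (pi / 2) = A (-1) (- (pi / 2)) by rewrite /A cis_halfpi cis_Nhalfpi; ring.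
have := B1; rewrite /boundary (CIB (cx 1 _ i1) (cx 1 _ i1)) AE1 AE2.
rewrite -(CIB (cx _ _ i2) (cx _ _ i2)) => B1'.
have X1 : CI a 1 (fun t => F (z + rc t * A (-1) (pi / 2)) / rc t - F (z + rc t * A (-1) (- (pi / 2))) / rc t)
   = - CI a 1 (fun t => F (z + rc t * A (-1) (- (pi / 2))) / rc t - F (z + rc t * A (-1) (pi / 2)) / rc t).
  by rewrite (CIB (cx _ _ i2) (cx _ _ i2)) (CIB (cx _ _ i2) (cx _ _ i2)) opprB.
move: B1' B2; rewrite /boundary X1.
have l01 : 0 <= (1 : R) by [].
rewrite (CIB (cy 1 1 i1 l01 (lexx _)) (cy 1 a i1 (ltW a0) a1)).
rewrite (CIB (cy (-1) 1 i2 l01 (lexx _)) (cy (-1) a i2 (ltW a0) a1)).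
set X := CI a 1 _; set Y1 := CI _ _ _; set Y2 := CI _ _ _; set Y3 := CI _ _ _; set Y4 := CI _ _ _.
move=> E1 E2.
have E3 : Y2 + Y4 = Y1 + Y3.
  apply/eqP; rewrite -subr_eq0.
  have -> : Y2 + Y4 - (Y1 + Y3) = - ((- X + (Y1 - Y2)) + (X + (Y3 - Y4))) by ring.
  by rewrite E1 E2 addr0 oppr0.
have -> : circ (fun u => F (z + rc a * (rc r * u - z)) * (ci R * (rc r * u) / (rc r * u - z))) = Y2 + Y4.
  rewrite /Y2 /Y4 -(CID (cy 1 a i1 (ltW a0) a1) (cy (-1) a i2 (ltW a0) a1)).
  by apply: eq_CI => t _; rewrite /A /A' mul1r mulN1r.
rewrite E3 /Y1 /Y3 -(CID (cy 1 1 i1 l01 (lexx _)) (cy (-1) 1 i2 l01 (lexx _))).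
apply: eq_CI => t _; rewrite /A /A' mul1r mulN1r rc1 !mul1r.
by congr (F _ * _ + F _ * _); ring.
Qed.

End CauchyFormula.

(** * The formulas of Cauchy and Poisson *)

Section CauchyPoisson.
Variable R : realType.
Local Notation C := (CC R).
Implicit Types (F : C -> C) (z u w : C) (r : R).

Lemma le_eps_mul (x M : R) : 0 <= M -> (forall e, 0 < e -> x <= e * M) -> x <= 0.
Proof.
move=> M0 H; rewrite leNgt; apply/negP => x0.
have M1 : 0 < M + 1 by rewrite ltr_wpDl.
have := H (x / (M + 1)) (divr_gt0 x0 M1).
rewrite mulrAC ler_pdivlMr // mulrDr mulr1 -subr_ge0 opprD addrA subrr sub0r oppr_ge0.
by rewrite leNgt x0.
Qed.

Lemma onc_ratio (G H : C -> C) : (forall u, cmod u = 1 -> H u != 0) -> onc G -> onc H ->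
  onc (fun u => G u / H u).
Proof. by move=> H0 cG cH; exact: (oncM cG (oncV H0 cH)). Qed.

(** By [circle_deformation] the left side may be computed on any contraction of the circle. As [a]
    tends to 0, the values [F (z + a (r u - z))] tend to [F z] uniformly in [u], since
    [|r u - z| <= 2 r]. *)
Lemma cauchy_unnormalized F z r : cmod z < r -> analytic_cdisc F r ->
  circ (fun u => F (rc r * u) * (ci R * (rc r * u) / (rc r * u - z))) =
  F z * circ (fun u => ci R * (rc r * u) / (rc r * u - z)).
Proof.
move=> zr dF; have r0 : 0 <= r by rewrite (le_trans (cmod_ge0 z)) // ltW.
pose k u := ci R * (rc r * u) / (rc r * u - z).
have ck : onc k.
  apply: onc_ratio; [by move=> u; exact: sub_circle_neq0| |exact: onc_sub_circle].
  by apply: oncZ; apply: oncZ; exact: onc_id.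
have [l Fl] := dF z (ltW zr); have cF := cder_continuous Fl.
apply/eqP; rewrite -subr_eq0 -cmod_eq0 eq_le cmod_ge0 andbT.
apply: (@le_eps_mul _ (rcirc (fun u => cmod (k u)))).
  by apply: rcirc_ge0 => u _; exact: cmod_ge0.
move=> e e0; have [d d0 Hd] := cvg_eps cF e0.
pose a := Num.min 1 (d / (2 * (r + 1))).
have r1 : 0 < r + 1 by rewrite ltr_wpDl.
have a0 : 0 < a by rewrite lt_min ltr01 divr_gt0 // mulr_gt0.
have a1 : a <= 1 by rewrite ge_min lexx.
have ad : a * (2 * r) < d.
  apply: (@lt_le_trans _ _ (a * (2 * (r + 1)))); first by rewrite !ltr_pM2l // ltrDl.
  by rewrite -ler_pdivlMr ?mulr_gt0 // /a ge_min lexx orbT.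
rewrite -(circle_deformation zr dF a0 a1) -/k.
have near u : cmod u = 1 -> cmod (F (z + rc a * (rc r * u - z)) - F z) < e.
  move=> u1; apply: Hd; rewrite addrAC subrr add0r cmodM cmod_rc (ger0_norm (ltW a0)).
  apply: le_lt_trans ad; rewrite ler_pM2l // (le_trans (cmodB _ _)) //.
  by rewrite cmodM cmod_rc u1 mulr1 ger0_norm // mulrDl mul1r lerD2l ltW.
have cFa : onc (fun u => F (z + rc a * (rc r * u - z))).
  apply: onc_comp.
    by apply: oncD; [exact: onc_cst|apply: oncZ; exact: onc_sub_circle].
  move=> u u1; have [m Fm] : exists m, cder F (z + rc a * (rc r * u - z)) m.
    apply: dF; have -> : z + rc a * (rc r * u - z) = rc (1 - a) * z + rc a * (rc r * u).
      by rewrite rcB rc1; ring.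
    apply: le_trans (cmodD _ _) _; rewrite !cmodM !cmod_rc u1 !mulr1 !ger0_norm ?subr_ge0 ?(ltW a0) //.
    apply: le_trans (lerD (ler_wpM2l _ (ltW zr)) (lexx _)) _; first by rewrite subr_ge0.
    by rewrite -mulrDl subrK mul1r.
  exact: cder_continuous Fm.
rewrite -(circZ (F z) ck) -(circB (oncM cFa ck) (oncZ (k:=F z) ck)).
have E : circ (fun u => F (z + rc a * (rc r * u - z)) * k u - F z * k u) =
    circ (fun u => (F (z + rc a * (rc r * u - z)) - F z) * k u).
  by apply: eq_circ => u _; rewrite mulrBl.
have cD := oncB cFa (@onc_cst R C (F z)).
rewrite E; apply: le_trans (circ_norm (oncM cD ck)) _.
rewrite -(rcircZ e (onc_cmod ck)); apply: rcirc_le.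
- exact: (onc_cmod (oncM cD ck)).
- by apply: onc_rM; [exact: onc_cst|exact: (onc_cmod ck)].
- by move=> u u1; rewrite cmodM ler_wpM2r ?cmod_ge0 // ltW // near.
Qed.

Lemma ci_neq0 : ci R != 0.
Proof. by rewrite -cmod_eq0 cmod_ci oner_eq0. Qed.

Lemma rc_circle_neq0 r u : 0 < r -> cmod u = 1 -> rc r * u != 0.
Proof. by move=> r0 u1; rewrite -cmod_gt0 cmodM cmod_rc u1 mulr1 gtr0_norm. Qed.

Lemma circ_ci_kernel F z r : cmod z < r -> analytic_cdisc F r ->
  circ (fun u => F (rc r * u) * (ci R * (rc r * u) / (rc r * u - z))) =
  ci R * circ (fun u => F (rc r * u) * ((rc r * u) / (rc r * u - z))).
Proof.
move=> zr dF; have r0 : 0 <= r by rewrite (le_trans (cmod_ge0 z)) // ltW.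
rewrite -circZ; first by apply: eq_circ => u _; ring.
apply: oncM; first exact: analytic_cdisc_onc.
apply: onc_ratio; [by move=> u; exact: sub_circle_neq0| |exact: onc_sub_circle].
by apply: oncZ; exact: onc_id.
Qed.

Lemma analytic_cdisc_cst (k : C) r : analytic_cdisc (fun=> k) r.
Proof. by move=> w _; exists 0; exact: cder_cst. Qed.

(** At [z = 0] the kernel is the constant [ci], so its total mass is known at once. *)
Lemma mean_value F r : 0 < r -> analytic_cdisc F r ->
  circ (fun u => F (rc r * u)) = F 0 * rc (2 * pi).
Proof.
move=> r0 dF; have z0 : cmod (0 : C) < r by rewrite cmod0.
have := cauchy_unnormalized z0 dF; rewrite (circ_ci_kernel z0 dF).
have -> : circ (fun u => F (rc r * u) * (rc r * u / (rc r * u - 0))) = circ (fun u => F (rc r * u)).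
  by apply: eq_circ => u u1; rewrite subr0 divff ?mulr1 // rc_circle_neq0.
have -> : circ (fun u => ci R * (rc r * u) / (rc r * u - 0)) = ci R * rc (2 * pi).
  rewrite -circ_cst; apply: eq_circ => u u1.
  by rewrite subr0 mulfK // rc_circle_neq0.
by rewrite mulrCA => /(mulfI ci_neq0).
Qed.

Lemma conj_circle r u z : cmod u = 1 -> conj (rc r * u - z) * u = rc r - conj z * u.
Proof.
move=> u1; rewrite conjD conjN conjM conj_rc mulrBl -mulrA [conj u * u]mulrC mul_conj u1.
by rewrite expr1n rc1 mulr1.
Qed.

Lemma unit_neq0 u : cmod u = 1 -> u != 0.
Proof. by move=> u1; rewrite -cmod_gt0 u1. Qed.

Lemma conj_neq0 z : (conj z == 0) = (z == 0).
Proof. by rewrite -!cmod_eq0 cmod_conj. Qed.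

Lemma one_sub_neq0 z w : cmod z * cmod w < 1 -> 1 - z * w != 0.
Proof.
move=> zw; rewrite -cmod_gt0; apply: lt_le_trans (cmodB_ge _ _).
by rewrite cmod1 cmodM subr_gt0.
Qed.

Lemma cder_affine_inv (k a z : C) : 1 - a * z != 0 ->
  cder (fun w => k / (1 - a * w)) z (k * a / (1 - a * z) ^+ 2).
Proof.
move=> az; have h1 := cderB (cder_cst 1 z) (cderZ a (cder_id z)).
have h2 := cderZ k (@cder_comp R (fun w => 1 - a * w) (fun w => w^-1) z _ _ (cder_inv az) h1).
have -> : k * a / (1 - a * z) ^+ 2 = k * (- (1 - a * z) ^- 2 * (0 - a * 1)) by ring.
exact: h2.
Qed.

(** For [F = 1] the formula [cauchy_unnormalized] is empty, so the mass of the kernel needs another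
    argument. On the circle the conjugate of the kernel is [1 / (1 - a u)] with [a = conj z / r],
    analytic on the closed unit disc, and its mean is its value 1 at the centre. *)
Lemma circ_cauchy_kernel z r : cmod z < r ->
  circ (fun u => rc r * u / (rc r * u - z)) = rc (2 * pi).
Proof.
move=> zr; have r0 : 0 < r := le_lt_trans (cmod_ge0 z) zr.
pose a := conj z / rc r.
have ca : cmod a < 1.
  by rewrite cmodM cmodV cmod_conj cmod_rc gtr0_norm // ltr_pdivrMr // mul1r.
have dH : analytic_cdisc (fun w => 1 / (1 - a * w)) 1.
  move=> w w1; exists (1 * a / (1 - a * w) ^+ 2); apply: cder_affine_inv.
  apply: one_sub_neq0; apply: le_lt_trans ca.
  by rewrite -[leRHS]mulr1 ler_wpM2l ?cmod_ge0.
have := mean_value ltr01 dH; rewrite mulr0 subr0 divr1 mul1r => E.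
rewrite -[RHS]conj_rc -E -circ_conj; last exact: (analytic_cdisc_onc ler01 dH).
apply: eq_circ => u u1; rewrite -[LHS]conjK; congr conj.
have u0 := unit_neq0 u1.
have rr : rc r != 0 :> C by rewrite rc_eq0 gt_eqF.
have d0 := sub_circle_neq0 zr u1.
rewrite rc1 !mul1r conjM conjV.
have E1 : conj (rc r * u) * u = rc r.
  by have := conj_circle r 0 u1; rewrite subr0 conj0 mul0r subr0.
have E2 := conj_circle r z u1.
have E3 : 1 - a * u = (rc r - conj z * u) / rc r by rewrite /a mulrBl divff // mulrAC.
have D0 : conj (rc r * u - z) != 0 by rewrite conj_neq0.
rewrite E3 invfM invrK -E2 -[X in _ = _ * X]E1.
set D := conj (rc r * u - z) in D0 *; set c := conj (rc r * u).
by rewrite invfM mulrACA mulVf // mulr1 mulrC.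
Qed.

Lemma cauchy_formula F z r : cmod z < r -> analytic_cdisc F r ->
  circ (fun u => F (rc r * u) * (rc r * u / (rc r * u - z))) = F z * rc (2 * pi).
Proof.
move=> zr dF; have := cauchy_unnormalized zr dF; rewrite (circ_ci_kernel zr dF).
have -> : circ (fun u => ci R * (rc r * u) / (rc r * u - z)) = ci R * rc (2 * pi).
  rewrite -(circ_cauchy_kernel zr) -circZ; first by apply: eq_circ => u _; rewrite -[LHS]mulrA.
  apply: onc_ratio; [by move=> u; exact: sub_circle_neq0| |exact: onc_sub_circle].
  by apply: oncZ; exact: onc_id.
by rewrite mulrCA => /(mulfI ci_neq0).
Qed.

Definition poisson r z u : R := (r ^+ 2 - cmod z ^+ 2) / cmod (rc r * u - z) ^+ 2.

Lemma poisson_ge0 r z u : cmod z <= r -> 0 <= poisson r z u.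
Proof.
move=> zr; rewrite divr_ge0 ?exprn_ge0 ?cmod_ge0 // subr_ge0.
by rewrite ler_pXn2r ?nnegrE ?cmod_ge0 // (le_trans (cmod_ge0 z)).
Qed.

Lemma at_rV (T : topologicalType) (t : T) (f : T -> R) : {for t, continuous f} ->
  f t != 0 -> {for t, continuous (fun x => (f x)^-1)}.
Proof. by move=> cf f0; exact: cvgV. Qed.

Lemma onc_poisson r z : cmod z < r -> onc (poisson r z).
Proof.
move=> zr u u1; have H := at_cmod (onc_sub_circle (z:=z) (r:=r) u1).
have n0 : cmod (rc r * u - z) ^+ 2 != 0 by rewrite expf_neq0 // cmod_eq0 sub_circle_neq0.
have c1 : {for u, continuous (fun _ : C => r ^+ 2 - cmod z ^+ 2)} by exact: (onc_cst u1).
have c2 : {for u, continuous (fun u : C => cmod (rc r * u - z) ^+ 2)} by exact: (at_rM H H).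
by rewrite /poisson; exact: (at_rM c1 (at_rV c2 n0)).
Qed.

Lemma poisson_algebra (K : fieldType) (s s2 u D cD X : K) :
  s != 0 -> s2 != 0 -> u != 0 -> D != 0 -> cD != 0 ->
  X / s2 / (s * (cD * u) / s2) * (s * u / D) = X / (D * cD).
Proof. by move=> s0 s20 u0 D0 cD0; field; rewrite s0 s20 u0 D0 cD0. Qed.

(** Cauchy's formula is applied to [F2 = F * k / (1 - a w)], whose extra factor has its pole at the
    reflected point [r^2 / conj z] and equals 1 at [z]. On the circle this factor turns the Cauchy
    kernel into the Poisson kernel. *)
Lemma poisson_formula F z r : cmod z < r -> analytic_cdisc F r ->
  circ (fun u => F (rc r * u) * rc (poisson r z u)) = F z * rc (2 * pi).
Proof.
move=> zr dF; have r0 : 0 < r := le_lt_trans (cmod_ge0 z) zr.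
have rr : rc r != 0 :> C by rewrite rc_eq0 gt_eqF.
pose a := conj z / rc (r ^+ 2).
have r20 : rc (r ^+ 2) != 0 :> C by rewrite rc_eq0 expf_neq0 ?gt_eqF.
have ar : cmod a * r < 1.
  rewrite cmodM cmodV cmod_conj cmod_rc gtr0_norm ?exprn_gt0 //.
  by rewrite mulrAC ltr_pdivrMr ?exprn_gt0 // mul1r expr2 ltr_pM2r.
pose k : C := rc (r ^+ 2 - cmod z ^+ 2) / rc (r ^+ 2).
pose F2 w := F w * (k / (1 - a * w)).
have dF2 : analytic_cdisc F2 r.
  move=> w wr; have [l Fl] := dF w wr.
  have az : 1 - a * w != 0.
    by apply: one_sub_neq0; apply: le_lt_trans ar; rewrite ler_wpM2l ?cmod_ge0.
  by eexists; apply: cderM Fl _; exact: cder_affine_inv.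
have azE w : 1 - a * w = (rc (r ^+ 2) - conj z * w) / rc (r ^+ 2).
  by rewrite /a mulrBl divff // mulrAC.
have FE : F2 z = F z.
  have zz : cmod z ^+ 2 < r ^+ 2 by rewrite ltr_pXn2r ?nnegrE ?cmod_ge0 // ltW.
  have n0 : rc (r ^+ 2 - cmod z ^+ 2) != 0 :> C by rewrite rc_eq0 subr_eq0 gt_eqF.
  rewrite /F2 azE [conj z * z]mulrC mul_conj -rcB /k divff ?mulr1 //.
  by rewrite mulf_neq0 // invr_eq0.
rewrite -FE -(cauchy_formula zr dF2); apply: eq_circ => u u1.
have u0 := unit_neq0 u1; have d0 := sub_circle_neq0 zr u1.
have c0 : conj (rc r * u - z) != 0 by rewrite conj_neq0.
rewrite /F2 -mulrA; congr (_ * _).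
rewrite azE /poisson rcM rcV -mul_conj.
have -> : rc (r ^+ 2) - conj z * (rc r * u) = rc r * (conj (rc r * u - z) * u).
  by rewrite conj_circle // expr2 rcM; ring.
symmetry; exact: poisson_algebra.
Qed.

Lemma rcirc_poisson z r : cmod z < r -> rcirc (poisson r z) = 2 * pi.
Proof.
move=> zr; have := poisson_formula zr (@analytic_cdisc_cst 1 r); rewrite mul1r => E.
have : rc (rcirc (poisson r z)) = rc (2 * pi) :> C.
  by rewrite -(circ_rc (onc_poisson zr)) -E; apply: eq_circ => u _; rewrite mul1r.
by move=> /(congr1 (@cre R)).
Qed.

Lemma poisson_sub_mean F z r : cmod z < r -> analytic_cdisc F r ->
  2 * pi * cmod (F z) <= rcirc (fun u => cmod (F (rc r * u)) * poisson r z u).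
Proof.
move=> zr dF; have r0 : 0 <= r by rewrite (le_trans (cmod_ge0 z)) // ltW.
have cF := analytic_cdisc_onc r0 dF.
have cP := onc_poisson zr.
have := circ_norm (oncM cF (onc_rc cP)); rewrite (poisson_formula zr dF) cmodM cmod_rc.
rewrite ger0_norm ?mulr_ge0 ?pi_ge0 // mulrC => H; apply: le_trans H _.
rewrite le_eqVlt; apply/orP; left; apply/eqP; apply: eq_rcirc => u u1.
by rewrite cmodM cmod_rc ger0_norm // poisson_ge0 // ltW.
Qed.

(* [|r v - s u| = |r u - s v|] for unimodular [u, v]. *)
Lemma poisson_sym (r s : R) u v : cmod u = 1 -> cmod v = 1 ->
  poisson r (rc s * v) u = poisson r (rc s * u) v.
Proof.
move=> u1 v1; rewrite /poisson !cmodM u1 v1; congr (_ / _ ^+ 2).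
have v0 := unit_neq0 v1.
rewrite -[LHS]cmod_conj -[LHS]mulr1 -{1}u1 -cmodM conj_circle //.
rewrite -[LHS]mulr1 -{1}v1 -cmodM mulrBl; congr cmod.
by rewrite conjM conj_rc -!mulrA [u * v]mulrC [conj v * _]mulrA [conj v * v]mulrC mul_conj v1 expr1n rc1 mul1r.
Qed.

End CauchyPoisson.

(** * Cauchy integrals, higher derivatives and estimates *)

Section CauchyIntegrals.
Variable R : realType.
Local Notation C := (CC R).
Implicit Types (F f g : C -> C) (z u w h : C) (r : R).

Lemma quad_cder f z l (B d : R) : 0 < d ->
  (forall h, cmod h <= d -> cmod (f (z + h) - f z - h * l) <= B * cmod h ^+ 2) -> cder f z l.
Proof.
move=> d0 H; exists (fun w => if w == z then l else (f w - f z) / (w - z)); split.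
- move=> w; case: eqVneq => [->|wz]; first by rewrite !subrr mulr0.
  by rewrite divfK // subr_eq0.
- apply/(@cvgCP _ _ (nbhs z) _) => e e0; rewrite eqxx.
  have B1 : 0 < `|B| + 1 by rewrite ltr_wpDl.
  have m0 : 0 < Num.min d (e / (`|B| + 1)) by rewrite lt_min d0 divr_gt0.
  have := near_cmod z m0; apply: filterS => w; rewrite lt_min => /andP[/ltW wd we].
  case: eqVneq => [_|wz]; first by rewrite subrr cmod0.
  have wz0 : w - z != 0 by rewrite subr_eq0.
  have c0 : 0 < cmod (w - z) by rewrite cmod_gt0.
  have := H (w - z) wd; rewrite (addrC z) subrK.
  have -> : f w - f z - (w - z) * l = ((f w - f z) / (w - z) - l) * (w - z).
    by rewrite [RHS]mulrBl divfK // [l * _]mulrC.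
  rewrite cmodM expr2 mulrA ler_pM2r // => hB; apply: le_lt_trans hB _.
  apply: (@le_lt_trans _ _ ((`|B| + 1) * cmod (w - z))).
    by rewrite ler_pM2r // (le_trans (ler_norm B)) // lerDl.
  by rewrite mulrC -ltr_pdivlMr.
- by rewrite eqxx.
Qed.

Lemma circ_quad g (K0 K1 Kh : C -> C) h (B : R) : onc g -> onc K0 -> onc K1 -> onc Kh ->
  (forall u, cmod u = 1 -> cmod (Kh u - K0 u - h * K1 u) <= B) ->
  cmod (circ (fun u => g u * Kh u) - circ (fun u => g u * K0 u) - h * circ (fun u => g u * K1 u))
  <= rcirc (fun u => cmod (g u)) * B.
Proof.
move=> cg c0 c1 ch HB.
rewrite -(circB (oncM cg ch) (oncM cg c0)) -(circZ h (oncM cg c1)).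
rewrite -(circB (oncB (oncM cg ch) (oncM cg c0)) (oncZ (oncM cg c1))).
have cD : onc (fun u => Kh u - K0 u - h * K1 u) := oncB (oncB ch c0) (oncZ c1).
have -> : circ (fun u => g u * Kh u - g u * K0 u - h * (g u * K1 u)) =
    circ (fun u => g u * (Kh u - K0 u - h * K1 u)).
  by apply: eq_circ => u _; ring.
apply: le_trans (circ_norm (oncM cg cD)) _.
rewrite mulrC -(rcircZ B (onc_cmod cg)); apply: rcirc_le.
- exact: onc_cmod (oncM cg cD).
- by apply: onc_rM; [exact: onc_cst|exact: (onc_cmod cg)].
- by move=> u u1; rewrite cmodM mulrC ler_wpM2r ?cmod_ge0 // HB.
Qed.

(** Up to the constant [ci], this is [d zeta / (zeta - z)^(n+1)] on the circle. No factorial is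
    included, hence the factor 2 in front of [cauchyint g r 2] below. *)
Definition ckernel r n z u : C := rc r * u / (rc r * u - z) ^+ n.+1.
Definition cauchyint g r n z : C := circ (fun u => g u * ckernel r n z u).

Lemma onc_ckernel r n z : cmod z < r -> onc (ckernel r n z).
Proof.
move=> zr; apply: onc_ratio.
- by move=> u u1; rewrite expf_neq0 // sub_circle_neq0.
- by apply: oncZ; exact: onc_id.
- by move=> u u1; exact: atX (onc_sub_circle u1).
Qed.

Lemma sub_circle_ge r s z u : cmod z <= s -> s <= r -> cmod u = 1 -> r - s <= cmod (rc r * u - z).
Proof.
move=> zs sr u1; have r0 : 0 <= r by rewrite (le_trans (cmod_ge0 z)) // (le_trans zs).
apply: le_trans (cmodB_ge _ _).
by rewrite cmodM cmod_rc u1 mulr1 ger0_norm // lerD2l lerN2.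
Qed.

Lemma sub_circle_le r s z u : cmod z <= s -> s <= r -> cmod u = 1 -> cmod (rc r * u - z) <= 2 * r.
Proof.
move=> zs sr u1; have r0 : 0 <= r by rewrite (le_trans (cmod_ge0 z)) // (le_trans zs).
apply: le_trans (cmodB _ _) _.
by rewrite cmodM cmod_rc u1 mulr1 ger0_norm // mulrDl mul1r lerD2l (le_trans zs).
Qed.

Lemma kernel0_algebra (K : fieldType) (b a h : K) : a != 0 -> a - h != 0 ->
  b / (a - h) - b / a - h * (b / a ^+ 2) = h ^+ 2 * (b / (a ^+ 2 * (a - h))).
Proof. by move=> a0 ah; field; rewrite a0 ah. Qed.

Lemma kernel1_algebra (K : fieldType) (b a h : K) : a != 0 -> a - h != 0 ->
  b / (a - h) ^+ 2 - b / a ^+ 2 - (h * 2%:R) * (b / a ^+ 3) =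
  h ^+ 2 * (b * (3%:R * a - 2%:R * h) / (a ^+ 3 * (a - h) ^+ 2)).
Proof. by move=> a0 ah; field; rewrite a0 ah. Qed.

Lemma cmod_nat n : cmod (n%:R : C) = n%:R.
Proof.
have -> : (n%:R : C) = rc n%:R.
  by elim: n => [//|n IH]; rewrite -!natr1 IH rcD.
by rewrite cmod_rc ger0_norm.
Qed.

(** The bounds depend on [z] only through [s], which later makes Taylor remainders uniform. With
    [a = r u - z], the denominators are controlled by [|a| >= r - s] and [|a - h| >= (r - s) / 2],
    and [8 * r] bounds [|3 a - 2 h| <= 6 r + (r - s)]. *)
Lemma kernel_quad r s z h u : 0 < s -> s < r -> cmod z <= s -> cmod h <= (r - s) / 2 -> cmod u = 1 ->
  cmod (ckernel r 0 (z + h) u - ckernel r 0 z u - h * ckernel r 1 z u)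
    <= r / ((r - s) ^+ 2 * ((r - s) / 2)) * cmod h ^+ 2 /\
  cmod (ckernel r 1 (z + h) u - ckernel r 1 z u - (h * 2%:R) * ckernel r 2 z u)
    <= r * (8 * r) / ((r - s) ^+ 3 * ((r - s) / 2) ^+ 2) * cmod h ^+ 2.
Proof.
move=> s0 sr zs hd u1; have r0 := lt_trans s0 sr.
set d := r - s in hd *; have d0 : 0 < d by rewrite subr_gt0.
have d2 : 0 < d / 2 by rewrite divr_gt0.
have a_ge := sub_circle_ge zs (ltW sr) u1; have a_le := sub_circle_le zs (ltW sr) u1.
set a := rc r * u - z in a_ge a_le.
rewrite -/d in a_ge.
have ah_ge : d / 2 <= cmod (a - h).
  apply: le_trans (cmodB_ge _ _); rewrite lerBrDr.
  apply: le_trans a_ge; rewrite [X in _ <= X](splitr d) lerD2l //.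
have a0 : a != 0 by rewrite -cmod_gt0 (lt_le_trans d0).
have ah0 : a - h != 0 by rewrite -cmod_gt0 (lt_le_trans d2).
have hE : rc r * u - (z + h) = a - h by rewrite opprD addrA.
have bE : cmod (rc r * u) = r by rewrite cmodM cmod_rc u1 mulr1 gtr0_norm.
have ca0 : 0 < cmod a by rewrite cmod_gt0.
have cah0 : 0 < cmod (a - h) by rewrite cmod_gt0.
split.
- rewrite /ckernel hE -/a !expr1 kernel0_algebra // cmodM cmodX mulrC.
  rewrite ler_wpM2r ?exprn_ge0 ?cmod_ge0 //.
  rewrite cmodM cmodV bE ler_pM2l // cmodM cmodX lef_pV2 ?posrE ?mulr_gt0 ?exprn_gt0 //.
  rewrite ler_pM ?exprn_ge0 ?(ltW d0) ?(ltW d2) //.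
  by rewrite ler_pXn2r ?nnegrE ?(ltW d0) ?(ltW ca0).
- rewrite /ckernel hE -/a kernel1_algebra // cmodM cmodX mulrC.
  rewrite ler_wpM2r ?exprn_ge0 ?cmod_ge0 //.
  rewrite cmodM cmodV cmodM bE ler_pM ?mulr_ge0 ?invr_ge0 ?cmod_ge0 ?(ltW r0) //.
    rewrite ler_pM2l //; apply: le_trans (cmodB _ _) _; rewrite !cmodM !cmod_nat.
    apply: (@le_trans _ _ (3 * (2 * r) + 2 * (d / 2))); first by rewrite lerD ?ler_wpM2l.
    have : d <= r by rewrite /d gerBl ltW.
    by rewrite [2 * (d / 2)]mulrC divfK // => dr; lra.
  rewrite cmodM !cmodX lef_pV2 ?posrE ?mulr_gt0 ?exprn_gt0 //.
  by rewrite ler_pM ?exprn_ge0 ?(ltW d0) ?(ltW d2) // ler_pXn2r ?nnegrE ?(ltW d0) ?(ltW ca0) ?(ltW d2) ?(ltW cah0).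
Qed.

Lemma cauchyint_quad g r s z h : onc g -> 0 < s -> s < r -> cmod z <= s -> cmod h <= (r - s) / 2 ->
  cmod (cauchyint g r 0 (z + h) - cauchyint g r 0 z - h * cauchyint g r 1 z)
    <= rcirc (fun u => cmod (g u)) * (r / ((r - s) ^+ 2 * ((r - s) / 2))) * cmod h ^+ 2 /\
  cmod (cauchyint g r 1 (z + h) - cauchyint g r 1 z - h * (2%:R * cauchyint g r 2 z))
    <= rcirc (fun u => cmod (g u)) * (r * (8 * r) / ((r - s) ^+ 3 * ((r - s) / 2) ^+ 2)) * cmod h ^+ 2.
Proof.
move=> cg s0 sr zs hd.
have zr : cmod z < r := le_lt_trans zs sr.
have zhr : cmod (z + h) < r.
  apply: le_lt_trans (cmodD _ _) _; apply: le_lt_trans (lerD zs hd) _; lra.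
have Q u (u1 : cmod u = 1) := kernel_quad s0 sr zs hd u1.
split; rewrite -mulrA.
  by apply: circ_quad; [by []|exact: onc_ckernel..|move=> u /Q[]].
rewrite mulrA.
by apply: circ_quad; [by []|exact: onc_ckernel..|move=> u /Q[]].
Qed.

(** Here [g] is merely continuous on the circle: this is what later makes limits of analytic
    functions analytic before anything but their continuity is known. *)
Lemma cder_cauchyint g r z : onc g -> cmod z < r ->
  cder (cauchyint g r 0) z (cauchyint g r 1 z) /\
  cder (cauchyint g r 1) z (2%:R * cauchyint g r 2 z).
Proof.
move=> cg zr; pose s := (cmod z + r) / 2; have r0 := le_lt_trans (cmod_ge0 z) zr.
have c0 := cmod_ge0 z.
have s0 : 0 < s by rewrite /s; lra.
have sr : s < r by rewrite /s; lra.
have zs : cmod z <= s by rewrite /s; lra.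
have d0 : 0 < (r - s) / 2 by lra.
have Q h (hd : cmod h <= (r - s) / 2) := cauchyint_quad cg s0 sr zs hd.
split; apply: (quad_cder d0) => h hd.
  exact: (proj1 (Q h hd)).
exact: (proj2 (Q h hd)).
Qed.

Lemma tpi_neq0 : rc (2 * pi) != 0 :> C.
Proof. by rewrite rc_eq0 mulf_neq0 // gt_eqF // pi_gt0. Qed.

Lemma tpi_gt0 : 0 < 2 * pi :> R.
Proof. by rewrite mulr_gt0 // pi_gt0. Qed.

Lemma cauchyint0 F r z : cmod z < r -> analytic_cdisc F r ->
  cauchyint (fun u => F (rc r * u)) r 0 z = F z * rc (2 * pi).
Proof.
move=> zr dF; rewrite -(cauchy_formula zr dF); apply: eq_circ => u _.
by rewrite /ckernel expr1.
Qed.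

Lemma analytic_cdisc_lt F r s : s <= r -> analytic_cdisc F r -> analytic_cdisc F s.
Proof. by move=> sr dF w ws; apply: dF; exact: le_trans sr. Qed.

Lemma cder_cauchy F r z : cmod z < r -> analytic_cdisc F r ->
  cder F z (cauchyint (fun u => F (rc r * u)) r 1 z / rc (2 * pi)).
Proof.
move=> zr dF; have r0 := le_lt_trans (cmod_ge0 z) zr.
have cg := analytic_cdisc_onc (ltW r0) dF.
have [H _] := cder_cauchyint cg zr.
have := cderZ (rc (2 * pi))^-1 H; rewrite [_ ^-1 * _]mulrC; apply: near_cder.
have d0 : 0 < r - cmod z by rewrite subr_gt0.
have := near_cmod z d0; apply: filterS => w wz.
have wr : cmod w < r.
  rewrite -(subrK z w); apply: le_lt_trans (cmodD _ _) _; by rewrite -ltrBrDr.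
by rewrite (cauchyint0 wr dF) mulrC mulfK // tpi_neq0.
Qed.

Lemma cderiv_cauchy F r z : cmod z < r -> analytic_cdisc F r ->
  cderiv F z = cauchyint (fun u => F (rc r * u)) r 1 z / rc (2 * pi).
Proof. by move=> zr dF; exact: cder_cderiv (cder_cauchy zr dF). Qed.

Lemma cderiv_analytic F r z : cmod z < r -> analytic_cdisc F r -> exists l, cder (cderiv F) z l.
Proof.
move=> zr dF; have r0 := le_lt_trans (cmod_ge0 z) zr.
have cg := analytic_cdisc_onc (ltW r0) dF.
have [_ H] := cder_cauchyint cg zr.
exists ((rc (2 * pi))^-1 * (2%:R * cauchyint (fun u => F (rc r * u)) r 2 z)).
have := cderZ (rc (2 * pi))^-1 H; apply: near_cder.
have d0 : 0 < r - cmod z by rewrite subr_gt0.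
have := near_cmod z d0; apply: filterS => w wz.
have wr : cmod w < r.
  rewrite -(subrK z w); apply: le_lt_trans (cmodD _ _) _; by rewrite -ltrBrDr.
by rewrite (cderiv_cauchy wr dF) mulrC.
Qed.

(** The constant is common to all [z] in the smaller disc, so that one may differentiate under an
    integral along a whole segment. *)
Lemma taylor_uniform F r s : 0 < s -> s < r -> analytic_cdisc F r ->
  exists B, forall z h, cmod z <= s -> cmod h <= (r - s) / 2 ->
    cmod (F (z + h) - F z - h * cderiv F z) <= B * cmod h ^+ 2.
Proof.
move=> s0 sr dF; have r0 := lt_trans s0 sr; have cg := analytic_cdisc_onc (ltW r0) dF.
exists ((2 * pi)^-1 * (rcirc (fun u => cmod (F (rc r * u))) * (r / ((r - s) ^+ 2 * ((r - s) / 2))))) => z h zs hd.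
have zr : cmod z < r := le_lt_trans zs sr.
have zhr : cmod (z + h) < r.
  apply: le_lt_trans (cmodD _ _) _; apply: le_lt_trans (lerD zs hd) _; lra.
have [H _] := cauchyint_quad cg s0 sr zs hd.
have E : F (z + h) - F z - h * cderiv F z = (cauchyint (fun u => F (rc r * u)) r 0 (z + h) -
   cauchyint (fun u => F (rc r * u)) r 0 z - h * cauchyint (fun u => F (rc r * u)) r 1 z) / rc (2 * pi).
  rewrite !(cauchyint0 _ dF) // (cderiv_cauchy zr dF) !mulrBl !mulfK ?tpi_neq0 // mulrA.
  by [].
rewrite E cmodM cmodV cmod_rc (gtr0_norm tpi_gt0) mulrC.
rewrite -mulrA; apply: ler_wpM2l H; by rewrite invr_ge0 ltW // tpi_gt0.
Qed.

(* The kernel of order two is a multiple of the Poisson kernel in modulus, so its mean is known exactly. *)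
Lemma cauchy_estimate F r z (M : R) : cmod z < r -> analytic_cdisc F r ->
  (forall w, cmod w = r -> cmod (F w) <= M) ->
  cmod (cderiv F z) <= M * r / (r ^+ 2 - cmod z ^+ 2).
Proof.
move=> zr dF FM; have r0 := le_lt_trans (cmod_ge0 z) zr.
have cg := analytic_cdisc_onc (ltW r0) dF; have ck := onc_ckernel (n:=1) zr.
have rz : 0 < r ^+ 2 - cmod z ^+ 2.
  by rewrite subr_gt0 ltr_pXn2r ?nnegrE ?cmod_ge0 // ltW.
rewrite (cderiv_cauchy zr dF) cmodM cmodV cmod_rc (gtr0_norm tpi_gt0) ler_pdivrMr ?tpi_gt0 //.
apply: le_trans (circ_norm (oncM cg ck)) _; rewrite -(rcirc_poisson zr) -rcircZ; last exact: onc_poisson.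
apply: rcirc_le.
- exact: onc_cmod (oncM cg ck).
- by apply: onc_rM; [exact: onc_cst|exact: onc_poisson].
move=> u u1; have bE : cmod (rc r * u) = r by rewrite cmodM cmod_rc u1 mulr1 gtr0_norm.
rewrite /ckernel /poisson !cmodM cmodV cmodX cmod_rc u1 mulr1 (gtr0_norm r0).
have -> : M * r / (r ^+ 2 - cmod z ^+ 2) * ((r ^+ 2 - cmod z ^+ 2) / cmod (rc r * u - z) ^+ 2) =
   M * (r / cmod (rc r * u - z) ^+ 2) by rewrite mulrA divfK ?gt_eqF // mulrA.
by rewrite ler_wpM2r ?FM // divr_ge0 ?exprn_ge0 ?cmod_ge0 // ltW.
Qed.

Lemma lipschitz_cauchy F r s z w : 0 < s -> s < r -> cmod z <= s -> cmod w <= s -> analytic_cdisc F r ->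
  2 * pi * cmod (F z - F w) <= cmod (z - w) * (r / (r - s) ^+ 2) * rcirc (fun u => cmod (F (rc r * u))).
Proof.
move=> s0 sr zs ws dF; have r0 := lt_trans s0 sr; have cg := analytic_cdisc_onc (ltW r0) dF.
have zr : cmod z < r := le_lt_trans zs sr; have wr : cmod w < r := le_lt_trans ws sr.
have d0 : 0 < r - s by rewrite subr_gt0.
have -> : 2 * pi * cmod (F z - F w) = cmod (cauchyint (fun u => F (rc r * u)) r 0 z - cauchyint (fun u => F (rc r * u)) r 0 w).
  by rewrite !(cauchyint0 _ dF) // -mulrBl cmodM cmod_rc (gtr0_norm tpi_gt0) mulrC.
have cz := onc_ckernel (n:=0) zr; have cw := onc_ckernel (n:=0) wr.
rewrite -(circB (oncM cg cz) (oncM cg cw)).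
apply: le_trans (circ_norm (oncB (oncM cg cz) (oncM cg cw))) _.
rewrite -rcircZ; last exact: onc_cmod.
apply: rcirc_le.
- exact: onc_cmod (oncB (oncM cg cz) (oncM cg cw)).
- by apply: onc_rM; [exact: onc_cst|exact: onc_cmod].
move=> u u1; rewrite -mulrBr cmodM mulrC ler_wpM2r ?cmod_ge0 //.
have z0 := sub_circle_neq0 zr u1; have w0 := sub_circle_neq0 wr u1.
have -> : ckernel r 0 z u - ckernel r 0 w u = (z - w) * (rc r * u / ((rc r * u - z) * (rc r * u - w))).
  by rewrite /ckernel !expr1; field; rewrite z0 w0.
rewrite cmodM ler_wpM2l ?cmod_ge0 // cmodM cmodV !cmodM cmod_rc u1 mulr1 gtr0_norm //.
rewrite ler_pM2l // lef_pV2 ?posrE ?mulr_gt0 ?exprn_gt0 ?cmod_gt0 // expr2.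
by rewrite ler_pM ?(ltW d0) // sub_circle_ge // ltW.
Qed.

End CauchyIntegrals.

(** * Analytic functions in the disc and their primitives *)

Section AnalyticDisc.
Variable R : realType.
Local Notation C := (CC R).
Implicit Types (F G f g : C -> C) (z u w h : C) (r s t : R).

Lemma analytic_discP F : analytic_disc F <-> forall z, cmod z < 1 -> exists l, cder F z l.
Proof. by split=> H z /H /cdifferentiableP. Qed.

Lemma analytic_disc_cder F z : analytic_disc F -> cmod z < 1 -> cder F z (cderiv F z).
Proof. by move=> dF z1; apply: cdifferentiable_cder; exact: dF. Qed.

Lemma analytic_disc_cdisc F r : analytic_disc F -> r < 1 -> analytic_cdisc F r.
Proof.
move=> dF r1 w wr; exists (cderiv F w); apply: analytic_disc_cder => //.
exact: le_lt_trans r1.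
Qed.

Lemma midpoint_lt1 (x : R) : 0 <= x -> x < 1 -> [/\ 0 < (1 + x) / 2, x < (1 + x) / 2 & (1 + x) / 2 < 1].
Proof. by move=> x0 x1; split; lra. Qed.

Lemma analytic_cderiv F : analytic_disc F -> analytic_disc (cderiv F).
Proof.
move=> dF; apply/analytic_discP => z z1.
have [m0 zm m1] := midpoint_lt1 (cmod_ge0 z) z1.
exact: cderiv_analytic zm (analytic_disc_cdisc dF m1).
Qed.

Lemma analyticM F G : analytic_disc F -> analytic_disc G -> analytic_disc (fun z => F z * G z).
Proof.
move=> dF dG; apply/analytic_discP => z z1; eexists.
exact: cderM (analytic_disc_cder dF z1) (analytic_disc_cder dG z1).
Qed.

Lemma analyticB F G : analytic_disc F -> analytic_disc G -> analytic_disc (fun z => F z - G z).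
Proof.
move=> dF dG; apply/analytic_discP => z z1; eexists.
exact: cderB (analytic_disc_cder dF z1) (analytic_disc_cder dG z1).
Qed.

Lemma cderivB F G z : analytic_disc F -> analytic_disc G -> cmod z < 1 ->
  cderiv (fun z => F z - G z) z = cderiv F z - cderiv G z.
Proof.
move=> dF dG z1; apply: cder_cderiv.
exact: cderB (analytic_disc_cder dF z1) (analytic_disc_cder dG z1).
Qed.

Lemma analytic_id : analytic_disc (fun z : C => z).
Proof. by apply/analytic_discP => z _; exists 1; exact: cder_id. Qed.

Lemma analytic_at F z : analytic_disc F -> cmod z < 1 -> {for z, continuous F}.
Proof. by move=> dF z1; exact: cder_continuous (analytic_disc_cder dF z1). Qed.

Lemma analytic_onc F r : analytic_disc F -> 0 <= r -> r < 1 -> onc (fun u => F (rc r * u)).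
Proof. by move=> dF r0 r1; apply: analytic_cdisc_onc r0 (analytic_disc_cdisc dF r1). Qed.

Lemma at_ray z t : {for t, continuous (fun t => rc t * z)}.
Proof. by apply: atM; [exact: (at_rc (@at_id _ t))|exact: at_cst]. Qed.

Lemma cmod_ray z t : 0 <= t -> t <= 1 -> cmod (rc t * z) <= cmod z.
Proof.
move=> t0 t1; rewrite cmodM cmod_rc ger0_norm // -[X in _ <= X]mul1r.
by rewrite ler_wpM2r ?cmod_ge0.
Qed.

Lemma con_ray F z : analytic_disc F -> cmod z < 1 -> con 0 1 (fun t => F (rc t * z)).
Proof.
move=> dF z1 t /andP[t0 t1]; apply: (@at_comp _ _ _ (fun t => rc t * z)); first exact: at_ray.
by apply: analytic_at => //; apply: le_lt_trans z1; exact: cmod_ray.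
Qed.

Lemma con_rc (a b : R) : con a b (@rc R).
Proof. by move=> t _; exact: (at_rc (@at_id _ t)). Qed.

Lemma vel_ray F z t : analytic_disc F -> cmod z < 1 -> 0 <= t -> t <= 1 ->
  vel (fun t => F (rc t * z)) t (cderiv F (rc t * z) * z).
Proof.
move=> dF z1 t0 t1.
have H : vel (fun t => rc t * z) t z.
  by have := velM (vel_rc t) (vel_cst z t); rewrite mulr0 addr0 mul1r.
apply: (@vel_comp _ (fun t => rc t * z) _ _ _ _ _ H); apply: analytic_disc_cder => //.
by apply: le_lt_trans z1; exact: cmod_ray.
Qed.

Lemma con_rM (a b : R) (f g : R -> R) : con a b f -> con a b g -> con a b (fun t => f t * g t).
Proof. by move=> cf cg t tt; exact: (at_rM (cf t tt) (cg t tt)). Qed.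
Lemma at_rD (T : topologicalType) (t : T) (f g : T -> R) :
  {for t, continuous f} -> {for t, continuous g} -> {for t, continuous (fun x => f x + g x)}.
Proof. exact: cvgD. Qed.
Lemma con_rD (a b : R) (f g : R -> R) : con a b f -> con a b g -> con a b (fun t => f t + g t).
Proof. by move=> cf cg t tt; exact: (at_rD (cf t tt) (cg t tt)). Qed.
Lemma con_rZ (a b k : R) (f : R -> R) : con a b f -> con a b (fun t => k * f t).
Proof. by move=> cf; apply: con_rM => //; exact: con_cst. Qed.

Definition primitive F z := z * CI 0 1 (fun t => F (rc t * z)).

Lemma TgE g f z : Tg g f z = primitive (fun w => f w * cderiv g w) z.
Proof. by []. Qed.

(** Differentiating under the integral gives the integrand [F(tz) + t z F'(tz)], called [L]. It is
    the [t]-derivative of [t F(tz)], so its integral is [F z]; independence of the path never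
    enters. *)
Lemma cder_primitive F z : analytic_disc F -> cmod z < 1 -> cder (primitive F) z (F z).
Proof.
move=> dF z1; have dF' := analytic_cderiv dF.
have [s0 zs s1] := midpoint_lt1 (cmod_ge0 z) z1; set s := (1 + cmod z) / 2 in s0 zs s1.
have [r0 sr r1] := midpoint_lt1 (ltW s0) s1; set r := (1 + s) / 2 in r0 sr r1.
have [B HB] := taylor_uniform s0 sr (analytic_disc_cdisc dF r1).
pose d := Num.min ((r - s) / 2) (s - cmod z).
have d0 : 0 < d by rewrite lt_min divr_gt0 ?subr_gt0.
have cF := con_ray dF z1; have cF' := con_ray dF' z1.
pose L t := F (rc t * z) + rc t * (cderiv F (rc t * z) * z).
have cL : con 0 1 L.
  apply: (conD cF); apply: (conM (@con_rc 0 1)).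
  by apply: (conM cF'); exact: con_cst.
have EL : CI 0 1 L = F z.
  rewrite (@CI_FTC _ _ _ (fun t => rc t * F (rc t * z))) //.
    by rewrite rc1 rc0 !mul1r mul0r subr0.
  move=> t /andP[t0 t1]; rewrite /L -{1}[F (rc t * z)]mul1r.
  exact: velM (vel_rc t) (vel_ray dF z1 t0 t1).
rewrite -EL; apply: (@quad_cder _ _ _ _ (`|B| + RI 0 1 (fun t => cmod (cderiv F (rc t * z)))) _ d0) => h hd.
have hr : cmod h <= (r - s) / 2 by rewrite (le_trans hd) // ge_min lexx.
have zhs : cmod (z + h) <= s.
  apply: le_trans (cmodD _ _) _; rewrite -lerBrDl (le_trans hd) // ge_min lexx orbT //.
have zh1 : cmod (z + h) < 1 := le_lt_trans zhs s1.
have cFh := con_ray dF zh1.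
rewrite /primitive -(CIZ (z + h) cFh) -(CIZ z cF) -(CIZ h cL).
have cA := conZ (k:=z + h) cFh; have cB := conZ (k:=z) cF; have cC := conZ (k:=h) cL.
rewrite -(CIB cA cB) -(CIB (conB cA cB) cC).
apply: le_trans (CI_norm (conB (conB cA cB) cC)) _.
pose M t := `|B| * cmod h ^+ 2 + cmod h ^+ 2 * cmod (cderiv F (rc t * z)).
have cM0 : con 0 1 (fun t => cmod h ^+ 2 * cmod (cderiv F (rc t * z))).
  by apply: con_rZ; exact: con_cmod.
have cM : con 0 1 M by apply: con_rD => //; exact: con_cst.
apply: (@le_trans _ _ (RI 0 1 M)); last first.
  rewrite /M RID //; last exact: con_cst.
  rewrite RI_cst // subr0 mulr1 RIZ; last exact: con_cmod.
  by rewrite mulrDl [X in _ + X]mulrC.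
apply: RI_le; [exact: con_cmod (conB (conB cA cB) cC)|exact: cM|].
move=> t /andP[t0 t1].
have tz : cmod (rc t * z) <= s by rewrite (le_trans (cmod_ray _ _ _)) // ltW.
have th : cmod (rc t * h) <= cmod h by exact: cmod_ray.
have := HB _ _ tz (le_trans th hr); set E := F _ - _ - _ => hE.
have -> : (z + h) * F (rc t * (z + h)) - z * F (rc t * z) - h * L t =
   (z + h) * E + rc t * (h ^+ 2 * cderiv F (rc t * z)).
  by rewrite /E /L mulrDr; ring.
apply: le_trans (cmodD _ _) _; apply: lerD.
  rewrite cmodM -[X in _ <= X]mul1r; apply: ler_pM; [exact: cmod_ge0|exact: cmod_ge0|exact: ltW|].
  apply: le_trans hE _; apply: (@le_trans _ _ (`|B| * cmod (rc t * h) ^+ 2)).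
    by rewrite ler_wpM2r ?exprn_ge0 ?cmod_ge0 ?ler_norm.
  by rewrite ler_wpM2l // ler_pXn2r ?nnegrE ?cmod_ge0.
rewrite cmodM cmod_rc (ger0_norm t0) [cmod (h ^+ 2 * _)]cmodM cmodX -[X in _ <= X]mul1r.
by rewrite ler_wpM2r // mulr_ge0 ?exprn_ge0 ?cmod_ge0.
Qed.

Lemma analytic_primitive F : analytic_disc F -> analytic_disc (primitive F).
Proof.
by move=> dF; apply/analytic_discP => z z1; exists (F z); exact: cder_primitive.
Qed.

Lemma analytic_Tg g f : analytic_disc g -> analytic_disc f -> analytic_disc (Tg g f).
Proof.
move=> dg df; exact: (analytic_primitive (analyticM df (analytic_cderiv dg))).
Qed.

Lemma cderiv_Tg g f z : analytic_disc g -> analytic_disc f -> cmod z < 1 ->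
  cderiv (Tg g f) z = f z * cderiv g z.
Proof.
move=> dg df z1; apply: cder_cderiv.
exact: (cder_primitive (analyticM df (analytic_cderiv dg)) z1).
Qed.

(** The function [(1 - t) f(tz)] runs from [f 0] to 0 and has derivative [z (1 - t) f'(tz) - f(tz)].
    The factor [1 - t] gained here compensates the growth of [f'] near the boundary. *)
Lemma ray_by_parts f z : analytic_disc f -> cmod z < 1 ->
  CI 0 1 (fun t => f (rc t * z)) =
  f 0 + z * CI 0 1 (fun t => rc (1 - t) * cderiv f (rc t * z)).
Proof.
move=> df z1; have df' := analytic_cderiv df.
have cf := con_ray df z1; have cf' := con_ray df' z1.
have cr : con 0 1 (fun t => rc (1 - t) : C).
  have -> : (fun t => rc (1 - t) : C) = fun t => 1 - rc t by apply/funext => t; rewrite rcB rc1.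
  exact: (conB (@con_cst R C 0 1 1) (@con_rc 0 1)).
have cz : con 0 1 (fun t => z * (rc (1 - t) * cderiv f (rc t * z))) := conZ (conM cr cf').
have F01 : CI 0 1 (fun t => z * (rc (1 - t) * cderiv f (rc t * z)) - f (rc t * z)) = - f 0.
  have D t : 0 <= t <= 1 -> vel (fun t => rc (1 - t) * f (rc t * z)) t
      (z * (rc (1 - t) * cderiv f (rc t * z)) - f (rc t * z)).
    move=> /andP[t0 t1].
    have vr : vel (fun t => rc (1 - t) : C) t (-1).
      have -> : (fun t => rc (1 - t) : C) = fun t => 1 + (-1) * rc t.
        by apply/funext => x; rewrite rcB rc1 mulN1r.
      by have := velD (vel_cst 1 t) (velZ (-1) (vel_rc t)); rewrite add0r mulr1.
    have E : z * (rc (1 - t) * cderiv f (rc t * z)) - f (rc t * z) =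
        -1 * f (rc t * z) + rc (1 - t) * (cderiv f (rc t * z) * z) by ring.
    rewrite E; exact: velM vr (vel_ray df z1 t0 t1).
  rewrite (CI_FTC ler01 D (conB cz cf)) subrr subr0 rc0 rc1 !mul0r mul1r sub0r.
  by [].
have := F01; rewrite (CIB cz cf) (CIZ z (conM cr cf')) => E.
apply/eqP; rewrite -subr_eq0; apply/eqP.
set X := z * _ in E *; set Y := CI _ _ _ in E *.
have -> : Y - (f 0 + X) = - (X - Y) - f 0 by ring.
by rewrite E opprK subrr.
Qed.

Lemma circle_mean_bound F z r : cmod z < r -> analytic_cdisc F r ->
  2 * pi * cmod (F z) <= r / (r - cmod z) * rcirc (fun u => cmod (F (rc r * u))).
Proof.
move=> zr dF; have r0 := le_lt_trans (cmod_ge0 z) zr.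
have cF := analytic_cdisc_onc (ltW r0) dF.
have ck := onc_ckernel (n:=0) zr.
have -> : 2 * pi * cmod (F z) = cmod (circ (fun u => F (rc r * u) * ckernel r 0 z u)).
  by rewrite -/(cauchyint _ r 0 z) (cauchyint0 zr dF) cmodM cmod_rc (gtr0_norm (tpi_gt0 R)) mulrC.
apply: le_trans (circ_norm (oncM cF ck)) _; rewrite -rcircZ; last exact: onc_cmod.
apply: rcirc_le.
- exact: onc_cmod (oncM cF ck).
- by apply: onc_rM; [exact: onc_cst|exact: onc_cmod].
move=> u u1; rewrite cmodM mulrC ler_wpM2r ?cmod_ge0 //.
rewrite /ckernel expr1 cmodM cmodV cmodM cmod_rc u1 mulr1 gtr0_norm // ler_pM2l //.
by rewrite lef_pV2 ?posrE ?subr_gt0 ?cmod_gt0 ?sub_circle_neq0 // (sub_circle_ge (lexx _) (ltW zr)).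
Qed.

Lemma constant_of_cderiv0 g : analytic_disc g -> (forall z, cmod z < 1 -> cderiv g z = 0) ->
  constant_disc g.
Proof.
move=> dg g0; exists (g 0) => z z1.
have := @CI_FTC R 0 1 (fun t => g (rc t * z)) (fun t => cderiv g (rc t * z) * z) ler01.
have c : con 0 1 (fun t => cderiv g (rc t * z) * z).
  by apply: (conM (con_ray (analytic_cderiv dg) z1)); exact: con_cst.
rewrite rc1 rc0 mul1r mul0r => /(_ _ c) E.
apply/eqP; rewrite -subr_eq0 -E; last by move=> t /andP[t0 t1]; exact: vel_ray.
rewrite (@eq_CI _ _ _ _ (fun=> 0)); first by rewrite CI_cst // mul0r.
move=> t /andP[t0 t1]; rewrite g0 ?mul0r //.
by apply: le_lt_trans z1; exact: cmod_ray.
Qed.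

End AnalyticDisc.

(** * Measurability in the plane and scaling of Lebesgue measure *)

Section PlaneMeasurability.
Variable R : realType.
Local Notation C := (CC R).
Local Notation mu := (@lebesgue_measure R).

(** An open set is the union of the half-open boxes with rational corners that it contains, and
    there are countably many of them. *)
Lemma open_measurable_plane (U : set (R * R)) : open U -> measurable (U : set (measurableTypeR R * measurableTypeR R)).
Proof.
move=> oU.
pose box (q : rat * rat * (rat * rat)) : set (R * R) :=
  `]ratr q.1.1, ratr q.1.2[%classic `*` `]ratr q.2.1, ratr q.2.2[%classic.
have -> : U = \bigcup_(q in [set q | box q `<=` U]) box q.
  rewrite eqEsubset; split => [[x y] Uxy|p [q qU qp]]; last exact: qU.
  have := oU; rewrite openE => /(_ _ Uxy) /nbhs_ballP[e /= e0 He].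
  have near (s : R) : exists a b : rat, [/\ s - e < ratr a, ratr a < s, s < ratr b & ratr b < s + e].
    have /rat_in_itvoo[a] : s - e < s by rewrite ltrBlDr ltrDl.
    have /rat_in_itvoo[b] : s < s + e by rewrite ltrDl.
    by rewrite !in_itv /= => /andP[? ?] /andP[? ?]; exists a, b.
  have [a [b [a1 a2 b1 b2]]] := near x; have [c [d [c1 c2 d1 d2]]] := near y.
  exists ((a, b), (c, d)); last by split; rewrite /= in_itv /= ?a2 ?b1 ?c2 ?d1.
  move=> [x' y'] [/=]; rewrite !in_itv /= => /andP[? ?] /andP[? ?]; apply: He; split => /=.
    by rewrite /ball /= ltr_norml; apply/andP; split; lra.
  by rewrite /ball /= ltr_norml; apply/andP; split; lra.
rewrite bigcup_mkcond; apply: countable_bigcupT_measurable => [|q]; first exact: countableP.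
by case: ifP => _ //; apply: measurableX; exact: measurable_itv.
Qed.

Lemma cts_measurable_plane (D : set (R * R)) (f : R * R -> R) : open D ->
  (forall p, D p -> {for p, continuous f}) ->
  measurable_fun (D : set (measurableTypeR R * measurableTypeR R)) (f : _ -> measurableTypeR R).
Proof.
move=> oD cf; have cD : {in D, continuous f} by move=> p; rewrite inE; exact: cf.
apply: (measurability _ (measurable_realfun.RGenOpens.measurableE R)).
move=> _ [_ [a [b ->] <-]]; apply: open_measurable_plane.
by move/(continuous_inP _ oD): cD; apply; exact: interval_open.
Qed.

(** The image of Lebesgue measure under [x |-> c x], multiplied by [|c|], has the right value on
    intervals, so uniqueness of Lebesgue measure applies. For [c < 0] the preimage of []a, b]] is
    closed on the left instead of the right, whence two cases. *)
Lemma ge0_integral_scale (c : R) (h : R -> \bar R) : c != 0 -> measurable_fun [set: measurableTypeR R] (h : measurableTypeR R -> \bar R) ->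
  (forall x, (0 <= h x)%E) ->
  (\int[mu]_x h x = `|c|%:E * \int[mu]_x h (c * x)%R)%E.
Proof.
move=> c0 mh h0.
have mc : measurable_fun setT (fun x : measurableTypeR R => c * x : measurableTypeR R).
  exact: measurable_funM.
have c0' : 0 < `|c| by rewrite normr_gt0.
pose k := NngNum (normr_ge0 c).
pose phi := (fun x => c * x) : measurableTypeR R -> measurableTypeR R.
have E (A : set (measurableTypeR R)) : measurable A -> mu A = mscale k (pushforward mu phi) A.
  move=> mA; apply: lebesgue_measure_unique => //= _ [[a b] _ <-].
  rewrite /mscale /= /pushforward lebesgue_measure_itv /= lte_fin.
  have [c1|c1|c00] := ltgtP c 0; last by rewrite c00 eqxx in c0.
    have -> : (fun x : R => c * x) @^-1` `]a, b]%classic = `[b / c, a / c[%classic.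
      apply/seteqP; split => x /=; rewrite !in_itv /= => /andP[h1 h2]; apply/andP; split.
      - by rewrite ler_ndivrMr // mulrC.
      - by rewrite ltr_ndivlMr // mulrC.
      - by rewrite mulrC -ltr_ndivlMr.
      - by rewrite mulrC -ler_ndivrMr.
    rewrite lebesgue_measure_itv /= lte_fin ltr_nM2r ?invr_lt0 // ltr0_norm //.
    case: ifP => _; last by rewrite mule0.
    by rewrite -!EFinB -EFinM; congr (_%:E); field.
  have -> : (fun x : R => c * x) @^-1` `]a, b]%classic = `]a / c, b / c]%classic.
    apply/seteqP; split => x /=; rewrite !in_itv /= => /andP[h1 h2]; apply/andP; split.
    - by rewrite ltr_pdivrMr // mulrC.
    - by rewrite ler_pdivlMr // mulrC.
    - by rewrite mulrC -ltr_pdivrMr.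
    - by rewrite mulrC -ler_pdivlMr.
  rewrite lebesgue_measure_itv /= lte_fin ltr_pM2r ?invr_gt0 // gtr0_norm //.
  case: ifP => _; last by rewrite mule0.
  by rewrite -!EFinB -EFinM; congr (_%:E); field.
have E2 := @ge0_integral_pushforward _ _ _ _ R phi mc mu setT h measurableT mh (fun y _ => h0 y).
have -> : (\int[mu]_x h (c * x)%R = \int[mu]_(x in phi @^-1` setT) (h \o phi) x)%E by [].
rewrite -E2 (_ : `|c|%:E = k%:num%:E)%E // -(ge0_integral_mscale _ measurableT k mh) //.
by apply: eq_measure_integral => A mA _; exact: E.
Qed.

End PlaneMeasurability.

(** * Polar coordinates by slopes *)

Section Polar.
Variable R : realType.
Local Notation C := (CC R).
Local Notation mu := (@lebesgue_measure R).
Local Notation M := (measurableTypeR R).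

(** This is [cos (atan t)], the abscissa of the point of slope [t] on the right half circle. *)
Definition hyp (t : R) : R := (Num.sqrt (1 + t ^+ 2))^-1.

Lemma sqr1_gt0 (t : R) : 0 < 1 + t ^+ 2.
Proof. by rewrite ltr_pwDl // sqr_ge0. Qed.

Lemma hyp_gt0 t : 0 < hyp t.
Proof. by rewrite invr_gt0 sqrtr_gt0 sqr1_gt0. Qed.

Lemma hyp_sqr t : hyp t ^+ 2 = (1 + t ^+ 2)^-1.
Proof. by rewrite exprVn sqr_sqrtr // ltW // sqr1_gt0. Qed.

Lemma cis_atan t : cis (atan t) = cpt (hyp t) (t * hyp t) :> C.
Proof.
have hE : hyp t = cos (atan t) by rewrite cos_atan.
rewrite /cis hE; congr cpt.
have c0 : cos (atan t) != 0 by rewrite -hE gt_eqF // hyp_gt0.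
by rewrite -{2}(atanK t) /tan divfK.
Qed.

Lemma continuous_hyp : continuous hyp.
Proof.
move=> t; have H : {for t, continuous (fun t : R => Num.sqrt (1 + t ^+ 2))}.
  have c1 : {for t, continuous (fun t : R => 1 + t ^+ 2)}.
    apply: at_rD; first exact: cvg_cst.
    by apply: at_rM; exact: cvg_id.
  exact: (@continuous_comp _ _ _ (fun t : R => 1 + t ^+ 2) Num.sqrt _ c1 (@sqrt_continuous R _)).
by apply: (at_rV H); rewrite gt_eqF // sqrtr_gt0 sqr1_gt0.
Qed.

Lemma measurable_hyp : measurable_fun [set: M] (hyp : M -> M).
Proof. by apply: continuous_measurable_fun; exact: continuous_hyp. Qed.

(** The substitution [theta = atan t] is made on [[-n, n]]; monotone convergence on both sides then
    fills the line and the open interval []-pi/2, pi/2[]. *)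
Lemma integral_atan (G : R -> R) : continuous G -> (forall x, 0 <= G x) ->
  (\int[mu]_t ((1 + t ^+ 2)^-1 * G (atan t))%:E = (RI (- (pi / 2)) (pi / 2) G)%:E)%E.
Proof.
move=> cG G0.
have mG : measurable_fun [set: M] (G : M -> M) by exact: continuous_measurable_fun.
have mK : measurable_fun [set: M] (fun t : M => ((1 + t ^+ 2)^-1 * G (atan t))%:E).
  apply/measurable_EFinP; apply: measurable_funM.
    rewrite (_ : (fun t => _) = fun t => hyp t ^+ 2); last by apply/funext => t; rewrite hyp_sqr.
    by apply: measurable_funX; exact: measurable_hyp.
  apply: (measurableT_comp mG); apply: continuous_measurable_fun; exact: continuous_atan.
have sub n : (\int[mu]_(t in `[(- n%:R)%R, n%:R%R]) ((1 + t ^+ 2)^-1 * G (atan t))%:E =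
    \int[mu]_(x in `[atan (- n%:R)%R, atan n%:R%R]) (G x)%:E)%E.
  have cd t : {for t, continuous (@atan R)^`()}.
    rewrite (_ : atan^`() = fun t => hyp t * hyp t).
      by apply: at_rM; exact: continuous_hyp.
    by apply/funext => x; rewrite derive1_atan -hyp_sqr.
  rewrite (@integration_by_substitution_increasing R atan G (- n%:R) n%:R).
  - by apply: eq_integral => t _; congr EFin; rewrite mulrC -derive1_atan.
  - by rewrite ge0_cp.
  - by move=> x y _ _; exact: lt_atan.
  - by move=> x _; exact: cd.
  - by apply/cvg_ex; exists (atan^`() (- n%:R)); apply: cvg_at_right_filter; exact: cd.
  - by apply/cvg_ex; exists (atan^`() n%:R); apply: cvg_at_left_filter; exact: cd.
  - split.
    + by move=> x _; exact: derivable_atan.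
    + by apply: cvg_at_right_filter; exact: continuous_atan.
    + by apply: cvg_at_left_filter; exact: continuous_atan.
  - exact: continuous_subspaceT.
have nd1 : nondecreasing_seq (fun n : nat => `[- n%:R, n%:R]%classic : set M).
  move=> m n mn; apply/subsetPset => x /=; rewrite !in_itv /= => /andP[h1 h2]; apply/andP; split.
    by apply: le_trans h1; rewrite lerN2 ler_nat.
  by apply: le_trans h2 _; rewrite ler_nat.
have nd2 : nondecreasing_seq (fun n : nat => `[atan (- n%:R), atan n%:R]%classic : set M).
  move=> m n mn; apply/subsetPset => x /=; rewrite !in_itv /= => /andP[h1 h2]; apply/andP; split.
    by apply: le_trans h1; apply: le_atan; rewrite lerN2 ler_nat.
  by apply: le_trans h2 _; apply: le_atan; rewrite ler_nat.
have K0 t : (0 <= ((1 + t ^+ 2)^-1 * G (atan t))%:E)%E.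
  by rewrite lee_fin mulr_ge0 // invr_ge0 ltW // sqr1_gt0.
have L1 := @ge0_nondecreasing_set_cvg_integral _ _ _ _ _ mu nd1
   (fun n => measurable_itv _) (fun n => measurable_funTS mK) (fun n x _ => K0 x).
have mGE : measurable_fun [set: M] (fun x : M => (G x)%:E) by exact/measurable_EFinP.
have G0E x : (0 <= (G x)%:E)%E by rewrite lee_fin.
have L2 := @ge0_nondecreasing_set_cvg_integral _ _ _ _ _ mu nd2
   (fun n => measurable_itv _) (fun n => measurable_funTS mGE) (fun n x _ => G0E x).
have U1 : \bigcup_n `[- n%:R, n%:R]%classic = [set: R].
  apply/seteqP; split => // x _; exists (Num.bound `|x|) => //=.
  by rewrite in_itv /= -ler_norml ltW // archi_boundP.
have U2 : \bigcup_n `[atan (- n%:R), atan n%:R]%classic = `]- (pi / 2), pi / 2[%classic :> set R.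
  apply/seteqP; split => x /=.
    move=> [n _] /=; rewrite !in_itv /= => /andP[h1 h2]; apply/andP; split.
      by apply: lt_le_trans h1; exact: atan_gtNpi2.
    by apply: le_lt_trans h2 _; exact: atan_ltpi2.
  move=> xx; exists (Num.bound `|tan x|) => //=.
  have : `|tan x| <= (Num.bound `|tan x|)%:R by rewrite ltW // archi_boundP.
  rewrite ler_norml => /andP[h1 h2].
  have /andP[] : (atan (- (Num.bound `|tan x|)%:R) <= atan (tan x)) &&
      (atan (tan x) <= atan (Num.bound `|tan x|)%:R) by rewrite !le_atan.
  by rewrite tanK // in_itv /= => -> ->.
rewrite U1 in L1; rewrite U2 in L2.
have cI : con (- (pi / 2)) (pi / 2) G by move=> t _; exact: cG.
rewrite /RI /Rintegral fineK; last exact: integrable_fin_num (con_integrable cI).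
have -> : (\int[mu]_(x in `[(- (pi / 2))%R, (pi / 2)%R]) (G x)%:E = \int[mu]_(x in `](- (pi / 2))%R, (pi / 2)%R[) (G x)%:E)%E.
  exact: (integral_itv_bndoo _ _ (measurable_funTS mGE)).
apply: (cvg_unique _ L1); first exact: ereal_hausdorff.
apply: cvg_trans L2; apply: near_eq_cvg; apply: nearW => n; exact: esym (sub n).
Qed.

Section Tonelli.
Variable H : M * M -> \bar R.
Hypothesis mH : measurable_fun [set: M * M] H.
Hypothesis H0 : forall p, (0 <= H p)%E.

Lemma tonelli_plane : (\int[(mu \x mu)]_p H p = \int[mu]_x \int[mu]_y H (x, y))%E.
Proof. exact: (@fubini_tonelli1 _ _ M M R mu mu H mH H0). Qed.

Lemma tonelli_swap : (\int[mu]_x \int[mu]_y H (x, y) = \int[mu]_y \int[mu]_x H (x, y))%E.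
Proof. exact: (@fubini_tonelli _ _ M M R mu mu H mH H0). Qed.

Lemma measurable_tonelli : measurable_fun [set: M] (fun x => \int[mu]_y H (x, y))%E.
Proof. exact: (@measurable_fun_fubini_tonelli_F _ _ M M R mu H mH H0). Qed.
End Tonelli.

Definition polar_weight (H : R * R -> \bar R) (r t : R) : \bar R :=
  ((`|r| * (1 + t ^+ 2)^-1)%:E * H (r * hyp t, r * (t * hyp t))%R)%E.

(* The shear y = x t and the scaling x = r / sqrt (1 + t^2) give polar coordinates with signed radius
   and slope t, without any trigonometric change of variables in the plane. *)
Lemma integral_polar (H : R * R -> \bar R) :
  measurable_fun [set: M * M] H -> (forall p, (0 <= H p)%E) ->
  measurable_fun [set: M * M] (fun p => polar_weight H p.1 p.2) /\
  (\int[(mu \x mu)]_p H p = \int[mu]_r \int[mu]_t polar_weight H r t)%E.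
Proof.
move=> mH H0.
have m1 : measurable_fun [set: M * M] (fst : M * M -> M) by exact: measurable_fst.
have m2 : measurable_fun [set: M * M] (snd : M * M -> M) by exact: measurable_snd.
have mh : measurable_fun [set: M * M] (fun p => hyp p.2 : M) := measurableT_comp measurable_hyp m2.
have mL : measurable_fun [set: M * M] (fun p => polar_weight H p.1 p.2).
  apply: emeasurable_funM.
    apply/measurable_EFinP; apply: measurable_funM; first exact: measurableT_comp m1.
    rewrite (_ : (fun p => _) = fun p : M * M => hyp p.2 ^+ 2); last by apply/funext => p; rewrite hyp_sqr.
    exact: measurable_funX.
  apply: (measurableT_comp mH); apply: measurable_fun_pair; apply: measurable_funM => //.
  exact: measurable_funM.
split; first exact: mL.
have L0 r t : (0 <= polar_weight H r t)%E.
  by rewrite mule_ge0 // lee_fin mulr_ge0 // invr_ge0 ltW // sqr1_gt0.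
pose K (p : R * R) := (`|p.1|%:E * H (p.1, p.1 * p.2)%R)%E.
have mK : measurable_fun [set: M * M] K.
  apply: emeasurable_funM.
    by apply/measurable_EFinP; exact: measurableT_comp m1.
  by apply: (measurableT_comp mH); apply: measurable_fun_pair => //; exact: measurable_funM.
have K0 p : (0 <= K p)%E by rewrite mule_ge0.
transitivity (\int[mu]_x \int[mu]_y H (x, y))%E; first exact: tonelli_plane.
have -> : (\int[mu]_x \int[mu]_y H (x, y) = \int[mu]_x \int[mu]_t K (x, t))%E.
  (* The substitution [y = x t] needs [x != 0]; the value [x = 0] is a null set for the outer
     integral. *)
  rewrite -(@integral_setD1 _ _ 0 setT); [|by apply: measurableD|]; last first.
    apply: measurable_funTS; exact: (measurable_tonelli mH H0).
  rewrite -[RHS](@integral_setD1 _ _ 0 setT); [|by apply: measurableD|]; last first.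
    apply: measurable_funTS; exact: (measurable_tonelli mK K0).
  apply: eq_integral => x; rewrite inE => -[_ /= /eqP x0].
  have mHx : measurable_fun [set: M] (fun y => H (x, y)) := measurable_fun_pair2 x mH.
  rewrite (ge0_integral_scale x0 mHx) // -ge0_integralZl //.
  apply: (measurableT_comp mHx); exact: measurable_funM.
rewrite (tonelli_swap mK K0).
rewrite (tonelli_swap (H:=fun p => polar_weight H p.1 p.2) mL (fun p => L0 p.1 p.2)) /=.
apply: eq_integral => t _.
have h0 : hyp t != 0 by rewrite gt_eqF // hyp_gt0.
have mKt : measurable_fun [set: M] (fun x => K (x, t)) := measurable_fun_pair1 t mK.
rewrite (ge0_integral_scale h0 mKt) // -ge0_integralZl //; last first.
  apply: (measurableT_comp mKt); exact: measurable_funM.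
apply: eq_integral => r _; rewrite /K /polar_weight /= muleA -EFinM; congr (_%:E * H (_, _))%E.
- rewrite normrM -hyp_sqr (gtr0_norm (hyp_gt0 t)); ring.
- by rewrite mulrC.
- by ring.
Qed.

End Polar.

(** * Integrals over the disc as integrals of circle means *)

Section PolarDisc.
Variable R : realType.
Local Notation C := (CC R).
Local Notation mu := (@lebesgue_measure R).
Local Notation M := (measurableTypeR R).

Definition discR : set (R * R) := [set p | cmod (cpt p.1 p.2 : C) < 1].

Lemma at_cpt_pair (p : R * R) : {for p, continuous (fun p : R * R => cpt p.1 p.2 : C)}.
Proof. by apply: at_cpt; [exact: cvg_fst|exact: cvg_snd]. Qed.

Lemma continuous_cmod_pair : continuous (fun p : R * R => cmod (cpt p.1 p.2 : C)).
Proof. by move=> p; exact: (at_cmod (@at_cpt_pair p)). Qed.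

Lemma open_discR : open discR.
Proof.
have -> : discR = (fun p : R * R => cmod (cpt p.1 p.2 : C)) @^-1` `]-oo, 1[%classic.
  by apply/seteqP; split => p; rewrite /= in_itv.
apply: open_comp; last exact: interval_open.
by move=> p _; exact: continuous_cmod_pair.
Qed.

Lemma measurable_discR : measurable (discR : set (M * M)).
Proof. exact: open_measurable_plane open_discR. Qed.

Lemma polar_point (r t : R) : cpt (r * hyp t) (r * (t * hyp t)) = rc r * cis (atan t) :> C.
Proof. by rewrite cis_atan; apply: ceq; rewrite !creimE; ring. Qed.

Lemma discR_polar (r t : R) : discR (r * hyp t, r * (t * hyp t)) = (`|r| < 1) :> Prop.
Proof.
have -> : discR (r * hyp t, r * (t * hyp t)) = (cmod (cpt (r * hyp t) (r * (t * hyp t)) : C) < 1) :> Prop by [].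
by rewrite polar_point cmodM cmod_rc cmod_cis mulr1.
Qed.

Lemma continuous_circle (F : C -> R) r : (forall z, cmod z < 1 -> {for z, continuous F}) ->
  `|r| < 1 -> continuous (fun t => F (rc r * cis t)).
Proof.
move=> cF r1 t; apply: (@continuous_comp _ _ _ (fun t => rc r * cis t) F).
  by apply: atM; [exact: at_cst|exact: at_cist].
by apply: cF; rewrite cmodM cmod_rc cmod_cis mulr1.
Qed.

(** Slopes reach only the right half circle. Folding the negative radii onto the positive ones
    supplies the antipodal values, and the sum is exactly the integrand of [rcirc]. *)
Lemma polar_disc (F : C -> R) (w : R -> R) :
  (forall z, cmod z < 1 -> {for z, continuous F}) -> (forall z, cmod z < 1 -> 0 <= F z) ->
  measurable_fun (`[0, 1[ : set M) (w : M -> M) -> (forall r, 0 <= r < 1 -> 0 <= w r) ->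
  (\int[(mu \x mu)]_(p in discR) (F (cpt p.1 p.2) * w (cmod (cpt p.1 p.2 : C)))%:E =
   \int[mu]_(r in `[0%R, 1%R[) (r * w r * rcirc (fun u => F (rc r * u)%R))%:E)%E.
Proof.
move=> cF F0 mw w0.
pose G (p : M * M) : \bar R := (F (cpt p.1 p.2) * w (cmod (cpt p.1 p.2 : C)))%:E.
have mD := measurable_discR.
have mG : measurable_fun (discR : set (M * M)) G.
  apply/measurable_EFinP; apply: measurable_funM.
    apply: (cts_measurable_plane open_discR) => p pD.
    apply: (@continuous_comp _ _ _ (fun p : R * R => cpt p.1 p.2 : C) F); first exact: at_cpt_pair.
    exact: cF.
  apply: (@measurable_comp _ _ _ _ _ _ (`[0, 1[ : set M)) => //.
    by move=> _ [p pD <-]; apply/andP; split; [exact: cmod_ge0|exact: pD].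
  by apply: (cts_measurable_plane open_discR) => p _; exact: continuous_cmod_pair.
pose H := (G \_ discR : M * M -> \bar R).
have mH : measurable_fun [set: M * M] H by apply/(measurable_restrictT _ mD).
have H0 p : (0 <= H p)%E.
  rewrite /H patchE; case: ifPn => //; rewrite inE => pD.
  by rewrite lee_fin mulr_ge0 ?F0 // w0 // cmod_ge0.
have [mL EH] := integral_polar mH H0.
rewrite integral_mkcond -/G -/H EH.
pose Phi (r : R) : \bar R := if `|r| < 1 then
  (`|r| * w `|r| * RI (- (pi / 2)) (pi / 2) (fun t => F (rc r * cis t)))%:E else 0%E.
have inner r : (\int[mu]_t polar_weight H r t = Phi r)%E.
  rewrite /Phi /polar_weight; case: ltP => r1; last first.
    apply: integral0_eq => t _; rewrite /H patchE memNset ?mule0 //.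
    by rewrite discR_polar; apply/negP; rewrite -leNgt.
  have cG := continuous_circle cF r1.
  have G0 t : 0 <= F (rc r * cis t) by apply: F0; rewrite cmodM cmod_rc cmod_cis mulr1.
  have rw0 : 0 <= `|r| * w `|r| by rewrite mulr_ge0 // w0 // normr_ge0.
  rewrite EFinM -(integral_atan cG G0) -ge0_integralZl //; first last.
  - by move=> t _; rewrite lee_fin mulr_ge0 // invr_ge0 ltW // sqr1_gt0.
  - apply/measurable_EFinP; apply: measurable_funM.
      rewrite (_ : (fun t => _) = fun t => hyp t ^+ 2); last by apply/funext => t; rewrite hyp_sqr.
      by apply: measurable_funX; exact: measurable_hyp.
    have mc : measurable_fun [set: M] ((fun t => F (rc r * cis t)) : M -> M) by exact: continuous_measurable_fun.
    apply: (measurableT_comp mc); apply: continuous_measurable_fun; exact: continuous_atan.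
  apply: eq_integral => t _; rewrite /H patchE mem_set; last first.
    by rewrite discR_polar.
  rewrite /G [fst _]/(_.1) [snd _]/(_.2) polar_point cmodM cmod_rc cmod_cis mulr1 -!EFinM; congr EFin; ring.
have -> : (\int[mu]_r \int[mu]_t polar_weight H r t = \int[mu]_r Phi r)%E.
  by apply: eq_integral => r _; exact: inner.
have mPhi : measurable_fun [set: M] (Phi : M -> \bar R).
  have -> : Phi = (fun r => \int[mu]_t polar_weight H r t)%E by apply/funext => r; rewrite inner.
  apply: (@measurable_tonelli _ (fun p : M * M => polar_weight H p.1 p.2) mL) => p.
  by rewrite /polar_weight mule_ge0 // lee_fin mulr_ge0 // invr_ge0 ltW // sqr1_gt0.
have Phi0 r : (0 <= Phi r)%E.
  by rewrite -inner; apply: integral_ge0 => t _; rewrite /polar_weight mule_ge0 // lee_fin mulr_ge0 // invr_ge0 ltW // sqr1_gt0.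
have mPhiN : measurable_fun [set: M] (fun r => Phi (- r) : \bar R).
  exact: (@measurableT_comp _ _ _ _ _ _ (Phi : M -> \bar R) setT (-%R : M -> M)).
have -> : [set: R] = `]-oo, 0]%classic `|` `]0, +oo[%classic.
  by apply/seteqP; split => // x _; rewrite /= !in_itv /= andbT; case: (leP x 0); [left|right].
rewrite ge0_integral_setU //=; first last.
- apply/disj_setPS => x [] /=; rewrite !in_itv /= andbT => x0.
  by rewrite ltNge x0.
- exact: measurable_funTS.
rewrite integral_itv_obnd_cbnd; last exact: measurable_funTS.
have -> : (\int[mu]_(x in `]-oo, 0%R]) Phi x = \int[mu]_(x in `[0%R, +oo[) Phi (- x)%R)%E.
  rewrite (ge0_integration_by_substitution0 mPhiN (fun r => Phi0 (- r))).
  by apply: eq_integral => x _; rewrite opprK.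
rewrite -ge0_integralD; first last.
- exact: measurable_funTS mPhi.
- by move=> r _; exact: Phi0.
- exact: measurable_funTS mPhiN.
- by move=> r _; exact: Phi0.
- exact: measurable_itv.
rewrite integral_mkcond [RHS]integral_mkcond; apply: eq_integral => r _.
rewrite !patchE; case: (leP 0 r) => r0; last first.
  rewrite !memNset // /= in_itv /= ?andbT; first by case/andP; rewrite leNgt r0.
  by rewrite leNgt r0.
rewrite [in LHS]mem_set; last by rewrite /= in_itv /= r0.
rewrite /Phi normrN ger0_norm //; case: ltP => r1; last first.
  by rewrite memNset ?adde0 // /= in_itv /= => /andP[_]; rewrite ltNge r1.
rewrite mem_set /= ?in_itv /= ?r0 // -EFinD -mulrDr; congr (_ * _)%:E.
have r1' : `|r| < 1 by rewrite ger0_norm.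
rewrite -RID; first by apply: eq_RI => t _; rewrite addrC rcN mulNr mulrN.
  by move=> t _; apply: continuous_circle => //; rewrite normrN.
by move=> t _; apply: continuous_circle.
Qed.

End PolarDisc.

(** * Monotonicity of circle means *)

Section CircleMeans.
Variable R : realType.
Local Notation C := (CC R).
Local Notation mu := (@lebesgue_measure R).
Local Notation M := (measurableTypeR R).

Lemma tonelli_restrict (I J : set R) (K : R * R -> R) :
  measurable (I : set M) -> measurable (J : set M) -> continuous K -> (forall p, 0 <= K p) ->
  measurable_fun [set: M] (fun x : M => \int[mu]_(y in J) (K (x, y))%:E)%E /\
  (\int[mu]_(x in I) \int[mu]_(y in J) (K (x, y))%:E =
   \int[mu]_(y in J) \int[mu]_(x in I) (K (x, y))%:E)%E.
Proof.
move=> mI mJ cK K0.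
have mK : measurable_fun [set: M * M] (fun p : M * M => (K p)%:E).
  apply/measurable_EFinP; apply: (cts_measurable_plane openT) => p _; exact: cK.
have key (X : set R) : measurable (X : set M) ->
    let H := (fun p : M * M => (K p)%:E) \_ (X `*` J) in
    [/\ measurable_fun [set: M * M] H, (forall p, (0 <= H p)%E),
     (forall x, \int[mu]_y H (x, y) = (fun x => \int[mu]_(y in J) (K (x, y))%:E) \_ X x)%E &
     (forall y, \int[mu]_x H (x, y) = (fun y => \int[mu]_(x in X) (K (x, y))%:E) \_ J y)%E].
  move=> mX H; have mXJ : measurable (X `*` J : set (M * M)) by exact: measurableX.
  have H0 p : (0 <= H p)%E by rewrite /H patchE; case: ifP => // _; rewrite lee_fin.
  split=> //.
  - by apply/(measurable_restrictT _ mXJ); exact: measurable_funTS.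
  - move=> x; rewrite patchE; case: ifPn => [|]; rewrite ?notin_setE ?inE => xX.
      rewrite [RHS]integral_mkcond; apply: eq_integral => y _; rewrite /H !patchE.
      by congr (if _ then _ else _); apply/idP/idP; rewrite !inE => //= -[].
    by apply: integral0_eq => y _; rewrite /H patchE memNset // => -[].
  - move=> y; rewrite patchE; case: ifPn => [|]; rewrite ?notin_setE ?inE => yJ.
      rewrite [RHS]integral_mkcond; apply: eq_integral => x _; rewrite /H !patchE.
      by congr (if _ then _ else _); apply/idP/idP; rewrite !inE => //= -[].
    by apply: integral0_eq => x _; rewrite /H patchE memNset // => -[].
split.
  have [mH H0 Hx _] := key setT measurableT; have := measurable_tonelli mH H0.
  by congr measurable_fun; apply/funext => x; rewrite Hx patch_setT.
have [mH H0 Hx Hy] := key I mI; have sw := tonelli_swap mH H0.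
have -> : (\int[mu]_(x in I) \int[mu]_(y in J) (K (x, y))%:E =
    \int[mu]_x \int[mu]_y ((fun p : M * M => (K p)%:E) \_ (I `*` J)) (x, y))%E.
  by rewrite integral_mkcond; apply: eq_integral => x _; rewrite Hx.
rewrite sw; apply/esym; rewrite integral_mkcond; apply: eq_integral => y _.
by rewrite Hy.
Qed.

Lemma integral_RI a b (g : R -> R) : con a b g ->
  (\int[mu]_(t in `[a, b]) (g t)%:E = (RI a b g)%:E)%E.
Proof.
by move=> cg; rewrite /RI /Rintegral fineK //; exact: integrable_fin_num (con_integrable cg).
Qed.

Definition circE (f : C -> R) : \bar R :=
  (\int[mu]_(t in `[(- (pi / 2))%R, (pi / 2)%R]) (f (cis t) + f (- cis t)%R)%:E)%E.

Lemma circE_rcirc f : onc f -> circE f = (rcirc f)%:E.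
Proof.
move=> cf; exact: (integral_RI (onc_rcon cf)).
Qed.

(* The circle means of |F| increase with the radius: integrate the Poisson majorant over the inner circle
   and use the symmetry of the kernel. *)
Lemma circle_mean_nondecreasing (F : C -> C) r s : 0 <= r -> r < s -> analytic_cdisc F s ->
  rcirc (fun u => cmod (F (rc r * u))) <= rcirc (fun u => cmod (F (rc s * u))).
Proof.
move=> r0 rs dF; have s0 : 0 < s := le_lt_trans r0 rs.
have cFr := onc_cmod (analytic_cdisc_onc r0 (analytic_cdisc_lt (ltW rs) dF)).
have cFs := onc_cmod (analytic_cdisc_onc (ltW s0) dF).
have tp := tpi_gt0 R.
have rv v : cmod v = 1 -> cmod (rc r * v) < s by move=> v1; rewrite cmodM cmod_rc v1 mulr1 ger0_norm.
pose k (v u : C) : R := cmod (F (rc s * u)) * poisson s (rc r * v) u.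
(* Both circles are half circles with their antipodes, hence four terms. *)
pose K (p : R * R) : R := (k (cis p.1) (cis p.2) + k (cis p.1) (- cis p.2)) +
                          (k (- cis p.1) (cis p.2) + k (- cis p.1) (- cis p.2)).
have k0 v u : cmod v = 1 -> 0 <= k v u.
  by move=> v1; rewrite mulr_ge0 ?cmod_ge0 // poisson_ge0 // ltW // rv.
have K0 p : 0 <= K p by rewrite !addr_ge0 // k0 // ?cmod_cis ?cmod_Ncis.
have ck (a b : R * R -> C) : (forall p, cmod (a p) = 1) -> (forall p, cmod (b p) = 1) ->
    continuous a -> continuous b -> continuous (fun p => k (a p) (b p)).
  move=> a1 b1 ca cb p.
  have c1 : {for p, continuous (fun p => cmod (F (rc s * b p)))}.
    apply: (@continuous_comp _ _ _ b (fun u => cmod (F (rc s * u)))); first exact: cb.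
    exact: cFs (b1 p).
  have c2 : {for p, continuous (fun p => rc r * a p)} by apply: atM; [exact: at_cst|exact: ca].
  have c3 : {for p, continuous (fun p => rc s * b p)} by apply: atM; [exact: at_cst|exact: cb].
  have c4 := at_cmod c2; have c5 := at_cmod (atB c3 c2).
  have n0 : cmod (rc s * b p - rc r * a p) * cmod (rc s * b p - rc r * a p) != 0.
    by rewrite mulf_neq0 // cmod_eq0 sub_circle_neq0 // rv.
  have c6 : {for p, continuous (fun p => s ^+ 2 - cmod (rc r * a p) ^+ 2)}.
    by apply: cvgB; [exact: cvg_cst|exact: (at_rM c4 c4)].
  exact: (at_rM c1 (at_rM c6 (at_rV (at_rM c5 c5) n0))).
have cc1 : continuous (fun p : R * R => cis p.1 : C) by move=> p; apply: at_cis; exact: cvg_fst.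
have cc2 : continuous (fun p : R * R => cis p.2 : C) by move=> p; apply: at_cis; exact: cvg_snd.
have cn1 : continuous (fun p : R * R => - cis p.1 : C) by move=> p; exact: (atN (cc1 p)).
have cn2 : continuous (fun p : R * R => - cis p.2 : C) by move=> p; exact: (atN (cc2 p)).
have u1 (p : R * R) : cmod (cis p.1 : C) = 1 by exact: cmod_cis.
have u2 (p : R * R) : cmod (cis p.2 : C) = 1 by exact: cmod_cis.
have v1 (p : R * R) : cmod (- cis p.1 : C) = 1 by exact: cmod_Ncis.
have v2 (p : R * R) : cmod (- cis p.2 : C) = 1 by exact: cmod_Ncis.
have cK : continuous K.
  move=> p; have c1 := ck _ _ u1 u2 cc1 cc2 p; have c2 := ck _ _ u1 v2 cc1 cn2 p.
  have c3 := ck _ _ v1 u2 cn1 cc2 p; have c4 := ck _ _ v1 v2 cn1 cn2 p.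
  exact: (at_rD (at_rD c1 c2) (at_rD c3 c4)).
pose J := `[(- (pi / 2))%R, (pi / 2)%R]%classic : set R.
have mJ : measurable (J : set M) by exact: measurable_itv.
have [mK swap] := tonelli_restrict mJ mJ cK K0.
have conk v : cmod v = 1 -> onc (k v).
  by move=> v1'; apply: onc_rM; [exact: cFs|exact: onc_poisson (rv v v1')].
have RIE g (cg : con (- (pi / 2)) (pi / 2) g) := integral_RI cg.
have inner a : (\int[mu]_(t in J) (K (a, t))%:E = (rcirc (k (cis a)) + rcirc (k (- cis a)))%:E)%E.
  have c1 := onc_rcon (a:=- (pi / 2)) (b:=pi / 2) (conk (cis a) (cmod_cis a)).
  have c2 := onc_rcon (a:=- (pi / 2)) (b:=pi / 2) (conk (- cis a) (cmod_Ncis a)).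
  by rewrite (RIE (fun t => K (a, t)) (con_rD c1 c2)) /rcirc -RID.
have mid u : cmod u = 1 -> circE (fun v => k v u) = (2 * pi * cmod (F (rc s * u)))%:E.
  move=> uu; have cP := onc_poisson (rv u uu).
  have -> : circE (fun v => k v u) = circE (fun v => cmod (F (rc s * u)) * poisson s (rc r * u) v).
    apply: eq_integral => t _; rewrite /k.
    by rewrite !(poisson_sym s r uu) ?cmod_cis ?cmod_Ncis.
  rewrite circE_rcirc; last by apply: onc_rM; [exact: onc_cst|exact: cP].
  by rewrite (rcircZ _ cP) (rcirc_poisson (rv u uu)) mulrC.
have cs (f : R * R -> R) b : continuous f -> continuous (fun t => f (t, b)).
  move=> cf t; exact: (@continuous_comp _ _ _ (fun t => (t, b)) f t (cvg_pair cvg_id (cvg_cst _)) (cf (t, b))).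
have crD (f g : R -> R) : continuous f -> continuous g -> continuous (fun t => f t + g t).
  by move=> cf cg t; exact: (at_rD (cf t) (cg t)).
have outer b : (\int[mu]_(t in J) (K (t, b))%:E =
    (2 * pi * (cmod (F (rc s * cis b)) + cmod (F (rc s * - cis b))))%:E)%E.
  rewrite mulrDr EFinD -(mid _ (cmod_cis b)) -(mid _ (cmod_Ncis b)) -ge0_integralD; [|exact: mJ| | | |].
  - apply: eq_integral => t _; rewrite -EFinD; congr EFin; exact: addrACA.
  - move=> t _; rewrite lee_fin; exact: (addr_ge0 (k0 _ _ (cmod_cis t)) (k0 _ _ (cmod_Ncis t))).
  - apply: measurable_funTS; apply/measurable_EFinP; apply: continuous_measurable_fun.
    exact: (crD _ _ (cs _ b (ck _ _ u1 u2 cc1 cc2)) (cs _ b (ck _ _ v1 u2 cn1 cc2))).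
  - move=> t _; rewrite lee_fin; exact: (addr_ge0 (k0 _ _ (cmod_cis t)) (k0 _ _ (cmod_Ncis t))).
  - apply: measurable_funTS; apply/measurable_EFinP; apply: continuous_measurable_fun.
    exact: (crD _ _ (cs _ b (ck _ _ u1 v2 cc1 cn2)) (cs _ b (ck _ _ v1 v2 cn1 cn2))).
rewrite -(ler_pM2l tp) -lee_fin -(rcircZ _ cFr) -(rcircZ _ cFs).
have cZ (f : C -> R) : onc f -> onc (fun u => 2 * pi * f u).
  by move=> cf; apply: onc_rM; [exact: onc_cst|exact: cf].
rewrite -(circE_rcirc (cZ _ cFr)) -(circE_rcirc (cZ _ cFs)).
have -> : circE (fun u => 2 * pi * cmod (F (rc s * u))) = (\int[mu]_(y in J) \int[mu]_(x in J) (K (x, y))%:E)%E.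
  apply: eq_integral => t _; rewrite outer; congr EFin; exact: esym (mulrDr _ _ _).
rewrite -swap; apply: ge0_le_integral; [exact: mJ| | | |].
- move=> t _; rewrite lee_fin; exact: (addr_ge0 (mulr_ge0 (ltW tp) (cmod_ge0 _)) (mulr_ge0 (ltW tp) (cmod_ge0 _))).
- apply/measurable_EFinP; apply: measurable_funTS; apply: continuous_measurable_fun => t.
  exact: (onc_rcon (a:=t) (b:=t) (cZ _ cFr) (etrans (congr2 andb (lexx t) (lexx t)) erefl)).
- exact: measurable_funTS.
- move=> t _; rewrite inner lee_fin; apply: lerD.
    exact: (poisson_sub_mean (rv _ (cmod_cis t)) dF).
  exact: (poisson_sub_mean (rv _ (cmod_Ncis t)) dF).
Qed.

End CircleMeans.

(** * Diagonal subsequences *)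

Section DiagonalExtraction.
Variable R : realType.

(* Tychonoff gives a cluster point of the sequence in a product of segments; the subsequence follows it on
   more and more coordinates. *)
Lemma diag_extract (x : nat -> nat -> R) (B : nat -> R) : (forall n k, `|x n k| <= B k) ->
  exists2 phi : nat -> nat, {homo phi : m n / (m < n)%N} &
    forall k, cvg ((fun n => x (phi n) k) @ \oo).
Proof.
move=> xB.
have cA (k : nat) : compact (`[- B k, B k]%classic : set R) by exact: segment_compact.
have := @tychonoff nat (fun=> R) (fun k => `[- B k, B k]%classic) cA.
set A := [set f | _] => cptA.
have FA : (x @ \oo) A.
  by exists 0%N => // n _ k; rewrite /= in_itv /= -ler_norml.
have [p [_ clp]] := cptA _ _ FA.
pose Nb m := [set f : nat -> R | forall k, (k <= m)%N -> `|p k - f k| < m.+1%:R^-1].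
have nbN m : @nbhs _ (prod_topology (fun _ : nat => R)) p (Nb m).
  have e0 : 0 < (m.+1%:R^-1 : R) by rewrite invr_gt0.
  rewrite /Nb; move: (m.+1%:R^-1) e0 => e e0.
  suff H j : @nbhs _ (prod_topology (fun _ : nat => R)) p [set f | forall k, (k <= j)%N -> `|p k - f k| < e].
    exact: H.
  have one k : @nbhs _ (prod_topology (fun _ : nat => R)) p [set f | `|p k - f k| < e].
    exact: (@proj_continuous nat (fun=> R) k p _ (@nbhsx_ballx _ _ (p k) e e0)).
  have FF := @nbhs_filter (prod_topology (fun _ : nat => R)) p.
  elim: j => [|j IH].
    apply: (@filterS _ _ FF _ _ _ (one 0%N)) => f h k.
    by rewrite leqn0 => /eqP ->.
  apply: (@filterS _ _ FF _ _ _ (@filterI _ _ FF _ _ IH (one j.+1))) => f [h1 h2] k.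
  rewrite leq_eqVlt => /orP[/eqP->|]; first exact: h2.
  by rewrite ltnS; exact: h1.
have far m n0 : exists n, (n0 <= n)%N /\ Nb m (x n).
  have Ft : (x @ \oo) [set x n | n in [set n | (n0 <= n)%N]].
    by exists n0 => // n /= n0n; exists n.
  by have [_ [[n /= n0n <-] Nx]] := clp _ _ Ft (nbN m); exists n.
have [g Hg] := choice (fun mn : nat * nat => far mn.1 mn.2).
pose phi := fix phi m := if m is m'.+1 then g (m, (phi m').+1) else g (0%N, 0%N).
have phiN m : Nb m (x (phi m)).
  by case: m => [|m]; [exact: (Hg (0%N, 0%N)).2|exact: (Hg (m.+1, (phi m).+1)).2].
have phiS m : (phi m < phi m.+1)%N by exact: (Hg (m.+1, (phi m).+1)).1.
exists phi; first by apply: homo_ltn => //; exact: ltn_trans.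
move=> k; apply/cvg_ex; exists (p k); apply/cvgrPdist_lt => e e0.
have [N HN] : exists N : nat, N.+1%:R^-1 < e.
  by by have [N] := ltr_add_invr e0; rewrite add0r; exists N.
exists (maxn k N) => // n; rewrite /= geq_max => /andP[kn Nn].
apply: lt_trans (phiN n k kn) _; apply: le_lt_trans HN.
by rewrite lef_pV2 ?posrE // ler_nat.
Qed.

End DiagonalExtraction.

(** * Locally bounded sequences and their limits *)

Section Montel.
Variable R : realType.
Local Notation C := (CC R).
Local Notation mu := (@lebesgue_measure R).

Lemma RI_dct (a b K : R) (f : nat -> R -> R) (g : R -> R) : (forall n, con a b (f n)) -> con a b g ->
  (forall t, a <= t <= b -> f ^~ t @ \oo --> g t) ->
  (forall n t, a <= t <= b -> `|f n t| <= K) ->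
  (fun n => RI a b (f n)) @ \oo --> RI a b g.
Proof.
move=> cf cg fg fK.
have iK : mu.-integrable `[a, b] (EFin \o (fun=> K)).
  by apply: con_integrable; exact: con_cst.
have [] := @dominated_convergence _ _ R mu `[a, b] (measurable_itv _) (fun n => EFin \o f n) (EFin \o g) (EFin \o (fun=> K)).
- by move=> n; exact: measurable_int (con_integrable (cf n)).
- exact: measurable_int (con_integrable cg).
- apply: aeW => t; rewrite /= in_itv /= => tt; apply: cvg_EFin; first exact: nearW.
  exact: fg.
- exact: iK.
- by apply: aeW => t n; rewrite /= in_itv /= => tt; rewrite lee_fin; exact: fK.
- move=> _ _; rewrite /= (integral_RI cg) => H.
  exact: (fine_cvg H).
Qed.

Lemma circ_dct (K : R) (f : nat -> C -> C) (g : C -> C) : (forall n, onc (f n)) -> onc g ->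
  (forall u, cmod u = 1 -> f ^~ u @ \oo --> g u) ->
  (forall n u, cmod u = 1 -> cmod (f n u) <= K) ->
  (fun n => circ (f n)) @ \oo --> circ g.
Proof.
move=> cf cg fg fK; apply: cvg_cpt; apply: (@RI_dct _ _ (K + K)).
- by move=> n; exact: (con_cre (onc_con (cf n))).
- exact: (con_cre (onc_con cg)).
- by move=> t _; apply: cvg_cre; exact: (ccvgD (fg _ (cmod_cis t)) (fg _ (cmod_Ncis t))).
- move=> n t _; apply: le_trans (cre_le _) _; apply: le_trans (cmodD _ _) _.
  exact: (lerD (fK _ _ (cmod_cis t)) (fK _ _ (cmod_Ncis t))).
- by move=> n; exact: (con_cim (onc_con (cf n))).
- exact: (con_cim (onc_con cg)).
- by move=> t _; apply: cvg_cim; exact: (ccvgD (fg _ (cmod_cis t)) (fg _ (cmod_Ncis t))).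
- move=> n t _; apply: le_trans (cim_le _) _; apply: le_trans (cmodD _ _) _.
  exact: (lerD (fK _ _ (cmod_cis t)) (fK _ _ (cmod_Ncis t))).
Qed.

Definition locally_bounded (f : nat -> C -> C) :=
  forall s, s < 1 -> exists K, forall n z, cmod z <= s -> cmod (f n z) <= K.

Lemma equi_lipschitz (f : nat -> C -> C) : (forall n, analytic_disc (f n)) -> locally_bounded f ->
  forall s, s < 1 -> exists L, forall n z w, cmod z <= s -> cmod w <= s ->
    cmod (f n z - f n w) <= L * cmod (z - w).
Proof.
(* [lipschitz_cauchy] asks for a positive radius, while [s] may be 0 or negative. *)
move=> df lb s s1; pose s' := Num.max s (1 / 2).
have s'0 : 0 < s' by rewrite lt_max; apply/orP; right; rewrite divr_gt0.
have s'1 : s' < 1 by rewrite gt_max s1 ltr_pdivrMr // mul1r ltr1n.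
have [r0 sr r1] := midpoint_lt1 (ltW s'0) s'1; set r := (1 + s') / 2 in r0 sr r1.
have [K HK] := lb r r1.
exists (r / (r - s') ^+ 2 * K) => n z w zs ws.
have zs' : cmod z <= s' by rewrite le_max zs.
have ws' : cmod w <= s' by rewrite le_max ws.
have H := lipschitz_cauchy s'0 sr zs' ws' (analytic_disc_cdisc (df n) r1).
have HM : rcirc (fun u => cmod (f n (rc r * u))) <= K * (2 * pi).
  rewrite -rcirc_cst; apply: rcirc_le.
  - exact: onc_cmod (analytic_onc (df n) (ltW r0) r1).
  - exact: onc_cst.
  - by move=> u u1; apply: HK; rewrite cmodM cmod_rc u1 mulr1 gtr0_norm.
have tp := tpi_gt0 R.
rewrite -(ler_pM2l tp); apply: le_trans H _.
apply: le_trans (ler_wpM2l _ HM) _.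
  by rewrite mulr_ge0 ?cmod_ge0 // divr_ge0 ?exprn_ge0 ?subr_ge0 // ltW.
rewrite le_eqVlt; apply/orP; left; apply/eqP; ring.
Qed.

(** Lipschitz bounds survive pointwise limits, so [g] is continuous. By dominated convergence the
    Cauchy integrals of [f n] converge to those of [g]; hence [g] satisfies Cauchy's formula, whose
    right side is differentiable. The same convergence for the kernel of order two gives the
    derivatives. *)
Lemma limit_analytic (f : nat -> C -> C) (g : C -> C) : (forall n, analytic_disc (f n)) ->
  locally_bounded f -> (forall z, cmod z < 1 -> f ^~ z @ \oo --> g z) ->
  analytic_disc g /\ (forall z, cmod z < 1 -> (fun n => cderiv (f n) z) @ \oo --> cderiv g z).
Proof.
move=> df lb fg.
have gL s : s < 1 -> exists L, forall z w, cmod z <= s -> cmod w <= s -> cmod (g z - g w) <= L * cmod (z - w).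
  move=> s1; have [L HL] := equi_lipschitz df lb s1; exists L => z w zs ws.
  have z1 := le_lt_trans zs s1; have w1 := le_lt_trans ws s1.
  have H : (fun n => cmod (f n z - f n w)) @ \oo --> cmod (g z - g w).
    exact: cvg_cmod (ccvgB (fg _ z1) (fg _ w1)).
  apply: (@cvgr_to_le nat \oo _ R _ _ _ H).
  by apply: nearW => n; exact: HL.
have gat z : cmod z < 1 -> {for z, continuous g}.
  move=> z1; have [s0 zs s1] := midpoint_lt1 (cmod_ge0 z) z1; set s := (1 + cmod z) / 2 in s0 zs s1.
  have [L HL] := gL s s1.
  apply/(@cvgCP _ _ (nbhs z) _) => e e0.
  have L1 : 0 < `|L| + 1 by rewrite ltr_wpDl.
  have d0 : 0 < Num.min (s - cmod z) (e / (`|L| + 1)) by rewrite lt_min subr_gt0 zs divr_gt0.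
  have := near_cmod z d0; apply: filterS => w; rewrite lt_min => /andP[w1 w2].
  have ws : cmod w <= s.
    rewrite -(subrK z w); apply: le_trans (cmodD _ _) _; by rewrite -lerBrDr ltW.
  apply: le_lt_trans (HL _ _ ws (ltW zs)) _.
  apply: (@le_lt_trans _ _ ((`|L| + 1) * cmod (w - z))).
    by rewrite ler_wpM2r ?cmod_ge0 // (le_trans (ler_norm L)) // lerDl.
  by rewrite mulrC -ltr_pdivlMr.
have gonc r : 0 <= r -> r < 1 -> onc (fun u => g (rc r * u)).
  move=> r0 r1; apply: onc_comp; first by apply: oncZ; exact: onc_id.
  by move=> u u1; apply: gat; rewrite cmodM cmod_rc u1 mulr1 ger0_norm.
have conv r n z : 0 <= r -> r < 1 -> cmod z < r ->
    (fun m => cauchyint (fun u => f m (rc r * u)) r n z) @ \oo --> cauchyint (fun u => g (rc r * u)) r n z.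
  move=> r0 r1 zr; have [K HK] := lb r r1.
  have ck := onc_ckernel (n:=n) zr.
  have kb u : cmod u = 1 -> cmod (ckernel r n z u) <= r / (r - cmod z) ^+ n.+1.
    move=> u1; rewrite /ckernel cmodM cmodV cmodX cmodM cmod_rc u1 mulr1 ger0_norm //.
    have d0 : 0 < r - cmod z by rewrite subr_gt0.
    have ge := sub_circle_ge (lexx (cmod z)) (ltW zr) u1.
    apply: ler_wpM2l => //; rewrite lef_pV2 ?posrE ?exprn_gt0 ?(lt_le_trans d0 ge) //.
    by rewrite ler_pXn2r ?nnegrE ?(ltW d0) ?cmod_ge0.
  have fu u m : cmod u = 1 -> cmod (f m (rc r * u)) <= K.
    by move=> u1; apply: HK; rewrite cmodM cmod_rc u1 mulr1 ger0_norm.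
  apply: (@circ_dct (K * (r / (r - cmod z) ^+ n.+1))).
  - by move=> m; exact: oncM (analytic_onc (df m) r0 r1) ck.
  - exact: oncM (gonc r r0 r1) ck.
  - move=> u u1; apply: ccvgM; last exact: cvg_cst.
    by apply: fg; rewrite cmodM cmod_rc u1 mulr1 ger0_norm.
  - by move=> m u u1; rewrite cmodM; apply: ler_pM; [exact: cmod_ge0|exact: cmod_ge0|exact: fu|exact: kb].
have gE r z : 0 <= r -> r < 1 -> cmod z < r -> cauchyint (fun u => g (rc r * u)) r 0 z = g z * rc (2 * pi).
  move=> r0 r1 zr; have z1 := lt_trans zr r1.
  have c2 : (fun m => f m z * rc (2 * pi)) @ \oo --> g z * rc (2 * pi).
    by apply: ccvgM; [exact: fg|exact: cvg_cst].
  have c1 := conv r 0%N z r0 r1 zr.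
  have E : (fun m => cauchyint (fun u => f m (rc r * u)) r 0 z) = (fun m => f m z * rc (2 * pi)).
    by apply/funext => m; exact: cauchyint0 zr (analytic_disc_cdisc (df m) r1).
  rewrite E in c1; exact: (cvg_unique (@norm_hausdorff _ C) c1 c2).
have dg z r : 0 <= r -> r < 1 -> cmod z < r -> cder g z (cauchyint (fun u => g (rc r * u)) r 1 z / rc (2 * pi)).
  move=> r0 r1 zr; have [H _] := cder_cauchyint (gonc r r0 r1) zr.
  have := cderZ (rc (2 * pi))^-1 H; rewrite [_ ^-1 * _]mulrC; apply: near_cder.
  have d0 : 0 < r - cmod z by rewrite subr_gt0.
  have := near_cmod z d0; apply: filterS => w wz.
  have wr : cmod w < r.
    rewrite -(subrK z w); apply: le_lt_trans (cmodD _ _) _; by rewrite -ltrBrDr.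
  by rewrite (gE r w r0 r1 wr) mulrC mulfK // tpi_neq0.
split.
  apply/analytic_discP => z z1; have [r0 zr r1] := midpoint_lt1 (cmod_ge0 z) z1.
  eexists; exact: dg (ltW r0) r1 zr.
move=> z z1; have [r0 zr r1] := midpoint_lt1 (cmod_ge0 z) z1; set r := (1 + cmod z) / 2 in r0 zr r1.
rewrite (cder_cderiv (dg z r (ltW r0) r1 zr)).
have E : (fun m => cderiv (f m) z) = (fun m => cauchyint (fun u => f m (rc r * u)) r 1 z / rc (2 * pi)).
  by apply/funext => m; exact: cderiv_cauchy zr (analytic_disc_cdisc (df m) r1).
rewrite E; apply: ccvgM; last exact: cvg_cst.
exact: conv (ltW r0) r1 zr.
Qed.

End Montel.

(** * Montel's theorem *)

Section MontelTheorem.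
Variable R : realType.
Local Notation C := (CC R).

Lemma creB (z w : C) : cre (z - w) = cre z - cre w. Proof. by case: z w => [a b] [c d]. Qed.
Lemma cimB (z w : C) : cim (z - w) = cim z - cim w. Proof. by case: z w => [a b] [c d]. Qed.

Lemma cvg_of_uniform_approx (a : nat -> R) :
  (forall e, 0 < e -> exists2 b : nat -> R, cvg (b @ \oo) & forall n, `|b n - a n| <= e) -> cvg (a @ \oo).
Proof.
move=> H; apply/cauchy_cvgP; apply/cauchy_exP => e e0.
have e2 : 0 < e / 2 by rewrite divr_gt0.
have [b /cvg_ex[l bl] ba] := H _ e2; exists l.
have /cvgrPdist_lt/(_ _ e2) := bl; apply: filterS => n ln.
rewrite /ball /= [l - a n](_ : _ = (l - b n) + (b n - a n)); last by ring.
by apply: le_lt_trans (ler_normD _ _) _; rewrite [e]splitr; exact: ltr_leD.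
Qed.

(** An enumeration of the points of the disc with rational coordinates. Indices that code no pair,
    or a point outside the disc, are sent to 0, so that every value lies in the disc. *)
Definition rational_point (k : nat) : C :=
  if unpickle k is Some p then
    let v := cpt (ratr (p : rat * rat).1) (ratr p.2) in if cmod v < 1 then v else 0
  else 0.

Lemma rational_point_lt1 k : cmod (rational_point k) < 1.
Proof.
rewrite /rational_point; case: unpickle => [p|]; last by rewrite cmod0.
by case: ifPn => // _; rewrite cmod0.
Qed.

Lemma rational_point_dense (z : C) d : 0 < d -> cmod z < 1 ->
  exists k, cmod (rational_point k - z) < d.
Proof.
move=> d0 z1; pose e := Num.min d (1 - cmod z) / 2.
have e0 : 0 < e by rewrite divr_gt0 // lt_min d0 subr_gt0.
have approx (x : R) : exists q : rat, `|ratr q - x| < e.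
  have : x - e < x + e by rewrite ltrD2l gtrN.
  by move=> /rat_in_itvoo[q]; rewrite in_itv /= -ltr_distlC distrC; exists q.
have [a ha] := approx (cre z); have [b hb] := approx (cim z).
pose v : C := cpt (ratr a) (ratr b).
have vz : cmod (v - z) < Num.min d (1 - cmod z).
  have -> : v - z = rc (ratr a - cre z) + ci R * rc (ratr b - cim z).
    apply: ceq; rewrite /v /rc /ci; by rewrite !creimE; ring.
  apply: le_lt_trans (cmodD _ _) _; rewrite cmodM cmod_ci mul1r !cmod_rc.
  by rewrite [Num.min _ _](splitr); exact: ltrD.
move: vz; rewrite lt_min => /andP[vd v1].
have v1' : cmod v < 1.
  rewrite -(subrK z v); apply: le_lt_trans (cmodD _ _) _; by rewrite -ltrBrDr.
exists (pickle (a, b)); rewrite /rational_point pickleK /=.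
by rewrite -/v v1'.
Qed.

(** Diagonal extraction gives convergence at the rational points, and the common Lipschitz constants
    on smaller discs carry it to all points. *)
Lemma montel (f : nat -> C -> C) : (forall n, analytic_disc (f n)) -> locally_bounded f ->
  exists2 phi : nat -> nat, {homo phi : m n / (m < n)%N} &
  exists g, [/\ analytic_disc g, (forall z, cmod z < 1 -> (fun n => f (phi n) z) @ \oo --> g z) &
    (forall z, cmod z < 1 -> (fun n => cderiv (f (phi n)) z) @ \oo --> cderiv g z)].
Proof.
move=> df lb.
pose v n k : C := f n (rational_point k).
have [B HB] : {B : nat -> R & forall k n, cmod (v n k) <= B k}.
  apply: (@choice nat R (fun k B => forall n, cmod (v n k) <= B)) => k.
  by have [K HK] := lb _ (rational_point_lt1 k); exists K => n; exact: HK.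
(* [diag_extract] handles real sequences: even indices carry the real parts, odd ones the imaginary
   parts. *)
pose x n k : R := if odd k then cim (v n k./2) else cre (v n k./2).
have [n k|phi phiS Hphi] := @diag_extract R x (fun k => B k./2).
  rewrite /x; case: ifP => _; apply: le_trans (HB _ _); [exact: cim_le|exact: cre_le].
have cR k : cvg ((fun n => cre (v (phi n) k)) @ \oo).
  by have := Hphi k.*2; rewrite /x odd_double doubleK.
have cI k : cvg ((fun n => cim (v (phi n) k)) @ \oo).
  by have := Hphi k.*2.+1; rewrite /x /= odd_double /= uphalf_double.
have approx z : cmod z < 1 -> forall e, 0 < e -> exists k, forall n, cmod (v n k - f n z) <= e.
  move=> z1 e e0; have [s0 zs s1] := midpoint_lt1 (cmod_ge0 z) z1.
  set s := (1 + cmod z) / 2 in s0 zs s1.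
  have [L HL] := equi_lipschitz df lb s1.
  have L1 : 0 < `|L| + 1 by rewrite ltr_wpDl.
  have d0 : 0 < Num.min (s - cmod z) (e / (`|L| + 1)) by rewrite lt_min subr_gt0 zs divr_gt0.
  have [k] := rational_point_dense d0 z1; rewrite lt_min => /andP[k1 k2].
  exists k => n.
  have ks : cmod (rational_point k) <= s.
    rewrite -(subrK z (rational_point k)); apply: le_trans (cmodD _ _) _; by rewrite -lerBrDr ltW.
  apply: le_trans (HL n _ _ ks (ltW zs)) _.
  apply: (@le_trans _ _ ((`|L| + 1) * cmod (rational_point k - z))).
    by rewrite ler_wpM2r ?cmod_ge0 // (le_trans (ler_norm L)) // lerDl.
  by rewrite mulrC -ler_pdivlMr // ltW.
pose g z := cpt (lim ((fun n => cre (f (phi n) z)) @ \oo)) (lim ((fun n => cim (f (phi n) z)) @ \oo)).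
have fg z : cmod z < 1 -> (fun n => f (phi n) z) @ \oo --> g z.
  move=> z1.
  have c1 : cvg ((fun n => cre (f (phi n) z)) @ \oo).
    apply: cvg_of_uniform_approx => e e0; have [k Hk] := approx z z1 e e0.
    exists (fun n => cre (v (phi n) k)); first exact: cR.
    by move=> n; rewrite -creB; exact: le_trans (cre_le _) (Hk _).
  have c2 : cvg ((fun n => cim (f (phi n) z)) @ \oo).
    apply: cvg_of_uniform_approx => e e0; have [k Hk] := approx z z1 e e0.
    exists (fun n => cim (v (phi n) k)); first exact: cI.
    by move=> n; rewrite -cimB; exact: le_trans (cim_le _) (Hk _).
  have -> : (fun n => f (phi n) z) = (fun n => cpt (cre (f (phi n) z)) (cim (f (phi n) z))).
    by apply/funext => n; exact: cptE.
  exact: cvg_cpt c1 c2.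
have lb' : locally_bounded (fun n => f (phi n)).
  by move=> s s1; have [K HK] := lb s s1; exists K => n z; exact: HK.
have [dg dfg] := @limit_analytic R (fun n => f (phi n)) g (fun n => df (phi n)) lb' fg.
by exists phi => //; exists g; split.
Qed.

End MontelTheorem.

(** * Extended-valued integrals over half-open intervals *)

Section HalfOpenIntegrals.
Variable R : realType.
Local Notation mu := (@lebesgue_measure R).
Local Notation M := (measurableTypeR R).
Implicit Types (a b c : R) (f g : R -> R).

Definition mco a b f := measurable_fun (`[a, b[ : set M) (f : M -> M).
(** The interval excludes 1, where weight and means are not controlled. The value is extended real,
    so that inequalities can be stated before finiteness is known. *)
Definition EI a b f : \bar R := (\int[mu]_(x in `[a, b[) (f x)%:E)%E.

Lemma mcoS a b c d f : a <= c -> d <= b -> mco a b f -> mco c d f.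
Proof.
move=> ac db; apply: measurable_funS; first exact: measurable_itv.
by move=> x; rewrite /= !in_itv /= => /andP[cx xd]; rewrite (le_trans ac cx) (lt_le_trans xd db).
Qed.

Lemma mco_cst a b k : mco a b (fun=> k).
Proof. exact: measurable_cst. Qed.

Lemma mcoM a b f g : mco a b f -> mco a b g -> mco a b (fun x => f x * g x).
Proof. exact: measurable_funM. Qed.

Lemma mcoD a b f g : mco a b f -> mco a b g -> mco a b (fun x => f x + g x).
Proof. exact: measurable_funD. Qed.

Lemma EI_ge0 a b f : (forall x, a <= x < b -> 0 <= f x) -> (0 <= EI a b f)%E.
Proof. by move=> f0; apply: integral_ge0 => x; rewrite /= in_itv /= lee_fin; exact: f0. Qed.

Lemma EI_le a b f g : mco a b f -> mco a b g -> (forall x, a <= x < b -> 0 <= f x) ->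
  (forall x, a <= x < b -> f x <= g x) -> (EI a b f <= EI a b g)%E.
Proof.
move=> mf mg f0 fg; apply: ge0_le_integral; first exact: measurable_itv.
- by move=> x; rewrite /= in_itv /= lee_fin; exact: f0.
- exact/measurable_EFinP.
- exact/measurable_EFinP.
- by move=> x; rewrite /= in_itv /= lee_fin; exact: fg.
Qed.

Lemma eq_EI a b f g : (forall x, a <= x < b -> f x = g x) -> EI a b f = EI a b g.
Proof. by move=> fg; apply: eq_integral => x; rewrite inE /= in_itv /= => /fg ->. Qed.

Lemma EI_cst a b k : a <= b -> EI a b (fun=> k) = (k * (b - a))%:E.
Proof.
move=> ab; rewrite /EI integral_cst //= lebesgue_measure_itv /= lte_fin.
case: ltP => [//|ba]; rewrite (_ : b = a) ?subrr ?mulr0 ?mule0 //.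
by apply/eqP; rewrite eq_le ba ab.
Qed.

Lemma EIZ a b k f : 0 <= k -> mco a b f -> (forall x, a <= x < b -> 0 <= f x) ->
  (EI a b (fun x => k * f x)%R = k%:E * EI a b f)%E.
Proof.
move=> k0 mf f0; rewrite /EI; under eq_integral do rewrite EFinM.
by rewrite ge0_integralZl //; exact/measurable_EFinP.
Qed.

Lemma EID a b f g : mco a b f -> mco a b g -> (forall x, a <= x < b -> 0 <= f x) ->
  (forall x, a <= x < b -> 0 <= g x) -> (EI a b (fun x => f x + g x)%R = EI a b f + EI a b g)%E.
Proof.
move=> mf mg f0 g0; rewrite /EI; under eq_integral do rewrite EFinD.
rewrite ge0_integralD //; exact/measurable_EFinP.
Qed.

Lemma EI_split a b c f : a <= b -> b <= c -> mco a c f -> (forall x, a <= x < c -> 0 <= f x) ->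
  (EI a c f = EI a b f + EI b c f)%E.
Proof.
move=> ab bc mf f0; rewrite /EI.
have E : `[a, c[%classic = `[a, b[%classic `|` `[b, c[%classic by apply: itv_bndbnd_setU.
rewrite E ge0_integral_setU; first by [].
- exact: measurable_itv.
- exact: measurable_itv.
- by rewrite -E; apply/measurable_EFinP.
- by move=> x; rewrite -E /= in_itv /= lee_fin; exact: f0.
- apply/disj_setPS => x; rewrite /= !in_itv /= => -[/andP[_ xb] /andP[bx _]].
  by move: (lt_le_trans xb bx); rewrite ltxx.
Qed.

Lemma EI_sub a b c d f : a <= c -> d <= b -> mco a b f -> (forall x, a <= x < b -> 0 <= f x) ->
  (EI c d f <= EI a b f)%E.
Proof.
move=> ac db mf f0; apply: ge0_subset_integral; [exact: measurable_itv|exact: measurable_itv|..].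
- exact/measurable_EFinP.
- by move=> x; rewrite /= in_itv /= lee_fin; exact: f0.
- by move=> x; rewrite /= !in_itv /= => /andP[cx xd]; rewrite (le_trans ac cx) (lt_le_trans xd db).
Qed.

(** Monotone convergence: bounds proved up to each point of the sequence pass to the whole
    interval. *)
Lemma EI_sup a b f (s : nat -> R) (K : \bar R) : {homo s : m n / (m <= n)%N >-> m <= n} ->
  (forall n, s n < b) -> (forall x, x < b -> exists n, x < s n) -> mco a b f ->
  (forall x, a <= x < b -> 0 <= f x) -> (forall n, (EI a (s n) f <= K)%E) -> (EI a b f <= K)%E.
Proof.
move=> sm sb sx mf f0 H.
have U : \bigcup_i `[a, s i[%classic = `[a, b[%classic.
  apply/seteqP; split => x.
    by move=> [n _]; rewrite /= !in_itv /= => /andP[-> xs]; exact: lt_trans (sb n).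
  rewrite /= in_itv /= => /andP[ax xb]; have [n xn] := sx x xb.
  by exists n => //; rewrite /= in_itv /= ax.
have h1 : {homo (fun n : nat => `[a, s n[%classic) : n m / (n <= m)%N >-> (n <= m)%O}.
  move=> m n mn; apply/subsetPset => x; rewrite /= !in_itv /= => /andP[-> xm].
  exact: lt_le_trans xm (sm _ _ mn).
have h2 (i : nat) : measurable `[a, s i[%classic by exact: measurable_itv.
have h3 i : measurable_fun `[a, s i[%classic (EFin \o f).
  by apply/measurable_EFinP; apply: mcoS mf => //; exact: ltW.
have h4 i x : `[a, s i[%classic x -> (0 <= (EFin \o f) x)%E.
  rewrite /= in_itv /= lee_fin => /andP[ax xs]; apply: f0; rewrite ax; exact: lt_trans (sb i).
have := ge0_nondecreasing_set_cvg_integral (mu := lebesgue_measure) h1 h2 h3 h4.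
rewrite U => L; rewrite /EI -(cvg_lim _ L) //; apply: lime_le; first by apply/cvg_ex; eexists; exact: L.
by apply: nearW => n; exact: H.
Qed.

End HalfOpenIntegrals.

(** * Radial weights and tails of monotone functions *)

Section WeightTails.
Variable R : realType.
Local Notation mu := (@lebesgue_measure R).
Local Notation M := (measurableTypeR R).
Implicit Types (N w : R -> R) (r s e : R).

Definition nondecreasing01 N := forall r s, 0 <= r -> r <= s -> s < 1 -> N r <= N s.

Lemma nondecreasing01_mco N a : 0 <= a -> nondecreasing01 N -> mco a 1 N.
Proof.
move=> a0 nN; apply: (measurability (@RGenCInfty.G R)) => [|/= _ [_] [r] -> <-].
  exact: RGenCInfty.measurableE.
apply: is_interval_measurable => x y /= [].
rewrite !in_itv /= !andbT => /andP[ax x1] rx [/andP[ay y1] ry] z /andP[xz zy].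
rewrite !in_itv /= andbT (le_trans ax xz) (le_lt_trans zy y1); split=> //.
by apply: le_trans rx _; apply: nN; [exact: le_trans ax|exact: xz|exact: le_lt_trans y1].
Qed.

Section Weight.
Variable w : R -> R.
Hypothesis rw : radial_weight w.
Local Notation W := (omega_hat w).

Lemma weight_ge0 r : 0 <= r < 1 -> 0 <= w r.
Proof. by case: rw => h _ _; exact: h. Qed.

Lemma weight_ge0' a : 0 <= a -> forall r, a <= r < 1 -> 0 <= w r.
Proof. by move=> a0 r /andP[ar r1]; rewrite weight_ge0 // r1 (le_trans a0). Qed.

Lemma weight_mco a b : 0 <= a -> b <= 1 -> mco a b w.
Proof.
case: rw => _ iw _ a0 b1; apply: (@mcoS _ 0 1) => //.
by case/integrableP: iw => /measurable_EFinP.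
Qed.

Lemma omega_hat_gt0 r : 0 <= r < 1 -> 0 < W r.
Proof. by case: rw => _ _; exact. Qed.

Lemma weight_integrable a : 0 <= a -> mu.-integrable `[a, 1[ (fun r => (w r)%:E).
Proof.
case: rw => _ iw _ a0; apply: (integrableS _ _ _ iw); try exact: measurable_itv.
by move=> x; rewrite /= !in_itv /= => /andP[ax ->]; rewrite (le_trans a0 ax).
Qed.

Lemma omega_hatE r : 0 <= r -> EI r 1 w = (W r)%:E.
Proof.
move=> r0; rewrite /omega_hat /Rintegral fineK //.
exact: integrable_fin_num (weight_integrable r0).
Qed.

Lemma EI_weight a b : 0 <= a -> a <= b -> b <= 1 -> EI a b w = (W a - W b)%:E.
Proof.
move=> a0 ab b1; have := EI_split ab b1 (weight_mco a0 (lexx 1)) (weight_ge0' a0).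
rewrite !omega_hatE //; last exact: le_trans ab.
case: (EI a b w) => [x| |] //= [->]; by rewrite addrK.
Qed.

Lemma omega_hat_nonincreasing a b : 0 <= a -> a <= b -> b < 1 -> W b <= W a.
Proof.
move=> a0 ab b1; rewrite -subr_ge0 -lee_fin -(EI_weight a0 ab (ltW b1)); apply: EI_ge0 => x /andP[ax xb].
by apply: (weight_ge0' a0); rewrite ax (lt_trans xb).
Qed.

Definition dyadic r n : R := 1 - (1 - r) / 2 ^+ n.

Lemma dyadic0 r : dyadic r 0 = r.
Proof. by rewrite /dyadic expr0 divr1 opprB addrC subrK. Qed.

Lemma dyadicS r n : 1 - dyadic r n.+1 = (1 - dyadic r n) / 2.
Proof. by rewrite /dyadic exprS; field; rewrite expf_neq0. Qed.

Lemma dyadic_lt1 r n : r < 1 -> dyadic r n < 1.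
Proof. by move=> r1; rewrite /dyadic ltrBlDr ltrDl divr_gt0 ?exprn_gt0 // subr_gt0. Qed.

Lemma dyadic_ltS r n : r < 1 -> dyadic r n < dyadic r n.+1.
Proof. by move=> /(@dyadic_lt1 _ n) h; have := dyadicS r n; lra. Qed.

Lemma dyadic_homo r : r < 1 -> {homo dyadic r : m n / (m <= n)%N >-> m <= n}.
Proof.
by move=> r1; apply: homo_leq => [//|y x z|n]; [exact: le_trans|exact: ltW (dyadic_ltS _ r1)].
Qed.

Lemma dyadic_ge r n : r < 1 -> r <= dyadic r n.
Proof. by move=> r1; rewrite -{1}(dyadic0 r); exact: dyadic_homo. Qed.

Lemma dyadic_sup r x : r < 1 -> x < 1 -> exists n, x < dyadic r n.
Proof.
move=> r1 x1; have r1' : 0 < 1 - r by rewrite subr_gt0.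
have x1' : 0 < 1 - x by rewrite subr_gt0.
have := @cvg_geometric R (1 - r) (2^-1).
rewrite ger0_norm ?invr_ge0 // => /(_ ltac:(lra)) /cvgrPdist_lt /(_ _ x1') [n _ /(_ n (leqnn n))].
rewrite sub0r normrN /geometric /= ger0_norm ?mulr_ge0 ?exprn_ge0 ?ltW // exprVn => h.
by exists n; rewrite /dyadic ltrBrDr addrC -ltrBrDr.
Qed.

(* Abel summation along the points [1 - 2^-n (1 - s)], kept in inductive form. *)
Lemma tail_le_weighted N e s : 0 <= s -> s < 1 -> 0 <= e ->
  (forall r, s <= r -> r < 1 -> 1 - r <= e * W r) ->
  nondecreasing01 N -> (forall r, 0 <= r -> r < 1 -> 0 <= N r) ->
  (EI s 1 N <= (2 * e)%:E * EI s 1 (fun r => w r * N r)%R)%E.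
Proof.
move=> s0 s1 e0 He nN N0; pose x := dyadic s.
have x1 n : x n < 1 by exact: dyadic_lt1.
have xs n : s <= x n by exact: dyadic_ge.
have x0 n : 0 <= x n by exact: le_trans (xs n).
have xS n : x n <= x n.+1 by exact: ltW (dyadic_ltS _ s1).
have mN : mco s 1 N by exact: nondecreasing01_mco.
have mw : mco s 1 w by exact: weight_mco.
have N0s b r : b <= 1 -> s <= r < b -> 0 <= N r.
  by move=> b1 /andP[sr rb]; apply: N0; [exact: le_trans sr|exact: lt_le_trans rb b1].
have wN0 b r : b <= 1 -> s <= r < b -> 0 <= w r * N r.
  by move=> b1 h; rewrite mulr_ge0 ?(N0s b) // (weight_ge0' s0) //; case/andP: h => -> /lt_le_trans ->.
(* The remainder of the summation after [n] steps; it is nonnegative by [He]. *)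
pose c n := 2 * e * (N (x n) * W (x n)) - N (x n) * (1 - x n).
have c0 n : 0 <= c n.
  have h1 := He _ (xs n) (x1 n); have h2 := N0 _ (x0 n) (x1 n).
  have h3 : 0 <= N (x n) * (e * W (x n) - (1 - x n)) by rewrite mulr_ge0 // subr_ge0.
  have h4 : 0 <= N (x n) * (1 - x n) by rewrite mulr_ge0 // subr_ge0 ltW.
  by rewrite /c; lra.
have step n : (EI s (x n) N <=
   (2 * e)%:E * EI s (x n) (fun r => w r * N r)%R + (c n)%:E)%E.
  elim: n => [|n IH].
    rewrite /x dyadic0 -/x.
    have E f : EI s s f = 0%E by rewrite /EI set_itvco0 integral_set0.
    by rewrite !E mule0 add0e lee_fin.
  have y0 := xs n; have yS := xS n; have b1 := ltW (x1 n.+1).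
  rewrite (EI_split y0 yS (mcoS (lexx s) b1 mN) (N0s _ ^~ b1)).
  have mwN := mcoM (mcoS (lexx s) b1 mw) (mcoS (lexx s) b1 mN).
  rewrite (EI_split y0 yS mwN (wN0 _ ^~ b1)).
  have N1 := N0 _ (x0 n) (x1 n); have N2 := N0 _ (x0 n.+1) (x1 n.+1).
  have N12 := nN _ _ (x0 n) yS (x1 n.+1).
  have dS : 1 - x n.+1 = (1 - x n) / 2 by exact: dyadicS.
  have h1 : (EI (x n) (x n.+1) N <= (N (x n.+1) * (x n.+1 - x n))%:E)%E.
    rewrite -EI_cst //; apply: EI_le => //.
    - exact: mcoS y0 b1 mN.
    - exact: mco_cst.
    - by move=> r /andP[h h']; apply: (N0s _ _ b1); rewrite h' (le_trans y0 h).
    - by move=> r /andP[h h']; apply: nN; [exact: le_trans h|exact: ltW|exact: x1].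
  have h2 : ((N (x n) * (W (x n) - W (x n.+1)))%:E <= EI (x n) (x n.+1) (fun r => w r * N r)%R)%E.
    rewrite EFinM -EI_weight // -EIZ //.
    - apply: EI_le.
      + by apply: mcoM; [exact: mco_cst|exact: mcoS y0 b1 mw].
      + exact: mcoS y0 (lexx _) mwN.
      + move=> r /andP[h h']; rewrite mulr_ge0 // (weight_ge0' s0) //.
        by rewrite (le_trans y0 h) (lt_le_trans h' b1).
      + move=> r /andP[h h']; rewrite mulrC ler_wpM2l //.
          by rewrite (weight_ge0' s0) // (le_trans y0 h) (lt_le_trans h' b1).
        by apply: nN; [exact: x0|exact: h|exact: lt_le_trans h' b1].
    - exact: mcoS y0 b1 mw.
    - by move=> r /andP[h h']; rewrite (weight_ge0' s0) // (le_trans y0 h) (lt_le_trans h' b1).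
  have hW := He _ (xs n.+1) (x1 n.+1).
  (* Since [1 - x n = 2 (1 - x n.+1)], the right side exceeds the left by exactly twice the product
     of [N (x n.+1) - N (x n)] with [e * W (x n.+1) - (1 - x n.+1)]. This is where the factor 2 in
     front of [e] comes from. *)
  have key : c n + N (x n.+1) * (x n.+1 - x n) <=
      2 * e * (N (x n) * (W (x n) - W (x n.+1))) + c n.+1.
    have : 0 <= (N (x n.+1) - N (x n)) * (e * W (x n.+1) - (1 - x n.+1)).
      by rewrite mulr_ge0 // subr_ge0.
    rewrite /c; have -> : x n = 1 - 2 * (1 - x n.+1) by rewrite dS; field.
    lra.
  have p1 : (0 <= EI s (x n) (fun r => w r * N r)%R)%E.
    by apply: EI_ge0 => r h; exact: (wN0 _ _ (ltW (x1 n))).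
  have p2 : (0 <= EI (x n) (x n.+1) (fun r => w r * N r)%R)%E.
    by apply: EI_ge0 => r /andP[h h']; apply: (wN0 _ _ b1); rewrite h' (le_trans y0 h).
  apply: le_trans (leeD IH h1) _; rewrite -addeA -EFinD (ge0_muleDr _ p1 p2).
  rewrite -addeA leeD2l //.
  have h3 : ((2 * e * (N (x n) * (W (x n) - W (x n.+1))))%:E <=
    (2 * e)%:E * EI (x n) (x n.+1) (fun r => w r * N r)%R)%E.
    by rewrite EFinM lee_wpmul2l // lee_fin mulr_ge0.
  apply: le_trans (leeD2r (c n.+1)%:E h3).
  by rewrite -EFinD lee_fin.
have e2 : (0 <= (2 * e)%:E :> \bar R)%E by rewrite lee_fin mulr_ge0.
apply: (@EI_sup _ s 1 N x); first exact: dyadic_homo.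
- exact: x1.
- by move=> y; exact: dyadic_sup.
- exact: mN.
- exact: (N0s 1 ^~ (lexx 1)).
move=> n; apply: le_trans (step n) _.
(* The remainder is paid for by the part of the weighted integral beyond [x n], where [N >= N (x n)]
   and the weight has mass [W (x n)]. *)
have h : ((c n)%:E <= (2 * e)%:E * EI (x n) 1 (fun r => w r * N r)%R)%E.
  have N1 := N0 _ (x0 n) (x1 n).
  apply: (@le_trans _ _ ((2 * e)%:E * (N (x n) * W (x n))%:E)%E).
    rewrite -EFinM lee_fin /c gerBl mulr_ge0 // subr_ge0 ltW //; exact: x1.
  apply: lee_wpmul2l => //; rewrite EFinM -omega_hatE // -EIZ //.
  - apply: EI_le.
    + by apply: mcoM; [exact: mco_cst|exact: mcoS (xs n) (lexx _) mw].
    + by apply: mcoM; [exact: mcoS (xs n) (lexx _) mw|exact: mcoS (xs n) (lexx _) mN].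
    + by move=> r h; rewrite mulr_ge0 // (weight_ge0' (x0 n)).
    + move=> r h; rewrite mulrC ler_wpM2l ?(weight_ge0' (x0 n)) //.
      by case/andP: h => h h'; apply: nN.
  - exact: mcoS (xs n) (lexx _) mw.
  - exact: weight_ge0' (x0 n).
have p1 : (0 <= EI s (x n) (fun r => w r * N r)%R)%E.
  by apply: EI_ge0 => r h'; exact: (wN0 _ _ (ltW (x1 n))).
have p2 : (0 <= EI (x n) 1 (fun r => w r * N r)%R)%E.
  by apply: EI_ge0 => r /andP[h1 h2]; apply: (wN0 1) => //; rewrite h2 (le_trans (xs n) h1).
apply: le_trans (leeD2l _ h) _; rewrite -(ge0_muleDr _ p1 p2).
by rewrite -(EI_split (xs n) (ltW (x1 n)) (mcoM mw mN) (wN0 _ ^~ (lexx 1))).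
Qed.

End Weight.
End WeightTails.

(** * Means of the derivative and the norm of [D^1] *)

Section DerivativeMeans.
Variable R : realType.
Local Notation C := (CC R).
Local Notation mu := (@lebesgue_measure R).
Implicit Types (f g : C -> C) (z u : C) (w : R -> R) (r s : R).

(** The factor [r] is the Jacobian of polar coordinates. The circle integral is not divided by
    [2 * pi], whence the factors of [pi] in the norm and in the growth bounds. *)
Definition dmean f r : R := r * rcirc (fun u => cmod (cderiv f (rc r * u))).

Lemma onc_dmean f r : analytic_disc f -> 0 <= r -> r < 1 -> onc (fun u => cmod (cderiv f (rc r * u))).
Proof. by move=> df r0 r1; apply: onc_cmod; exact: analytic_onc (analytic_cderiv df) r0 r1. Qed.

Lemma dmean_ge0 f r : 0 <= r -> 0 <= dmean f r.
Proof. by move=> r0; apply: mulr_ge0 r0 _; apply: rcirc_ge0 => u _; exact: cmod_ge0. Qed.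

Lemma dmean_nondecreasing f : analytic_disc f -> nondecreasing01 (dmean f).
Proof.
move=> df r s r0; rewrite le_eqVlt => /predU1P[-> //|rs] s1.
have h := circle_mean_nondecreasing r0 rs (analytic_disc_cdisc (analytic_cderiv df) s1).
have h0 : 0 <= rcirc (fun u => cmod (cderiv f (rc r * u))) by apply: rcirc_ge0 => u _; exact: cmod_ge0.
exact: ler_pM r0 h0 (ltW rs) h.
Qed.

Lemma dmeanB f g r : analytic_disc f -> analytic_disc g -> 0 <= r -> r < 1 ->
  dmean (fun z => f z - g z) r <= dmean f r + dmean g r.
Proof.
move=> df dg r0 r1; rewrite /dmean -mulrDr; apply: (ler_wpM2l r0).
have cf := onc_dmean df r0 r1; have cg := onc_dmean dg r0 r1.
have cfg := onc_dmean (analyticB df dg) r0 r1.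
have cD : onc (fun u => cmod (cderiv f (rc r * u)) + cmod (cderiv g (rc r * u))).
  by move=> u u1; exact: (at_rD (cf u u1) (cg u u1)).
have -> : rcirc (fun u => cmod (cderiv f (rc r * u))) + rcirc (fun u => cmod (cderiv g (rc r * u))) =
    rcirc (fun u => cmod (cderiv f (rc r * u)) + cmod (cderiv g (rc r * u))).
  rewrite /rcirc -(RID (onc_rcon cf) (onc_rcon cg)); apply: eq_RI => t _; ring.
apply: rcirc_le => // u u1; rewrite cderivB //; first exact: cmodB.
by rewrite cmodM cmod_rc u1 mulr1 ger0_norm.
Qed.

Lemma D1_normE w f : radial_weight w -> analytic_disc f ->
  D1_norm w f = (EI 0 1 (fun r => w r * dmean f r)%R * (pi^-1)%:E + (cmod (f 0))%:E)%E.
Proof.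
move=> rw df; rewrite /D1_norm /disc_integral; congr (_ * _ + _)%E.
have c z : cmod z < 1 -> {for z, continuous (fun z => cmod (cderiv f z))}.
  by move=> z1; apply: at_cmod; exact: analytic_at (analytic_cderiv df) z1.
rewrite (polar_disc c (fun z _ => cmod_ge0 _) (weight_mco rw (lexx 0) (lexx 1)) (weight_ge0 rw)).
by apply: eq_integral => r _; congr EFin; rewrite /dmean; ring.
Qed.

Lemma cderiv_le_dmean f z r : analytic_disc f -> cmod z < r -> r < 1 ->
  2 * pi * (r - cmod z) * cmod (cderiv f z) <= dmean f r.
Proof.
move=> df zr r1; have := circle_mean_bound zr (analytic_disc_cdisc (analytic_cderiv df) r1).
have d0 : 0 < r - cmod z by rewrite subr_gt0.
have -> : r / (r - cmod z) * rcirc (fun u => cmod (cderiv f (rc r * u))) = dmean f r / (r - cmod z).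
  by rewrite /dmean; ring.
by rewrite ler_pdivlMr // mulrAC.
Qed.

Opaque dmean.

Lemma radial_weight_one : radial_weight (@one_weight R).
Proof.
have i1 : mu.-integrable `[0, 1[ (fun r => (@one_weight R r)%:E).
  have ic := con_integrable (@con_cst R R 0 1 (1 : R)).
  apply: (integrableS _ _ _ ic); try exact: measurable_itv.
  by move=> x; rewrite /= !in_itv /= => /andP[-> /ltW].
split=> [r _|//|r /andP[_ r1]]; first exact: ler01.
rewrite /omega_hat /Rintegral.
by rewrite -/(EI r 1 (fun=> 1)) EI_cst ?ltW //= mul1r subr_gt0.
Qed.

Lemma dmean_mco f a : analytic_disc f -> 0 <= a -> mco a 1 (dmean f).
Proof. by move=> df a0; exact: nondecreasing01_mco a0 (dmean_nondecreasing df). Qed.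

Lemma EI_weight_dmean_ge0 w f a b : radial_weight w -> 0 <= a -> b <= 1 ->
  (0 <= EI a b (fun r => w r * dmean f r)%R)%E.
Proof.
move=> rw a0 b1; apply: EI_ge0 => r /andP[ar rb]; apply: mulr_ge0.
  by apply: (weight_ge0' rw a0); rewrite ar (lt_le_trans rb).
exact: dmean_ge0 (le_trans a0 ar).
Qed.

Lemma EI_le_D1_norm w f : radial_weight w -> analytic_disc f ->
  (EI 0 1 (fun r => w r * dmean f r)%R <= pi%:E * D1_norm w f)%E.
Proof.
move=> rw df; rewrite D1_normE //.
have p := EI_weight_dmean_ge0 (w := w) f rw (lexx 0) (lexx 1).
have pi0 : 0 < pi :> R by exact: pi_gt0.
rewrite ge0_muleDr; last 2 first.
- by rewrite mule_ge0 // lee_fin invr_ge0 ltW.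
- by rewrite lee_fin cmod_ge0.
rewrite muleCA -EFinM divff ?gt_eqF // mule1 leeDl // -EFinM lee_fin mulr_ge0 ?cmod_ge0 // ltW //.
Qed.

Lemma cmod0_le_D1_norm w f : radial_weight w -> analytic_disc f -> ((cmod (f 0))%:E <= D1_norm w f)%E.
Proof.
move=> rw df; rewrite D1_normE // leeDr // mule_ge0 //; first exact: EI_weight_dmean_ge0.
by rewrite lee_fin invr_ge0 pi_ge0.
Qed.

(** On [[r, 1[] the mean is at least [dmean f r], and the weight has mass [omega_hat w r] there. A
    norm bound thus becomes a growth bound for the means. *)
Lemma dmean_omega_hat w f r : radial_weight w -> analytic_disc f -> 0 <= r -> r < 1 ->
  ((dmean f r * omega_hat w r)%:E <= EI 0 1 (fun r => w r * dmean f r)%R)%E.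
Proof.
move=> rw df r0 r1; have d0 := dmean_ge0 f r0.
have mw := weight_mco rw r0 (lexx 1).
rewrite EFinM -(omega_hatE rw r0) -EIZ //; last exact: weight_ge0' rw _ r0.
apply: (@le_trans _ _ (EI r 1 (fun r => w r * dmean f r)%R)).
  apply: EI_le.
  - by apply: mcoM; [exact: mco_cst|exact: mw].
  - by apply: mcoM; [exact: mw|exact: dmean_mco].
  - by move=> x xr; rewrite mulr_ge0 // (weight_ge0' rw r0).
  - move=> x xr; rewrite [leLHS]mulrC; apply: ler_wpM2l; first exact: (weight_ge0' rw r0).
    by case/andP: xr => rx x1; exact: dmean_nondecreasing.
apply: EI_sub => //.
- by apply: mcoM; [exact: weight_mco|exact: dmean_mco].
- by move=> x /andP[x0 x1]; rewrite mulr_ge0 ?dmean_ge0 // weight_ge0 // x0.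
Qed.

Lemma analytic_increment f z (L : R) : analytic_disc f -> cmod z < 1 ->
  (forall t, 0 <= t -> t <= 1 -> cmod (cderiv f (rc t * z)) <= L) -> cmod (f z - f 0) <= L * cmod z.
Proof.
move=> df z1 H.
have c : con 0 1 (fun t => cderiv f (rc t * z)) by exact: con_ray (analytic_cderiv df) z1.
have c2 : con 0 1 (fun t => cderiv f (rc t * z) * z) by exact: (conM c (@con_cst R C 0 1 z)).
have := CI_FTC ler01 (fun t (h : 0 <= t <= 1) => vel_ray df z1 (proj1 (andP h)) (proj2 (andP h))) c2.
rewrite rc1 rc0 mul1r mul0r => <-.
have := CI_bound ler01 c2 (M := L * cmod z); rewrite subr0 mulr1; apply => t /andP[t0 t1].
by rewrite cmodM ler_wpM2r ?cmod_ge0 // H.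
Qed.

(** The norm controls the mean at the radius midway between [s] and 1, this mean controls [f'] for
    [|z| <= s], and integration from 0 controls [f]. For negative [s] there is no such [z]. *)
Lemma D1_locally_bounded w s : radial_weight w -> s < 1 -> exists K : R, forall f, analytic_disc f ->
  (D1_norm w f <= 1)%E -> forall z, cmod z <= s -> cmod (f z) <= K.
Proof.
move=> rw s1; have [s0|s0] := ltP s 0.
  by exists 0 => f _ _ z zs; move: (le_lt_trans (le_trans (cmod_ge0 z) zs) s0); rewrite ltxx.
have [r0 sr r1] := midpoint_lt1 s0 s1; set r := (1 + s) / 2 in r0 sr r1.
have W0 : 0 < omega_hat w r by apply: (omega_hat_gt0 rw); rewrite (ltW r0) r1.
have rs0 : 0 < r - s by rewrite subr_gt0.
have pi0 : 0 < pi :> R by exact: pi_gt0.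
pose L : R := (2 * omega_hat w r * (r - s))^-1.
have L0 : 0 <= L by rewrite invr_ge0 !mulr_ge0 ?ltW.
exists (1 + L) => f df nf z zs.
have dr : dmean f r * omega_hat w r <= pi.
  rewrite -lee_fin; apply: le_trans (dmean_omega_hat rw df (ltW r0) r1) _.
  apply: le_trans (EI_le_D1_norm rw df) _.
  by rewrite -[leRHS]mule1; apply: lee_wpmul2l => //; rewrite lee_fin ltW.
have bd v : cmod v <= s -> cmod (cderiv f v) <= L.
  move=> vs; have := cderiv_le_dmean df (le_lt_trans vs sr) r1.
  have := cmod_ge0 (cderiv f v); set q := cmod (cderiv f v) => q0 h.
  have h1 : 2 * pi * (r - s) * q <= dmean f r.
    apply: le_trans h; apply: (ler_wpM2r q0); apply: ler_wpM2l; first by rewrite mulr_ge0 ?ltW.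
    by rewrite lerD2l lerN2.
  rewrite /L -[leRHS]mul1r ler_pdivlMr ?mulr_gt0 //.
  rewrite -(ler_pM2r pi0) mul1r; apply: le_trans dr.
  by apply: le_trans (ler_wpM2r (ltW W0) h1); rewrite le_eqVlt; apply/orP; left; apply/eqP; ring.
have z1 := le_lt_trans zs s1.
have := analytic_increment df z1 (fun t t0 t1 => bd _ (le_trans (cmod_ray z t0 t1) zs)).
have f0 : cmod (f 0) <= 1 by rewrite -lee_fin; exact: le_trans (cmod0_le_D1_norm rw df) nf.
move=> h; rewrite -(subrK (f 0) (f z)); apply: le_trans (cmodD _ _) _.
rewrite addrC lerD //; apply: le_trans h _; by rewrite -[leRHS]mulr1 ler_wpM2l // ltW.
Qed.

End DerivativeMeans.

(** * Compactness of the identity *)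

Section IdentityCompact.
Variable R : realType.
Local Notation C := (CC R).
Implicit Types (f g : C -> C) (r s e : R).

Lemma cvge0P (a : nat -> \bar R) : (forall n, 0 <= a n)%E ->
  a @ \oo --> 0%E <-> forall e, 0 < e -> \forall n \near \oo, (a n <= e%:E)%E.
Proof.
move=> a0; split=> [/fine_cvgP[fa /cvgrPdist_le ca] e e0|H].
  near=> n.
  have fn : a n \is a fin_num by near: n.
  rewrite -(fineK fn) lee_fin; have : `|0 - fine (a n)| <= e by near: n; exact: ca.
  by rewrite sub0r normrN; exact: le_trans (ler_norm _).
apply/fine_cvgP; split.
  have := H 1 ltr01; apply: filterS => n /=; have := a0 n.
  by case: (a n).
apply/cvgrPdist_le => e /H; apply: filterS => n /=; have := a0 n.
case: (a n) => [x| |] //=; rewrite !lee_fin => x0; by rewrite sub0r normrN ger0_norm.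
Unshelve. all: by end_near. Qed.

Lemma EI_dmean_head f s : analytic_disc f -> 0 <= s -> s < 1 -> (EI 0 s (dmean f) <= (dmean f s)%:E)%E.
Proof.
move=> df s0 s1; have d0 := dmean_ge0 f s0.
apply: (@le_trans _ _ (dmean f s * (s - 0))%:E).
  rewrite -(EI_cst _ s0); apply: EI_le.
  - exact: mcoS (lexx _) (ltW s1) (dmean_mco df (lexx 0)).
  - exact: mco_cst.
  - by move=> x /andP[x0 _]; exact: dmean_ge0.
  - by move=> x /andP[x0 xs]; exact: dmean_nondecreasing df _ _ x0 (ltW xs) s1.
by rewrite subr0 lee_fin -[leRHS]mulr1; apply: (ler_wpM2l d0); exact: ltW.
Qed.

Variable w : R -> R.
Hypothesis rw : radial_weight w.
Local Notation one := (@one_weight R).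
Local Notation rone := (radial_weight_one R).
Local Notation EW f := (EI 0 1 (fun r => w r * dmean f r)%R).

Lemma dmean_le f r : analytic_disc f -> (D1_norm w f <= 1)%E -> 0 <= r -> r < 1 ->
  dmean f r <= pi / omega_hat w r.
Proof.
move=> df nf r0 r1; have W0 : 0 < omega_hat w r by apply: (omega_hat_gt0 rw); rewrite r0 r1.
rewrite ler_pdivlMr // -lee_fin; apply: le_trans (dmean_omega_hat rw df r0 r1) _.
apply: le_trans (EI_le_D1_norm rw df) _.
by rewrite -[leRHS]mule1; apply: lee_wpmul2l => //; rewrite lee_fin pi_ge0.
Qed.

Lemma EW_le_pi f : analytic_disc f -> (D1_norm w f <= 1)%E -> (EW f <= pi%:E)%E.
Proof.
move=> df nf; apply: le_trans (EI_le_D1_norm rw df) _.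
by rewrite -[leRHS]mule1; apply: lee_wpmul2l => //; rewrite lee_fin pi_ge0.
Qed.

Lemma EW_sub f g : analytic_disc f -> analytic_disc g ->
  (EW (fun z => f z - g z) <= EW f + EW g)%E.
Proof.
move=> df dg; have mw := weight_mco rw (lexx 0) (lexx 1).
have dfg := analyticB df dg.
have p h x : 0 <= x < 1 -> 0 <= w x * dmean h x.
  by move=> /andP[x0 x1]; apply: mulr_ge0; [apply: (weight_ge0 rw); rewrite x0|exact: dmean_ge0].
have m h : analytic_disc h -> mco 0 1 (fun x => w x * dmean h x).
  by move=> dh; exact: mcoM mw (dmean_mco dh (lexx 0)).
rewrite -(EID (m _ df) (m _ dg) (p f) (p g)); apply: EI_le.
- exact: m.
- exact: mcoD (m _ df) (m _ dg).
- exact: p.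
- move=> x /andP[x0 x1]; rewrite -mulrDr; apply: ler_wpM2l; last exact: dmeanB.
  by apply: (weight_ge0 rw); rewrite x0.
Qed.

Hypothesis small : forall e, 0 < e -> exists s, [/\ 0 <= s, s < 1 &
  forall r, s <= r -> r < 1 -> 1 - r <= e * omega_hat w r].

(** The unweighted integral is cut at [s]. The head is at most a single mean, which tends to 0 along
    convergent sequences; the tail is a small multiple of the weighted integral by
    [tail_le_weighted]. *)
Lemma D1_one_le e : 0 < e -> exists s, [/\ 0 <= s, s < 1 & forall f, analytic_disc f ->
  (D1_norm one f <= ((dmean f s)%:E + e%:E * EW f) * (pi^-1)%:E + (cmod (f 0))%:E)%E].
Proof.
move=> e0; have [|s [s0 s1 Hs]] := small (e := e / 2); first by rewrite divr_gt0.
exists s; split=> // f df; rewrite (D1_normE rone df) leeD2r //.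
apply: lee_wpmul2r; first by rewrite lee_fin invr_ge0 pi_ge0.
have -> : EI 0 1 (fun r => one r * dmean f r) = EI 0 1 (dmean f).
  by apply: eq_EI => x _; rewrite mul1r.
rewrite (EI_split s0 (ltW s1) (dmean_mco df (lexx 0))); last first.
  by move=> x /andP[x0 _]; exact: dmean_ge0.
apply: leeD; first exact: EI_dmean_head.
apply: le_trans (tail_le_weighted rw s0 s1 _ Hs (dmean_nondecreasing df) _) _.
- by rewrite divr_ge0 // ltW.
- by move=> r r0 _; exact: dmean_ge0.
rewrite mulrC divfK //; apply: lee_wpmul2l; first by rewrite lee_fin ltW.
apply: EI_sub => //.
- exact: mcoM (weight_mco rw (lexx 0) (lexx 1)) (dmean_mco df (lexx 0)).
- by move=> x /andP[x0 x1]; apply: mulr_ge0; [apply: (weight_ge0 rw); rewrite x0|exact: dmean_ge0].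
Qed.

Lemma D1_embedding f : analytic_disc f -> (EW f < +oo)%E -> in_D1 one f.
Proof.
move=> df Ef; split=> //; have [s [s0 s1 Hs]] := D1_one_le ltr01.
apply: le_lt_trans (Hs f df) _.
have E0 : (0 <= EW f)%E by exact: EI_weight_dmean_ge0.
by move: Ef E0; case: (EW f) => [x| |] // _ _; rewrite ltry.
Qed.

(** Bounded convergence on the circle of radius [s]: the bound for the means at the larger radius
    [r] dominates the derivatives pointwise there. *)
Lemma dmean_cvg0 (d : nat -> C -> C) s r (K : R) : (forall n, analytic_disc (d n)) ->
  0 <= s -> s < r -> r < 1 -> (forall n, dmean (d n) r <= K) ->
  (forall z, cmod z < 1 -> (fun n => cderiv (d n) z) @ \oo --> (0 : C)) ->
  (fun n => dmean (d n) s) @ \oo --> (0 : R).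
Proof.
move=> dd s0 sr r1 HK d0; have s1 := lt_trans sr r1.
have rs0 : 0 < r - s by rewrite subr_gt0.
have c n : onc (fun u => rc (cmod (cderiv (d n) (rc s * u))) : C).
  by apply: onc_rc; exact: onc_dmean.
have su u : cmod u = 1 -> cmod (rc s * u) = s.
  by move=> u1; rewrite cmodM cmod_rc u1 mulr1 ger0_norm.
have := @circ_dct R (K / (2 * pi * (r - s))) (fun n u => rc (cmod (cderiv (d n) (rc s * u)))) (fun=> 0) c
  (@onc_cst R C 0).
have -> : circ (fun=> 0) = 0 :> C by rewrite circ_cst mul0r.
move=> h; have {}h : (fun n => circ (fun u => rc (cmod (cderiv (d n) (rc s * u))))) @ \oo --> (0 : C).
  apply: h => [u u1|n u u1].
    have u1' : cmod (rc s * u) < 1 by rewrite su.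
    have := cvg_rc (cvg_cmod (d0 _ u1')); rewrite cmod0 rc0; exact.
  rewrite cmod_rc ger0_norm ?cmod_ge0 //.
  rewrite ler_pdivlMr; last by rewrite !mulr_gt0 ?pi_gt0.
  rewrite mulrC; apply: le_trans (HK n).
  have := @cderiv_le_dmean R (d n) (rc s * u) r (dd n); rewrite su //; exact.
have E : (fun n => dmean (d n) s) = (fun n => s * cre (circ (fun u => rc (cmod (cderiv (d n) (rc s * u)))))).
  by apply/funext => n; rewrite (circ_rc (onc_dmean (dd n) s0 s1)).
have h' : (fun n => cre (circ (fun u => rc (cmod (cderiv (d n) (rc s * u)))))) @ \oo --> (0 : R).
  exact: (cvg_cre h).
rewrite E; have := cvgM (cvg_cst s) h'; rewrite mulr0; exact.
Qed.

(** Montel's theorem supplies the limit [g]. In [D1_one_le] for the differences [d n] the head tends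
    to 0, while the tail is small only if the weighted integrals of [d n] stay bounded; so [EW g]
    must be bounded, which pointwise convergence does not give by itself. *)
Lemma identity_compact :
  compact_operator (in_D1 w) (D1_norm w) (in_D1 one) (D1_norm one) (fun f => f).
Proof.
have pi0 : 0 < pi :> R by exact: pi_gt0.
split=> [f [df nf]|u Hu].
  apply: D1_embedding => //; apply: le_lt_trans (EI_le_D1_norm rw df) _.
  have D0 : (0 <= D1_norm w f)%E.
    by apply: le_trans (cmod0_le_D1_norm rw df); rewrite lee_fin cmod_ge0.
  by move: nf D0; case: (D1_norm w f) => [x| |] // _ _; rewrite -EFinM ltry.
have du n : analytic_disc (u n) by case: (Hu n) => -[].
have nu n : (D1_norm w (u n) <= 1)%E by case: (Hu n).
have lb : locally_bounded u.
  move=> s s1; have [K HK] := D1_locally_bounded rw s1.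
  by exists K => n z; exact: (HK _ (du n) (nu n)).
have [phi phiS [g [dg vg dvg]]] := montel du lb.
exists phi; split=> //; exists g.
pose d n z := u (phi n) z - g z.
have dd n : analytic_disc (d n) by exact: analyticB.
have d0 s : 0 <= s -> s < 1 -> (fun n => dmean (d n) s) @ \oo --> (0 : R).
  move=> s0 s1; have [r0 sr r1] := midpoint_lt1 s0 s1.
  apply: (dmean_cvg0 (K := pi / omega_hat w ((1 + s) / 2) + dmean g ((1 + s) / 2)) dd s0 sr r1).
    move=> n; apply: le_trans (dmeanB (du _) dg (ltW r0) r1) _; rewrite lerD2r.
    exact: dmean_le (du _) (nu _) (ltW r0) r1.
  move=> z z1.
  have E : (fun n => cderiv (d n) z) = (fun n => cderiv (u (phi n)) z - cderiv g z).
    by apply/funext => n; exact: cderivB (du _) dg z1.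
  rewrite E; exact: (ccvg_eq (ccvgB (dvg z z1) ccvg_cst) (subrr _)).
have mw := weight_mco rw (lexx 0) (lexx 1).
(* On [0, b] the means of [g] exceed those of [v n] by at most [dmean (d n) b], which tends to 0. *)
have Eg : (EW g <= pi%:E)%E.
  have y1 n : dyadic 0 n < 1 :> R by exact: dyadic_lt1.
  have y0 n : 0 <= dyadic 0 n :> R by exact: dyadic_ge.
  have mwg := mcoM mw (dmean_mco dg (lexx 0)).
  have p h x : 0 <= x < 1 -> 0 <= w x * dmean h x.
    by move=> /andP[x0 x1]; apply: mulr_ge0; [apply: (weight_ge0 rw); rewrite x0|exact: dmean_ge0].
  apply: (EI_sup (s := dyadic 0)) => //.
  - exact: dyadic_homo.
  - by move=> x; exact: dyadic_sup.
  - exact: p g.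
  move=> n; apply/lee_addgt0Pr => e e0.
  have W0 : 0 < omega_hat w 0 by apply: (omega_hat_gt0 rw); rewrite lexx ltr01.
  have e1 : 0 < e / omega_hat w 0 by rewrite divr_gt0.
  have /cvgrPdist_le /(_ _ e1) [m _ /(_ m (leqnn m))] := d0 _ (y0 n) (y1 n).
  have dm0 := dmean_ge0 (d m) (y0 n).
  rewrite sub0r normrN ger0_norm // ler_pdivlMr // => hm.
  have lt1 (x : R) : 0 <= x < dyadic 0 n -> 0 <= x < 1 by case/andP=> -> h; rewrite (lt_trans h (y1 n)).
  have m1 : mco 0 (dyadic 0 n) (fun x => w x * dmean (u (phi m)) x).
    exact: mcoS (lexx 0) (ltW (y1 n)) (mcoM mw (dmean_mco (du _) (lexx 0))).
  have m2 : mco 0 (dyadic 0 n) (fun x => dmean (d m) (dyadic 0 n) * w x).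
    by apply: mcoM; [exact: mco_cst|exact: mcoS (lexx 0) (ltW (y1 n)) mw].
  apply: (@le_trans _ _ (EI 0 (dyadic 0 n) (fun x => w x * dmean (u (phi m)) x + dmean (d m) (dyadic 0 n) * w x))).
    apply: EI_le.
    + exact: mcoS (lexx 0) (ltW (y1 n)) mwg.
    + exact: mcoD.
    + by move=> x /lt1; exact: p.
    move=> x hx; have x1 := lt1 x hx; case/andP: hx => x0 xn; case/andP: (x1) => _ x1'.
    rewrite [dmean (d m) _ * _]mulrC -mulrDr; apply: ler_wpM2l; first exact: (weight_ge0 rw).
    have -> : dmean g x = dmean (fun z => u (phi m) z - d m z) x.
      by congr (dmean _ x); apply/funext => z; rewrite /d opprB addrC subrK.
    apply: le_trans (dmeanB (du _) (dd m) x0 x1') _; rewrite lerD2l.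
    exact: dmean_nondecreasing (dd m) _ _ x0 (ltW xn) (y1 n).
  rewrite (EID m1 m2); last 2 first.
  - by move=> x /lt1; exact: p.
  - by move=> x /lt1 h; apply: mulr_ge0 dm0 _; exact: (weight_ge0 rw).
  apply: leeD.
    apply: le_trans (EW_le_pi (du (phi m)) (nu (phi m))).
    apply: (EI_sub (lexx 0) (ltW (y1 n)) (mcoM mw (dmean_mco (du _) (lexx 0)))); exact: p.
  rewrite (EIZ dm0 (mcoS (lexx 0) (ltW (y1 n)) mw)); last by move=> x /lt1; exact: (weight_ge0 rw).
  apply: (@le_trans _ _ ((dmean (d m) (dyadic 0 n))%:E * EI 0 1 w)%E).
    apply: lee_wpmul2l; first by rewrite lee_fin.
    exact: (EI_sub (lexx 0) (ltW (y1 n)) mw (weight_ge0 rw)).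
  by rewrite (omega_hatE rw (lexx 0)) -EFinM lee_fin.
split; first by apply: D1_embedding => //; apply: le_lt_trans Eg _; rewrite ltry.
apply/cvge0P => [n|e e0].
  by apply: le_trans (cmod0_le_D1_norm rone (dd n)); rewrite lee_fin cmod_ge0.
(* One quarter of [e] goes to the head, two to the tail because [EW (d n) <= 2 * pi], and one to the
   value at 0. *)
have e4 : 0 < e / 4 by rewrite divr_gt0.
have [s [s0 s1 Hs]] := D1_one_le e4.
have c0 : (fun n => cmod (d n 0)) @ \oo --> (0 : R).
  have z1 : cmod (0 : C) < 1 by rewrite cmod0.
  have h : (fun n => d n 0) @ \oo --> (0 : C).
    exact: (ccvg_eq (ccvgB (vg 0 z1) ccvg_cst) (subrr _)).
  by rewrite -(@cmod0 R); exact: (cvg_cmod h).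
have ep : 0 < e / 4 * pi by rewrite mulr_gt0.
have /cvgrPdist_le /(_ _ ep) n1 := d0 s s0 s1.
have /cvgrPdist_le /(_ _ e4) n2 := c0.
near=> n.
apply: le_trans (Hs _ (dd n)) _.
have h1 : dmean (d n) s <= e / 4 * pi.
  have : `|0 - dmean (d n) s| <= e / 4 * pi by near: n.
  by rewrite sub0r normrN; exact: le_trans (ler_norm _).
have h2 : cmod (d n 0) <= e / 4.
  have : `|0 - cmod (d n 0)| <= e / 4 by near: n.
  by rewrite sub0r normrN; exact: le_trans (ler_norm _).
have h3 : (EW (d n) <= (2 * pi)%:E)%E.
  apply: le_trans (EW_sub (du _) dg) _; rewrite mulrDl mul1r EFinD.
  exact: leeD (EW_le_pi (du _) (nu _)) Eg.
apply: (@le_trans _ _ (((e / 4 * pi)%:E + (e / 4)%:E * (2 * pi)%:E) * (pi^-1)%:E + (e / 4)%:E)%E).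
  apply: leeD; last by rewrite lee_fin.
  apply: lee_wpmul2r; first by rewrite lee_fin invr_ge0 ltW.
  apply: leeD; first by rewrite lee_fin.
  by apply: lee_wpmul2l => //; rewrite lee_fin ltW.
have -> : (((e / 4 * pi)%:E + (e / 4)%:E * (2 * pi)%:E) * (pi^-1)%:E + (e / 4)%:E =
    ((e / 4 * pi + e / 4 * (2 * pi)) * pi^-1 + e / 4)%:E)%E by [].
have key (p : R) : 0 < p -> (e / 4 * p + e / 4 * (2 * p)) * p^-1 + e / 4 = e.
  by move=> p0; field; rewrite gt_eqF.
by rewrite (key _ pi0).
Unshelve. all: by end_near. Qed.

End IdentityCompact.

(** * The integral operator with symbol [z] *)

Section BoundedPrimitive.
Variable R : realType.
Local Notation C := (CC R).
Implicit Types (f g h : C -> C) (z : C) (r s e t : R).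

(** For [t < x n.+1] the midpoint [(1 + t) / 2] is at most [x n.+2], so [h <= N (x n.+2)] on [[x n,
    x n.+1[]. On [[x n.+2, x n.+3[] the function [N] is at least this value; that interval is four
    times shorter, whence the constant 4 and the shift by two. *)
Lemma EI_midpoint_le (h N : R -> R) : mco 0 1 h -> (forall t, 0 <= t < 1 -> 0 <= h t) ->
  nondecreasing01 N -> (forall t, 0 <= t -> 0 <= N t) ->
  (forall t, 0 <= t -> t < 1 -> h t <= N ((1 + t) / 2)) ->
  (EI 0 1 h <= 4%:E * EI 0 1 N)%E.
Proof.
move=> mh h0 nN N0 hN; pose x n : R := dyadic 0 n.
have x1 n : x n < 1 by exact: dyadic_lt1.
have x0 n : 0 <= x n by exact: dyadic_ge.
have xS n : x n <= x n.+1 by exact: ltW (dyadic_ltS _ ltr01).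
have mN : mco 0 1 N by exact: nondecreasing01_mco.
have N0' a b t : 0 <= a -> a <= t < b -> 0 <= N t.
  by move=> a0 /andP[at' _]; exact: N0 (le_trans a0 at').
have h0' a b t : 0 <= a -> b <= 1 -> a <= t < b -> 0 <= h t.
  by move=> a0 b1 /andP[at' tb]; apply: h0; rewrite (le_trans a0 at') (lt_le_trans tb b1).
have step n : (EI 0 (x n) h <= 4%:E * EI 0 (x n.+2) N)%E.
  elim: n => [|n IH].
    rewrite {1}/x dyadic0 {1}/EI set_itvco0 integral_set0 mule_ge0 //.
    by apply: EI_ge0 => t; exact: N0'.
  have b1 := ltW (x1 n.+1); have c1 := ltW (x1 n.+3).
  rewrite (EI_split (x0 n) (xS n) (mcoS (lexx 0) b1 mh) (fun t => h0' _ _ t (lexx 0) b1)).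
  rewrite (EI_split (x0 n.+2) (xS n.+2) (mcoS (lexx 0) c1 mN) (fun t => N0' _ _ t (lexx 0))).
  have p1 : (0 <= EI 0 (x n.+2) N)%E by apply: EI_ge0 => t; exact: N0'.
  have p2 : (0 <= EI (x n.+2) (x n.+3) N)%E by apply: EI_ge0 => t; exact: N0'.
  rewrite (ge0_muleDr _ p1 p2); apply: leeD IH _.
  have d1 : 1 - x n.+1 = (1 - x n) / 2 by exact: dyadicS.
  have d2 : 1 - x n.+2 = (1 - x n.+1) / 2 by exact: dyadicS.
  have d3 : 1 - x n.+3 = (1 - x n.+2) / 2 by exact: dyadicS.
  apply: (@le_trans _ _ (N (x n.+2) * (x n.+1 - x n))%:E).
    rewrite -(EI_cst _ (xS n)); apply: EI_le.
    - exact: mcoS (x0 n) b1 mh.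
    - exact: mco_cst.
    - by move=> t; exact: h0' (x0 n) b1.
    - move=> t /andP[xt tx]; have t0 := le_trans (x0 n) xt.
      have t1 : t < 1 by exact: lt_le_trans tx b1.
      apply: le_trans (hN t t0 t1) _; apply: nN => //; first by lra.
      by lra.
  have -> : N (x n.+2) * (x n.+1 - x n) = 4 * (N (x n.+2) * (x n.+3 - x n.+2)).
    by rewrite (_ : x n.+1 - x n = 4 * (x n.+3 - x n.+2)); [ring|lra].
  rewrite EFinM; apply: lee_wpmul2l; first by rewrite lee_fin.
  rewrite -(EI_cst _ (xS n.+2)); apply: EI_le.
  - exact: mco_cst.
  - exact: mcoS (x0 n.+2) c1 mN.
  - by move=> t _; exact: N0.
  - by move=> t /andP[xt tx]; apply: nN => //; exact: lt_le_trans tx c1.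
apply: (EI_sup (s := x)) => //.
- exact: dyadic_homo.
- by move=> y; exact: dyadic_sup.
move=> n; apply: le_trans (step n) _; apply: lee_wpmul2l; first by rewrite lee_fin.
by apply: EI_sub => //; [exact: ltW|move=> t; exact: N0'].
Qed.

Lemma RI_EI (f : R -> R) : con 0 1 f -> EI 0 1 f = (RI 0 1 f)%:E.
Proof.
move=> cf; rewrite -(integral_RI cf) /EI; apply: integral_itv_bndo_bndc.
apply: measurable_funS (measurable_int _ (con_integrable cf)); first exact: measurable_itv.
by move=> x; rewrite /= !in_itv /= => /andP[-> /ltW].
Qed.

Lemma TgB g f h z : analytic_disc g -> analytic_disc f -> analytic_disc h -> cmod z < 1 ->
  Tg g (fun w => f w - h w) z = Tg g f z - Tg g h z.
Proof.
move=> dg df dh z1; rewrite !TgE /primitive -mulrBr; congr (_ * _).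
have c1 := @con_ray R _ z (analyticM df (analytic_cderiv dg)) z1.
have c2 := @con_ray R _ z (analyticM dh (analytic_cderiv dg)) z1.
rewrite -(CIB c1 c2); apply: eq_CI => t _; exact: mulrBl.
Qed.

Lemma Hinf_norm_le f (K : \bar R) : (forall z, cmod z < 1 -> ((cmod (f z))%:E <= K)%E) ->
  (Hinf_norm f <= K)%E.
Proof. by move=> H; apply: ge_ereal_sup => _ [z z1 <-]; exact: H. Qed.

Lemma Hinf_norm_ge f z : cmod z < 1 -> ((cmod (f z))%:E <= Hinf_norm f)%E.
Proof. by move=> z1; apply: ereal_sup_ubound; exists z. Qed.

Lemma Hinf_norm_ge0 f : (0 <= Hinf_norm f)%E.
Proof.
have z1 : cmod (0 : C) < 1 by rewrite cmod0.
by apply: le_trans (Hinf_norm_ge f z1); rewrite lee_fin cmod_ge0.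
Qed.

Local Notation one := (@one_weight R).
Local Notation rone := (radial_weight_one R).
Local Notation cid := (fun z : C => z).

Lemma Tg_id_le f z : analytic_disc f -> cmod z < 1 ->
  ((cmod (Tg cid f z))%:E <= 4%:E * D1_norm one f)%E.
Proof.
move=> df z1; have pi0 : 0 < pi :> R by exact: pi_gt0.
have dcd v : cderiv cid v = 1 by exact: cder_cderiv (cder_id v).
have Tle : cmod (Tg cid f z) <= cmod (CI 0 1 (fun t => f (rc t * z))).
  rewrite TgE /primitive (_ : CI 0 1 _ = CI 0 1 (fun t => f (rc t * z))).
    by rewrite cmodM ler_piMl ?cmod_ge0 // ltW.
  by apply: eq_CI => t _; rewrite dcd mulr1.
have cd : con 0 1 (fun t => cderiv f (rc t * z)) by exact: con_ray (analytic_cderiv df) z1.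
have c1 : con 0 1 (fun t => rc (1 - t) : C).
  by move=> t _; apply: at_rc; apply: cvgB; [exact: cvg_cst|exact: cvg_id].
have c2 : con 0 1 (fun t => rc (1 - t) * cderiv f (rc t * z)) by exact: (conM c1 cd).
pose h t := cmod (rc (1 - t) * cderiv f (rc t * z)).
have ch : con 0 1 h by exact: con_cmod c2.
have h0 t : 0 <= h t by exact: cmod_ge0.
have I1 : cmod (CI 0 1 (fun t => f (rc t * z))) <= cmod (f 0) + RI 0 1 h.
  rewrite (ray_by_parts df z1); apply: le_trans (cmodD _ _) _; rewrite lerD2l cmodM.
  apply: le_trans (CI_norm c2); rewrite ler_piMl ?cmod_ge0 //; exact: ltW.
have cph : con 0 1 (fun t => pi * h t) by exact: con_rZ ch.
have I2 : (EI 0 1 (fun t => pi * h t)%R <= 4%:E * EI 0 1 (dmean f))%E.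
  apply: EI_midpoint_le.
  - apply/measurable_EFinP; apply: measurable_funS (measurable_int _ (con_integrable cph)); first exact: measurable_itv.
    by move=> x; rewrite /= !in_itv /= => /andP[-> /ltW].
  - by move=> t _; exact: mulr_ge0 (ltW pi0) (h0 t).
  - exact: dmean_nondecreasing.
  - by move=> t; exact: dmean_ge0.
  move=> t t0 t1; have [r0 tr r1] := midpoint_lt1 t0 t1; set r := (1 + t) / 2 in r0 tr r1 *.
  have zt : cmod (rc t * z) <= t.
    by rewrite cmodM cmod_rc ger0_norm // ler_piMr // ltW.
  have := cderiv_le_dmean df (le_lt_trans zt tr) r1.
  apply: le_trans; rewrite /h cmodM cmod_rc ger0_norm ?subr_ge0 ?(ltW t1) // mulrA.
  apply: ler_wpM2r; first exact: cmod_ge0.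
  rewrite [2 * pi]mulrC -mulrA; apply: ler_wpM2l; first exact: ltW.
  by rewrite /r; lra.
have E1 : EI 0 1 (fun r => one r * dmean f r) = EI 0 1 (dmean f).
  by apply: eq_EI => x _; rewrite mul1r.
rewrite (D1_normE rone df) E1.
have p : (0 <= EI 0 1 (dmean f))%E by apply: EI_ge0 => x /andP[x0 _]; exact: dmean_ge0.
have p1 : (0 <= (pi^-1)%:E :> \bar R)%E by rewrite lee_fin invr_ge0 ltW.
apply: (@le_trans _ _ (cmod (f 0) + RI 0 1 h)%:E); first by rewrite lee_fin; exact: le_trans Tle I1.
rewrite ge0_muleDr; last 2 first.
- exact: mule_ge0.
- by rewrite lee_fin cmod_ge0.
rewrite EFinD addeC; apply: leeD; last by rewrite -EFinM lee_fin ler_peMl ?cmod_ge0 // ler1n.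
rewrite muleA; apply: (@le_trans _ _ (EI 0 1 (fun t => pi * h t)%R * (pi^-1)%:E)%E); last exact: lee_wpmul2r.
by rewrite (RI_EI cph) (RIZ _ ch) -EFinM lee_fin mulrC mulKf // gt_eqF.
Qed.

Lemma Tg_id_compact (w : R -> R) :
  compact_operator (in_D1 w) (D1_norm w) (in_D1 one) (D1_norm one) (fun f => f) ->
  compact_operator (in_D1 w) (D1_norm w) (@in_Hinf R) (@Hinf_norm R) (Tg cid).
Proof.
have did := @analytic_id R.
have inH f : in_D1 one f -> in_Hinf (Tg cid f).
  case=> df nf; split; first exact: analytic_Tg.
  apply: (@le_lt_trans _ _ (4%:E * D1_norm one f)%E); first by apply: Hinf_norm_le => z; exact: Tg_id_le.
  have : (0 <= D1_norm one f)%E.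
    by apply: le_trans (cmod0_le_D1_norm rone df); rewrite lee_fin cmod_ge0.
  by move: nf; case: (D1_norm one f) => [x| |] // _ _; rewrite -EFinM ltry.
case=> Hb Hc; split=> [f fw|u Hu]; first exact: inH (Hb _ fw).
have [phi [phiS [h [hh hc]]]] := Hc u Hu.
exists phi; split=> //; exists (Tg cid h); split; first exact: inH.
have dh : analytic_disc h by case: hh.
have du n : analytic_disc (u n) by case: (Hu n) => -[].
apply/cvge0P => [n|e e0]; first exact: Hinf_norm_ge0.
have e4 : 0 < e / 4 by rewrite divr_gt0.
pose d n (z : C) : C := u (phi n) z - h z.
have D0 n : (0 <= D1_norm one (d n))%E.
  by apply: le_trans (cmod0_le_D1_norm rone (analyticB (du _) dh)); rewrite lee_fin cmod_ge0.
have := iffLR (cvge0P D0) hc _ e4.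
apply: filterS => n hn; apply: Hinf_norm_le => z z1; rewrite -(TgB did (du _) dh z1).
apply: le_trans (Tg_id_le (analyticB (du _) dh) z1) _.
apply: (@le_trans _ _ (4%:E * (e / 4)%:E)%E); first by apply: lee_wpmul2l => //; rewrite lee_fin.
by rewrite -EFinM mulrC divfK.
Qed.

End BoundedPrimitive.

(** * Powers of the kernel against a doubling weight *)

Section KernelIntegral.
Variable R : realType.
Implicit Types (r s e d c : R).

(** For [d = 1 - |a|] this is comparable with [(1 - |a|) / (1 - |a| s)], but [d] and [1 - s] are
    separated in the denominator. *)
Definition kern d s : R := d / (d + 1 - s).

Lemma kern_den_gt0 d s : 0 < d -> s < 1 -> 0 < d + 1 - s.
Proof. by move=> d0 s1; rewrite -addrA addr_gt0 // subr_gt0. Qed.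

Lemma kern_ge0 d s : 0 < d -> s < 1 -> 0 <= kern d s.
Proof. by move=> d0 s1; rewrite divr_ge0 ?(ltW d0) // ltW // kern_den_gt0. Qed.

Lemma kern_le1 d s : 0 < d -> s < 1 -> kern d s <= 1.
Proof.
by move=> d0 s1; rewrite ler_pdivrMr ?kern_den_gt0 // mul1r -addrA lerDl subr_ge0 ltW.
Qed.

Lemma kern_nondecreasing d n : 0 < d -> nondecreasing01 (fun s => kern d s ^+ n).
Proof.
move=> d0 r s _ rs s1; have r1 := le_lt_trans rs s1.
rewrite lerXn2r ?nnegrE ?kern_ge0 // /kern ler_wpM2l ?(ltW d0) //.
by rewrite lef_pV2 ?posrE ?kern_den_gt0 // lerD2l lerN2.
Qed.

(** With [x = 1 - s], the ratio of the two kernels is [(2 d + x) / (2 (d + x))]. It decreases in [x]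
    and equals [3 / 4] at [x = d]. *)
Lemma kern_double d s : 0 < d -> s <= 1 - d -> s < 1 -> kern d s <= 3 / 4 * kern (2 * d) s.
Proof.
move=> d0 sd s1; have h1 := kern_den_gt0 d0 s1.
have h2 : 0 < 2 * d + 1 - s by apply: kern_den_gt0 s1; rewrite mulr_gt0.
rewrite /kern mulrA ler_pdivrMr // mulrAC ler_pdivlMr //.
have -> : 3 / 4 * (2 * d) * (d + 1 - s) = d * (3 / 2 * (d + 1 - s)) by field.
by apply: ler_wpM2l; [exact: ltW|lra].
Qed.

Lemma geometric_small (q e : R) : 0 <= q -> q < 1 -> 0 < e -> exists n, q ^+ n <= e.
Proof.
move=> q0 q1 e0; have := @cvg_geometric R 1 q.
rewrite ger0_norm // => /(_ q1) /cvgrPdist_le /(_ _ e0) [n _ /(_ n (leqnn n))].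
by rewrite sub0r normrN /geometric /= mul1r ger0_norm ?exprn_ge0 //; exists n.
Qed.

Variable w : R -> R.
Hypothesis rw : radial_weight w.
Local Notation W := (omega_hat w).

Lemma kern_weight_mco d n : 0 < d -> mco 0 1 (fun s => kern d s ^+ n * w s).
Proof.
move=> d0; apply: mcoM; last exact: weight_mco.
exact: nondecreasing01_mco (kern_nondecreasing n d0).
Qed.

Lemma kern_weight_ge0 d n s : 0 < d -> 0 <= s < 1 -> 0 <= kern d s ^+ n * w s.
Proof.
move=> d0 s01; apply: mulr_ge0; last exact: (weight_ge0 rw).
by apply: exprn_ge0; apply: kern_ge0 => //; case/andP: s01.
Qed.

(* Halving [d] multiplies the kernel by at most [3/4] below [1 - 2 d], which beats the doubling constant
   once the exponent is large. *)
Lemma kern_integral_le : Dhat w -> exists n A, 0 < A /\ forall d, 0 < d -> d <= 1 ->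
  (EI 0 1 (fun s => kern d s ^+ n * w s)%R <= (A * W (1 - d))%:E)%E.
Proof.
move=> [c [c1 Hc]]; have c0 : 0 < c by exact: lt_le_trans ltr01 c1.
(* This exponent closes the induction with the constant [2 * c]: below [1 - d] the integral is at
   most [W (1 - 2 * d) <= c * W (1 - d)], and above it at most [W (1 - d) <= c * W (1 - d)]. *)
have [n Hn] : exists n, (3 / 4 : R) ^+ n <= (2 * c)^-1.
  by apply: geometric_small; rewrite ?invr_gt0 ?mulr_gt0 //; lra.
exists n, (2 * c); split; first by rewrite mulr_gt0.
(* The induction on [j] passes from [d] to [2 * d] until [d > 1 / 2], where one use of doubling
   between 0 and [1 / 2] is enough. *)
suff H : forall j d, 2^-1 ^+ j.+1 < d -> d <= 1 -> (EI 0 1 (fun s => kern d s ^+ n * w s)%R <= (2 * c * W (1 - d))%:E)%E.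
  move=> d d0 d1; have d2 : 0 < d / 2 by rewrite divr_gt0.
  have [j Hj] := geometric_small (q := 2^-1) ltac:(lra) ltac:(lra) d2.
  by apply: (H j) => //; rewrite exprS; lra.
have Wd d : 0 < d -> d <= 1 -> 0 < W (1 - d).
  by move=> d0 d1; apply: (omega_hat_gt0 rw); rewrite subr_ge0 d1 ltrBlDr ltrDl.
have le_w d a b : 0 < d -> 0 <= a -> b <= 1 -> (EI a b (fun s => kern d s ^+ n * w s)%R <= EI a b w)%E.
  move=> d0 a0 b1; have s01 s : a <= s < b -> 0 <= s < 1.
    by case/andP=> h1 h2; rewrite (le_trans a0 h1) (lt_le_trans h2 b1).
  apply: EI_le.
  - exact: mcoS a0 b1 (kern_weight_mco n d0).
  - exact: weight_mco.
  - by move=> s /s01; exact: kern_weight_ge0.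
  - move=> s /s01 h; case/andP: (h) => _ s1; rewrite ler_piMl ?(weight_ge0 rw) //.
    by apply: exprn_ile1; [exact: kern_ge0|exact: kern_le1].
have base d : 2^-1 < d -> d <= 1 -> (EI 0 1 (fun s => kern d s ^+ n * w s)%R <= (2 * c * W (1 - d))%:E)%E.
  move=> d2 d1; have d0 : 0 < d by lra.
  apply: le_trans (le_w d 0 1 d0 (lexx 0) (lexx 1)) _.
  rewrite (omega_hatE rw (lexx 0)) lee_fin.
  have z01 : 0 <= (0 : R) < 1 by rewrite lexx ltr01.
  have h1 := Hc 0 z01.
  have h2 : W ((1 + 0) / 2) <= W (1 - d) by apply: (omega_hat_nonincreasing rw); lra.
  have h3 := Wd d d0 d1.
  apply: le_trans h1 _; apply: (@le_trans _ _ (c * W (1 - d))); first by rewrite ler_pM2l.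
  by rewrite -mulrA ler_peMl ?mulr_ge0 ?(ltW c0) ?(ltW h3) //; lra.
elim=> [|j IH] d; first by rewrite expr1; exact: base.
move=> dj d1; have [|d2] := ltP 2^-1 d; first by move=> h; exact: base.
have d0 : 0 < d by apply: le_lt_trans dj; rewrite exprn_ge0 // invr_ge0.
have dd0 : 0 < 2 * d by rewrite mulr_gt0.
have {}IH := IH (2 * d) ltac:(by move: dj; rewrite exprS; lra) ltac:(lra).
have s0 : 0 <= 1 - d by lra.
have s1 : 1 - d <= 1 by lra.
rewrite (EI_split s0 s1 (kern_weight_mco n d0) (fun s => kern_weight_ge0 n d0)).
have h2 : (EI (1 - d) 1 (fun s => kern d s ^+ n * w s)%R <= (W (1 - d))%:E)%E.
  by rewrite -(omega_hatE rw s0); exact: le_w.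
have q0 : 0 <= (3 / 4 : R) ^+ n by apply: exprn_ge0; lra.
have h1 : (EI 0 (1 - d) (fun s => kern d s ^+ n * w s)%R <=
    ((3 / 4) ^+ n)%:E * EI 0 1 (fun s => kern (2 * d) s ^+ n * w s)%R)%E.
  rewrite -(EIZ q0 (kern_weight_mco n dd0) (fun s => kern_weight_ge0 n dd0)).
  apply: (@le_trans _ _ (EI 0 (1 - d) (fun s => (3 / 4) ^+ n * (kern (2 * d) s ^+ n * w s)))).
    have m3 : mco 0 1 (fun s => (3 / 4) ^+ n * (kern (2 * d) s ^+ n * w s)).
      by apply: mcoM; [exact: mco_cst|exact: kern_weight_mco].
    apply: EI_le.
    - exact: mcoS (lexx 0) s1 (kern_weight_mco n d0).
    - exact: mcoS (lexx 0) s1 m3.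
    - by move=> s /andP[h h']; apply: kern_weight_ge0 => //; rewrite h (lt_le_trans h' s1).
    - move=> s /andP[h h']; have s1' := lt_le_trans h' s1.
      rewrite mulrA -exprMn; apply: ler_wpM2r; first by apply: (weight_ge0 rw); rewrite h.
      rewrite lerXn2r ?nnegrE ?kern_ge0 //; last by apply: kern_double => //; exact: ltW.
      by rewrite mulr_ge0 ?kern_ge0 //; lra.
  apply: EI_sub => //.
    by apply: mcoM; [exact: mco_cst|exact: kern_weight_mco].
  by move=> s h; apply: mulr_ge0 q0 _; exact: kern_weight_ge0.
have W2 : W (1 - 2 * d) <= c * W (1 - d).
  have := Hc (1 - 2 * d); have -> : (1 + (1 - 2 * d)) / 2 = 1 - d by lra.
  apply; lra.
apply: le_trans (leeD h1 h2) _.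
apply: (@le_trans _ _ (((3 / 4) ^+ n)%:E * (2 * c * W (1 - 2 * d))%:E + (W (1 - d))%:E)%E).
  by apply: leeD => //; apply: lee_wpmul2l; rewrite // lee_fin.
rewrite -EFinM -EFinD lee_fin; have W0 := Wd d d0 d1.
have h3 : (3 / 4) ^+ n * (2 * c * W (1 - 2 * d)) <= W (1 - 2 * d).
  have := Wd (2 * d) dd0 ltac:(lra); move: Hn; rewrite -(ler_pM2r (x := 2 * c)) ?mulr_gt0 //.
  rewrite mulVf ?gt_eqF ?mulr_gt0 // => h h'.
  by rewrite mulrA -[leRHS]mul1r; apply: ler_wpM2r h; exact: ltW.
have h4 : W (1 - d) <= c * W (1 - d) by rewrite ler_peMl // ltW.
have -> : 2 * c * W (1 - d) = c * W (1 - d) + c * W (1 - d) by ring.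
by apply: lerD h4; exact: le_trans h3 W2.
Qed.

End KernelIntegral.

(** * Test functions concentrated near a boundary point *)

Section TestFunctions.
Variable R : realType.
Local Notation C := (CC R).
Implicit Types (f g h : C -> C) (z a u : C) (r s e k : R) (n : nat).

(** The exponent exceeds by one the [n] of the kernel bound. With [d = 1 - |a|] and [k] of order
    [1 / W (|a|)], the product [k * d ^+ n] stays bounded, and the spare factor [d] makes the
    functions tend to 0 locally uniformly. *)
Definition testf k a n z : C := rc k * (rc (1 - cmod a) / (1 - conj a * z)) ^+ n.+1.

Lemma testf_den_ge a z : cmod a < 1 -> cmod z < 1 -> 1 - cmod a * cmod z <= cmod (1 - conj a * z).
Proof. by move=> a1 z1; have := cmodB_ge 1 (conj a * z); rewrite cmod1 cmodM cmod_conj. Qed.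

Lemma testf_den_neq0 a z : cmod a < 1 -> cmod z < 1 -> 1 - conj a * z != 0.
Proof.
move=> a1 z1; apply: one_sub_neq0; rewrite cmod_conj.
by apply: mulr_ilt1 => //; exact: cmod_ge0.
Qed.

Lemma cder_testf k a n z : cmod a < 1 -> cmod z < 1 ->
  cder (testf k a n) z (rc k * (n.+1%:R * (rc (1 - cmod a) / (1 - conj a * z)) ^+ n *
    (rc (1 - cmod a) * conj a / (1 - conj a * z) ^+ 2))).
Proof.
move=> a1 z1; apply: cderZ.
exact: (cderX n (cder_affine_inv (rc (1 - cmod a)) (testf_den_neq0 a1 z1))).
Qed.

Lemma analytic_testf k a n : cmod a < 1 -> analytic_disc (testf k a n).
Proof. by move=> a1; apply/analytic_discP => z z1; eexists; exact: cder_testf. Qed.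

Lemma testf_le k a n z s : 0 <= k -> cmod a < 1 -> cmod z <= s -> s < 1 ->
  cmod (testf k a n z) <= k * ((1 - cmod a) / (1 - s)) ^+ n.+1.
Proof.
move=> k0 a1 zs s1; have z1 := le_lt_trans zs s1.
rewrite /testf cmodM cmod_rc ger0_norm //; apply: ler_wpM2l => //.
have d0 : 0 <= 1 - cmod a by rewrite subr_ge0 ltW.
have s0 : 0 < 1 - s by rewrite subr_gt0.
rewrite cmodX lerXn2r ?nnegrE ?cmod_ge0 ?divr_ge0 ?(ltW s0) //.
rewrite cmodM cmodV cmod_rc ger0_norm //; apply: ler_wpM2l => //.
have h : 1 - s <= cmod (1 - conj a * z).
  apply: le_trans (testf_den_ge a1 z1); rewrite lerD2l lerN2.
  apply: le_trans zs; rewrite ler_piMl ?cmod_ge0 //; exact: ltW.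
by rewrite lef_pV2 // posrE //; exact: lt_le_trans h.
Qed.

(** At [z = a] the quotient is [(1 - |a|) / (1 - |a|^2) = 1 / (1 + |a|) >= 1 / 2]. *)
Lemma testf_peak k a n : 0 <= k -> cmod a < 1 -> k / 2 ^+ n.+1 <= cmod (testf k a n a).
Proof.
move=> k0 a1; rewrite /testf cmodM cmod_rc ger0_norm //; apply: ler_wpM2l => //.
have a0 := cmod_ge0 a; have d0 : 0 < 1 - cmod a by rewrite subr_gt0.
rewrite -exprVn cmodX lerXn2r ?nnegrE ?cmod_ge0 ?invr_ge0 //.
have -> : 1 - conj a * a = rc (1 - cmod a ^+ 2) by rewrite mulrC mul_conj rcB rc1.
rewrite cmodM cmodV !cmod_rc.
have -> : 1 - cmod a ^+ 2 = (1 - cmod a) * (1 + cmod a) by ring.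
have h : 0 < 1 + cmod a by rewrite ltr_pwDl.
rewrite !ger0_norm ?mulr_ge0 ?(ltW d0) ?(ltW h) // invfM mulrA divff ?gt_eqF // mul1r.
rewrite lef_pV2 ?posrE //; lra.
Qed.

(** On the unit circle the function is the Poisson kernel of the point [b = r a] divided by
    [1 - |b|^2], so its integral is exact. *)
Lemma rcirc_inv_sqr a r : cmod a < 1 -> 0 <= r -> r < 1 ->
  onc (fun u => (cmod (1 - conj a * (rc r * u)) ^+ 2)^-1) /\
  rcirc (fun u => (cmod (1 - conj a * (rc r * u)) ^+ 2)^-1) = 2 * pi / (1 - (r * cmod a) ^+ 2).
Proof.
move=> a1 r0 r1; pose b := rc r * a.
have cb : cmod b = r * cmod a by rewrite cmodM cmod_rc ger0_norm.
have b1 : cmod b < 1 by rewrite cb; apply: mulr_ilt1 => //; exact: cmod_ge0.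
have p0 : 0 < 1 - cmod b ^+ 2.
  by rewrite subr_gt0 expr2; apply: mulr_ilt1 => //; exact: cmod_ge0.
have cP := onc_poisson b1.
have E u : cmod u = 1 -> (1 - cmod b ^+ 2)^-1 * poisson 1 b u = (cmod (1 - conj a * (rc r * u)) ^+ 2)^-1.
  move=> u1; rewrite /poisson expr1n (mulKf (lt0r_neq0 p0)).
  have -> : 1 - conj a * (rc r * u) = conj (rc 1 * u - b) * u.
    rewrite (conj_circle 1 b u1) /b conjM conj_rc rc1; ring.
  by rewrite cmodM cmod_conj u1 mulr1.
split; last by rewrite -(eq_rcirc E) (rcircZ _ cP) (rcirc_poisson b1) cb mulrC.
move=> u u1; apply: at_rV; last by rewrite expf_neq0 // cmod_eq0 testf_den_neq0 // cmodM cmod_rc u1 mulr1 ger0_norm.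
have c : {for u, continuous (fun u => cmod (1 - conj a * (rc r * u)))}.
  apply: at_cmod; apply: atB; first exact: at_cst.
  apply: atM; first exact: at_cst.
  apply: atM; [exact: at_cst|exact: at_id].
exact: (at_rM c c).
Qed.

(** The derivative has [n + 2] factors in its denominator. Two of them are integrated exactly by
    [rcirc_inv_sqr] and cost a single power of [1 - |a| r]; the other [n] are bounded pointwise.
    Thus the mean has only the power [n + 1] of the kernel. *)
Lemma testf_dmean k a n r : 0 <= k -> cmod a < 1 -> 0 <= r -> r < 1 ->
  dmean (testf k a n) r <= k * (2 * pi * n.+1%:R * 2 ^+ n.+1) * kern (1 - cmod a) r ^+ n.+1.
Proof.
move=> k0 a1 r0 r1; have da := analytic_testf k n a1.
have a0 := cmod_ge0 a; set d := 1 - cmod a.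
have d0 : 0 < d by rewrite subr_gt0.
have d1 : d <= 1 by rewrite /d gerBl.
have q0 : 0 < 1 - cmod a * r by rewrite subr_gt0; apply: mulr_ilt1.
pose B := k * n.+1%:R * (d / (1 - cmod a * r)) ^+ n * d.
have B0 : 0 <= B.
  apply: mulr_ge0 (ltW d0); apply: mulr_ge0; first by apply: mulr_ge0.
  by apply: exprn_ge0; apply: divr_ge0; exact: ltW.
have [cI EI'] := rcirc_inv_sqr a1 r0 r1.
have M : rcirc (fun u => cmod (cderiv (testf k a n) (rc r * u))) <= B * (2 * pi / (1 - (r * cmod a) ^+ 2)).
  rewrite -EI' -(rcircZ _ cI); apply: rcirc_le.
  - exact: onc_dmean.
  - by apply: onc_rM cI; exact: onc_cst.
  move=> u u1; have ru : cmod (rc r * u) = r by rewrite cmodM cmod_rc u1 mulr1 ger0_norm.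
  have z1 : cmod (rc r * u) < 1 by rewrite ru.
  rewrite (cder_cderiv (cder_testf k n a1 z1)).
  have hd := testf_den_ge a1 z1; rewrite ru in hd.
  rewrite !(cmodM, cmodX, cmodV, cmod_rc, cmod_nat, cmod_conj) -/d !(ger0_norm k0) !(ger0_norm (ltW d0)).
  set D := cmod (1 - conj a * (rc r * u)) in hd *.
  have D0 : 0 < D by exact: lt_le_trans hd.
  have -> : k * (n.+1%:R * (d / D) ^+ n * (d * cmod a / D ^+ 2)) =
     (k * n.+1%:R * (d / D) ^+ n * d) * (cmod a / D ^+ 2) by ring.
  have D2 : 0 <= D ^- 2 by rewrite invr_ge0 exprn_ge0 // ltW.
  apply: ler_pM.
  - apply: mulr_ge0 (ltW d0); apply: mulr_ge0; first by apply: mulr_ge0.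
    by apply: exprn_ge0; apply: divr_ge0; exact: ltW.
  - exact: mulr_ge0 a0 D2.
  - apply: ler_wpM2r; first exact: ltW.
    apply: ler_wpM2l; first by apply: mulr_ge0.
    rewrite lerXn2r ?nnegrE ?divr_ge0 ?(ltW d0) ?(ltW q0) ?(ltW D0) //.
    by apply: ler_wpM2l; [exact: ltW|rewrite lef_pV2 ?posrE].
  - by rewrite ler_piMl // ltW.
rewrite /dmean; apply: le_trans (ler_wpM2l r0 M) _.
have s0 : 0 < 1 - (r * cmod a) ^+ 2.
  rewrite subr_gt0 expr2; apply: mulr_ilt1; try exact: mulr_ge0.
  - by apply: mulr_ilt1.
  - by apply: mulr_ilt1.
have s1 : 1 - cmod a * r <= 1 - (r * cmod a) ^+ 2.
  rewrite lerD2l lerN2 expr2 [cmod a * r]mulrC ler_piMl ?mulr_ge0 // ltW //.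
  by apply: mulr_ilt1.
(* This rests on [2 (1 - |a| r) - d - (1 - r) = |a| (1 - r) + r d >= 0]. *)
have k1 : d / (1 - cmod a * r) <= 2 * kern d r.
  have h := kern_den_gt0 d0 r1.
  rewrite /kern mulrA ler_pdivrMr // mulrAC ler_pdivlMr //.
  have -> : 2 * d * (1 - cmod a * r) = d * (2 * (1 - cmod a * r)) by ring.
  apply: ler_wpM2l; first exact: ltW.
  have : 0 <= cmod a * (1 - r) by rewrite mulr_ge0 // subr_ge0 ltW.
  have : 0 <= r * d by exact: mulr_ge0 r0 (ltW d0).
  by rewrite /d; lra.
have q1 : 0 <= d / (1 - cmod a * r) by apply: divr_ge0; exact: ltW.
have pi0 : 0 < pi :> R by exact: pi_gt0.
have bn : (d / (1 - cmod a * r)) ^+ n.+1 <= 2 ^+ n.+1 * kern d r ^+ n.+1.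
  by rewrite -exprMn lerXn2r ?nnegrE // mulr_ge0 // kern_ge0.
apply: (@le_trans _ _ (k * (2 * pi * n.+1%:R) * (d / (1 - cmod a * r)) ^+ n.+1)).
  have -> : k * (2 * pi * n.+1%:R) * (d / (1 - cmod a * r)) ^+ n.+1 =
     B * (2 * pi / (1 - cmod a * r)) by rewrite /B exprSr; ring.
  apply: (@le_trans _ _ (B * (2 * pi / (1 - (r * cmod a) ^+ 2)))).
    rewrite ler_piMl ?(ltW r1) //; apply: mulr_ge0 B0 _.
    by apply: divr_ge0; [rewrite mulr_ge0 // ltW|exact: ltW].
  apply: (ler_wpM2l B0); apply: ler_wpM2l; first by rewrite mulr_ge0 // ltW.
  by rewrite lef_pV2 ?posrE.
have -> : k * (2 * pi * n.+1%:R * 2 ^+ n.+1) * kern d r ^+ n.+1 =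
  k * (2 * pi * n.+1%:R) * (2 ^+ n.+1 * kern d r ^+ n.+1) by ring.
apply: ler_wpM2l bn; rewrite mulr_ge0 // mulr_ge0 // mulr_ge0 // ltW //.
Qed.

Variable w : R -> R.
Hypothesis rw : radial_weight w.
Local Notation W := (omega_hat w).

(** The denominator of the kernel is at most 2, so the kernel is at least [d / 2] everywhere and its
    integral at least [(d / 2) ^+ n * W 0]. Hence [W (1 - d)] cannot decay faster than [d ^+ n]. *)
Lemma kern_integral_decay n A d : 0 < A -> 0 < d -> d <= 1 ->
  (EI 0 1 (fun s => kern d s ^+ n * w s)%R <= (A * W (1 - d))%:E)%E ->
  d ^+ n <= A * 2 ^+ n / W 0 * W (1 - d).
Proof.
move=> A0 d0 d1 H.
have W0 : 0 < W 0 by apply: (omega_hat_gt0 rw); rewrite lexx ltr01.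
have h : (((d / 2) ^+ n * W 0)%:E <= (A * W (1 - d))%:E)%E.
  apply: le_trans H; rewrite EFinM -(omega_hatE rw (lexx 0)) -EIZ.
  - apply: EI_le.
    + by apply: mcoM; [exact: mco_cst|exact: weight_mco].
    + exact: kern_weight_mco.
    + move=> s s01; apply: mulr_ge0; last exact: (weight_ge0 rw).
      by rewrite exprn_ge0 // divr_ge0 // ltW.
    + move=> s s01; case/andP: (s01) => s0 s1; apply: ler_wpM2r; first exact: (weight_ge0 rw).
      have p := kern_den_gt0 d0 s1.
      rewrite lerXn2r ?nnegrE ?kern_ge0 ?divr_ge0 ?(ltW d0) // /kern.
      apply: ler_wpM2l; first exact: ltW.
      by rewrite lef_pV2 ?posrE //; lra.
  - by rewrite exprn_ge0 // divr_ge0 // ltW.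
  - exact: weight_mco.
  - exact: weight_ge0.
rewrite lee_fin expr_div_n in h.
have p2 : 0 < (2 : R) ^+ n by rewrite exprn_gt0.
rewrite -(ler_pM2r W0); apply: (@le_trans _ _ (2 ^+ n * (A * W (1 - d)))).
  apply: le_trans (ler_wpM2l (ltW p2) h).
  by rewrite le_eqVlt; apply/orP; left; apply/eqP; field; rewrite gt_eqF.
by rewrite le_eqVlt; apply/orP; left; apply/eqP; field; rewrite gt_eqF.
Qed.

Lemma testf_D1_norm k a n A : 0 <= k -> cmod a < 1 -> 0 < A ->
  (EI 0 1 (fun s => kern (1 - cmod a) s ^+ n * w s)%R <= (A * W (cmod a))%:E)%E ->
  (D1_norm w (testf k a n) <= (k * W (cmod a) * (A * (2 * n.+1%:R * 2 ^+ n.+1) + A * 2 ^+ n / W 0))%:E)%E.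
Proof.
move=> k0 a1 A0 H; have da := analytic_testf k n a1; have a0 := cmod_ge0 a.
set d := 1 - cmod a in H *.
have d0 : 0 < d by rewrite subr_gt0.
have d1 : d <= 1 by rewrite /d gerBl.
have dE : cmod a = 1 - d by rewrite /d opprB addrC subrK.
have W0 : 0 < W 0 by apply: (omega_hat_gt0 rw); rewrite lexx ltr01.
have pi0 : 0 < pi :> R by exact: pi_gt0.
have Wa : 0 < W (cmod a) by apply: (omega_hat_gt0 rw); rewrite a0 a1.
have f0 : cmod (testf k a n 0) <= k * (A * 2 ^+ n / W 0 * W (cmod a)).
  have z0 : cmod (0 : C) <= 0 by rewrite cmod0.
  apply: le_trans (testf_le n k0 a1 z0 ltr01) _; rewrite subr0 divr1 -/d.
  apply: ler_wpM2l => //; rewrite dE.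
  apply: le_trans (@kern_integral_decay n A d A0 d0 d1 _); last by rewrite -dE.
  by rewrite exprS ler_piMl // exprn_ge0 // ltW.
pose K := k * (2 * pi * n.+1%:R * 2 ^+ n.+1).
have K0 : 0 <= K.
  by apply: mulr_ge0 k0 _; rewrite mulr_ge0 ?exprn_ge0 // mulr_ge0 // mulr_ge0 // ltW.
have E1 : (EI 0 1 (fun r => w r * dmean (testf k a n) r)%R <= (K * (A * W (cmod a)))%:E)%E.
  rewrite EFinM; apply: le_trans (lee_wpmul2l _ H); last by rewrite lee_fin.
  rewrite -(EIZ K0 (kern_weight_mco rw n d0) (fun s => kern_weight_ge0 rw n d0)); apply: EI_le.
  - exact: mcoM (weight_mco rw (lexx 0) (lexx 1)) (dmean_mco da (lexx 0)).
  - by apply: mcoM; [exact: mco_cst|exact: kern_weight_mco].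
  - by move=> s s01; apply: mulr_ge0; [exact: (weight_ge0 rw)|apply: dmean_ge0; case/andP: s01].
  - move=> s s01; case/andP: (s01) => s0 s1.
    rewrite [leRHS]mulrA [leRHS]mulrC; apply: ler_wpM2l; first exact: (weight_ge0 rw).
    apply: le_trans (testf_dmean n k0 a1 s0 s1) _; rewrite -/K -/d; apply: ler_wpM2l => //.
    have k1 := kern_ge0 d0 s1.
    by rewrite exprS ler_piMl ?kern_le1 // exprn_ge0.
rewrite (D1_normE rw da).
apply: (@le_trans _ _ ((K * (A * W (cmod a)))%:E * (pi^-1)%:E + (k * (A * 2 ^+ n / W 0 * W (cmod a)))%:E)%E).
  apply: leeD; last by rewrite lee_fin.
  by apply: lee_wpmul2r E1; rewrite lee_fin invr_ge0 ltW.
rewrite -EFinM -EFinD lee_fin le_eqVlt; apply/orP; left; apply/eqP.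
have key (p : R) : 0 < p -> k * (2 * p * n.+1%:R * 2 ^+ n.+1) * (A * W (cmod a)) * p^-1 =
   k * W (cmod a) * (A * (2 * n.+1%:R * 2 ^+ n.+1)).
  by move=> p0; field; rewrite gt_eqF.
rewrite /K (key _ pi0); ring.
Qed.

End TestFunctions.

(** * Compact integral operators have constant symbols *)

Section CompactIntegralOperators.
Variable R : realType.
Local Notation C := (CC R).
Implicit Types (f g h : C -> C) (z a u : C) (r s e k : R) (n : nat).

(** A maximum principle weakened by a factor 2: were [|f|] below [|f z| / 2] on the whole circle,
    its Poisson mean would be too small. With this loss no maximum on the circle has to be
    attained. *)
Lemma large_on_circle f z r : analytic_disc f -> cmod z < r -> r < 1 ->
  exists2 a, cmod a = r & cmod (f z) / 2 <= cmod (f a).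
Proof.
move=> df zr r1; have z0 := cmod_ge0 z; have r0 := le_lt_trans z0 zr.
have [E|m0] := leP (cmod (f z)) 0.
  exists (rc r); first by rewrite cmod_rc ger0_norm // ltW.
  by apply: le_trans (cmod_ge0 _); rewrite pmulr_lle0 // invr_gt0.
apply: contrapT => H.
have lt u : cmod u = 1 -> cmod (f (rc r * u)) <= cmod (f z) / 2.
  move=> u1; rewrite leNgt; apply/negP => h; apply: H; exists (rc r * u); last exact: ltW.
  by rewrite cmodM cmod_rc u1 mulr1 ger0_norm // ltW.
have cP := onc_poisson zr.
have cf := onc_cmod (analytic_onc df (ltW r0) r1).
have := poisson_sub_mean zr (analytic_disc_cdisc df r1).
have le : rcirc (fun u => cmod (f (rc r * u)) * poisson r z u) <= rcirc (fun u => cmod (f z) / 2 * poisson r z u).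
  apply: rcirc_le.
  - exact: onc_rM cf cP.
  - by apply: onc_rM cP; exact: onc_cst.
  - by move=> u u1; apply: ler_wpM2r (lt u u1); exact: poisson_ge0 (ltW zr).
move=> /le_trans /(_ le); rewrite (rcircZ _ cP) (rcirc_poisson zr).
have pm : 0 < pi * cmod (f z) by rewrite mulr_gt0 // pi_gt0.
have -> : 2 * pi * cmod (f z) = 2 * (pi * cmod (f z)) by ring.
have -> : cmod (f z) / 2 * (2 * pi) = pi * cmod (f z) by field.
lra.
Qed.

Lemma Tg_le g f z (M : R) : analytic_disc g -> analytic_disc f -> cmod z < 1 ->
  (forall t, 0 <= t -> t <= 1 -> cmod (f (rc t * z)) <= M) ->
  cmod (Tg g f z) <= M * RI 0 1 (fun t => cmod (cderiv g (rc t * z))).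
Proof.
move=> dg df z1 H.
have c1 : con 0 1 (fun t => f (rc t * z)) by exact: con_ray df z1.
have c2 : con 0 1 (fun t => cderiv g (rc t * z)) by exact: con_ray (analytic_cderiv dg) z1.
have c12 : con 0 1 (fun t => f (rc t * z) * cderiv g (rc t * z)) by exact: conM c1 c2.
have c3 : con 0 1 (fun t => cmod (cderiv g (rc t * z))) by exact: con_cmod c2.
have c4 : con 0 1 (fun t => M * cmod (cderiv g (rc t * z))) by exact: con_rZ c3.
rewrite TgE /primitive cmodM; apply: le_trans (_ : cmod (CI 0 1 (fun t => f (rc t * z) * cderiv g (rc t * z))) <= _).
  by rewrite ler_piMl ?cmod_ge0 // ltW.
apply: le_trans (CI_norm c12) _; rewrite -(RIZ _ c3); apply: (RI_le (con_cmod c12) c4) => t /andP[t0 t1].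
by rewrite cmodM; apply: ler_wpM2r; [exact: cmod_ge0|exact: H].
Qed.

(** Cauchy's estimate on the circle with [r] midway between [|z|] and 1, where [r / (r^2 - |z|^2) <=
    1 / (r - |z|) = 2 / (1 - |z|)]. *)
Lemma cderiv_le_sup f z e : analytic_disc f -> cmod z < 1 ->
  (forall v, cmod v < 1 -> cmod (f v) <= e) -> (1 - cmod z) * cmod (cderiv f z) <= 2 * e.
Proof.
move=> df z1 H; have z0 := cmod_ge0 z; have [r0 zr r1] := midpoint_lt1 z0 z1.
set r := (1 + cmod z) / 2 in r0 zr r1.
have e0 : 0 <= e by apply: le_trans (cmod_ge0 _) (H z z1).
have h1 : 0 < r - cmod z by rewrite subr_gt0.
have h2 : 0 < r + cmod z by rewrite ltr_wpDr.
have {}h : cmod (cderiv f z) <= e * r / (r ^+ 2 - cmod z ^+ 2).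
  by apply: (cauchy_estimate zr (analytic_disc_cdisc df r1)) => v vr; apply: H; rewrite vr.
rewrite subr_sqr ler_pdivlMr ?mulr_gt0 // in h.
have h3 : (r - cmod z) * cmod (cderiv f z) * r <= e * r.
  apply: le_trans h; rewrite [_ * cmod _]mulrC -mulrA; apply: ler_wpM2l; first exact: cmod_ge0.
  by rewrite ler_pM2l // lerDl.
rewrite ler_pM2r // in h3.
have -> : 1 - cmod z = 2 * (r - cmod z) by rewrite /r; field.
by rewrite -mulrA ler_pM2l.
Qed.

Variable w : R -> R.
Hypothesis rw : radial_weight w.
Local Notation W := (omega_hat w).

Lemma Tg_compact_constant g c : Dhat w -> 0 < c ->
  (forall s, s < 1 -> exists r, [/\ s < r, r < 1 & c * W r <= 1 - r]) ->
  analytic_disc g -> compact_operator (in_D1 w) (D1_norm w) (@in_Hinf R) (@Hinf_norm R) (Tg g) ->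
  constant_disc g.
Proof.
move=> Dw c0 Hc dg [_ Tc]; apply: (constant_of_cderiv0 dg) => z0 z01.
apply: contrapT => /eqP; rewrite -cmod_gt0 => m0.
have [n [A [A0 HA]]] := kern_integral_le rw Dw.
have W0 : 0 < W 0 by apply: (omega_hat_gt0 rw); rewrite lexx ltr01.
set m := cmod (cderiv g z0) in m0.
pose K := A * (2 * n.+1%:R * 2 ^+ n.+1) + A * 2 ^+ n / W 0.
have K0 : 0 < K.
  by apply: addr_gt0; rewrite ?mulr_gt0 ?invr_gt0 ?exprn_gt0 ?ltr0n.
(* A radius beyond [|z0|] lets [large_on_circle] keep [|g'|] at least [m / 2]; a radius beyond
   [1 - 1 / j.+1] makes [|a j|] tend to 1. *)
have pick j : exists a, [/\ cmod a < 1, 1 - cmod a < j.+1%:R^-1, c * W (cmod a) <= 1 - cmod a &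
    m / 2 <= cmod (cderiv g a)].
  have j0 : 0 < (j.+1%:R^-1 : R) by rewrite invr_gt0 ltr0n.
  have s1 : Num.max (cmod z0) (1 - j.+1%:R^-1) < 1 by rewrite gt_max z01 ltrBlDr ltrDl.
  have [r []] := Hc _ s1; rewrite gt_max => /andP[zr jr] r1 cr.
  have [a ar ha] := large_on_circle (analytic_cderiv dg) zr r1.
  by exists a; rewrite ar; split=> //; rewrite ltrBlDr addrC -ltrBlDr.
have [a Ha] := choice pick.
have a1 j : cmod (a j) < 1 by case: (Ha j).
have Wa j : 0 < W (cmod (a j)) by apply: (omega_hat_gt0 rw); rewrite cmod_ge0 a1.
(* [K] is the constant of [testf_D1_norm], so this factor brings the norms down to at most 1. *)
pose k j := (K * W (cmod (a j)))^-1.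
have k0 j : 0 < k j by rewrite invr_gt0 mulr_gt0.
pose u j := testf (k j) (a j) n.
have d0 j : 0 < 1 - cmod (a j) by rewrite subr_gt0.
have d1 j : 1 - cmod (a j) <= 1 by rewrite gerBl cmod_ge0.
have HAj j : (EI 0 1 (fun s => kern (1 - cmod (a j)) s ^+ n * w s)%R <= (A * W (cmod (a j)))%:E)%E.
  by have := HA _ (d0 j) (d1 j); rewrite subKr.
have du j : analytic_disc (u j) by exact: analytic_testf.
have nu j : (D1_norm w (u j) <= 1)%E.
  apply: le_trans (testf_D1_norm rw (ltW (k0 j)) (a1 j) A0 (HAj j)) _.
  rewrite lee_fin -/K /k; have h := Wa j; rewrite le_eqVlt; apply/orP; left; apply/eqP.
  by field; rewrite !gt_eqF.
have [|phi [phiS [h [[dh _] hc]]]] := Tc u.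
  by move=> j; split; [split=> //; exact: le_lt_trans (nu j) (ltry _)|exact: nu].
pose D j z : C := Tg g (u (phi j)) z - h z.
have dT j : analytic_disc (Tg g (u (phi j))) by exact: analytic_Tg.
have D0 j : (0 <= Hinf_norm (D j))%E by exact: Hinf_norm_ge0.
have {}hc := iffLR (cvge0P D0) hc.
have phige j : (j <= phi j)%N.
  by elim: j => // j IH; exact: leq_ltn_trans IH (phiS _ _ (ltnSn j)).
have decay j z t : cmod z < 1 -> 0 <= t -> t <= 1 -> cmod (u j (rc t * z)) <=
    A * 2 ^+ n / W 0 / K / (1 - cmod z) ^+ n.+1 * (1 - cmod (a j)).
  move=> z1 t0 t1.
  apply: le_trans (testf_le n (ltW (k0 j)) (a1 j) (cmod_ray z t0 t1) z1) _.
  have dn : (1 - cmod (a j)) ^+ n <= A * 2 ^+ n / W 0 * W (cmod (a j)).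
    have := kern_integral_decay rw A0 (d0 j) (d1 j).
    by rewrite subKr; apply; exact: HAj.
  have z1' : 0 < (1 - cmod z) ^+ n.+1 by rewrite exprn_gt0 // subr_gt0.
  rewrite expr_div_n exprS.
  have h' := Wa j; have dj := d0 j.
  have -> : A * 2 ^+ n / W 0 / K / (1 - cmod z) ^+ n.+1 * (1 - cmod (a j)) =
     k j * ((1 - cmod (a j)) * (A * 2 ^+ n / W 0 * W (cmod (a j))) / (1 - cmod z) ^+ n.+1).
    by rewrite /k; field; rewrite !gt_eqF.
  apply: (ler_wpM2l (ltW (k0 j))); apply: ler_wpM2r; first by rewrite invr_ge0 ltW.
  by apply: ler_wpM2l dn; exact: ltW.
(* The sup-norm limit is identified pointwise: on the segment from 0 to [z] the test functions tend
   to 0, hence so do their images at [z]. *)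
have hz z : cmod z < 1 -> h z = 0.
  move=> z1; apply/eqP; rewrite -cmod_eq0 eq_le cmod_ge0 andbT.
  pose B := A * 2 ^+ n / W 0 / K / (1 - cmod z) ^+ n.+1.
  pose I := RI 0 1 (fun t => cmod (cderiv g (rc t * z))).
  have B0 : 0 <= B.
    by apply: divr_ge0; [apply: divr_ge0; [apply: divr_ge0; [apply: mulr_ge0|]|]|]; rewrite ?exprn_ge0 ?subr_ge0 // ltW.
  have I0 : 0 <= I by apply: RI_ge0 => t _; exact: cmod_ge0.
  have BI : 0 < B * I + 1 by apply: ltr_wpDl ltr01; exact: mulr_ge0.
  apply/ler_addgt0Pl => e e0; rewrite addr0.
  have e2 : 0 < e / 2 by rewrite divr_gt0.
  have e3 : 0 < e / 2 / (B * I + 1) by rewrite divr_gt0.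
  have [N _ HN] := hc _ e2.
  have [N' HN'] : exists N' : nat, N'.+1%:R^-1 <= e / 2 / (B * I + 1).
    have := Num.Theory.archi_boundP (ltW (_ : 0 < (e / 2 / (B * I + 1))^-1)).
    rewrite invr_gt0 => /(_ e3) hN'; exists (Num.bound (e / 2 / (B * I + 1))^-1).
    rewrite -[leRHS]invrK lef_pV2 ?posrE ?invr_gt0 ?ltr0n //.
    by apply: ltW; apply: lt_le_trans hN' _; rewrite ler_nat.
  pose j := maxn N N'.
  have D1 : cmod (D j z) <= e / 2.
    rewrite -lee_fin; apply: le_trans (Hinf_norm_ge (D j) z1) _; apply: HN; exact: leq_maxl.
  have [_ aj _ _] := Ha (phi j).
  have T1 : cmod (Tg g (u (phi j)) z) <= e / 2.
    apply: le_trans (Tg_le dg (du _) z1 (fun t t0 t1 => decay (phi j) z t z1 t0 t1)) _.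
    rewrite -/B -/I; apply: (@le_trans _ _ ((B * I + 1) * (1 - cmod (a (phi j))))).
      have -> : B * (1 - cmod (a (phi j))) * I = B * I * (1 - cmod (a (phi j))) by ring.
      by apply: ler_wpM2r; [exact: ltW|rewrite lerDl].
    rewrite mulrC -ler_pdivlMr //; apply: le_trans HN'; apply: le_trans (ltW aj) _.
    rewrite lef_pV2 ?posrE ?ltr0n // ler_nat ltnS.
    exact: leq_trans (leq_maxr N N') (phige j).
  have -> : h z = Tg g (u (phi j)) z - D j z by rewrite /D opprB addrC subrK.
  by apply: le_trans (cmodB _ _) _; rewrite (splitr e) lerD.
(* A lower bound for [(1 - |b|) |u(b)| |g'(b)|]: [c / K] comes from [(1 - |b|) / (K W)], the power
   of 2 from [testf_peak], and [m / 2] from the choice of [b]. With images below [q / 4],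
   [cderiv_le_sup] bounds the same product by [q / 2]. *)
pose q := c / K / 2 ^+ n.+1 * (m / 2).
have q0 : 0 < q by apply: mulr_gt0; [apply: divr_gt0; [exact: divr_gt0|rewrite exprn_gt0]|exact: divr_gt0].
have q4 : 0 < q / 4 by rewrite divr_gt0.
have [N _ /(_ N (leqnn N)) HN] := hc _ q4.
pose b := a (phi N); have [b1 _ cb mb] := Ha (phi N); rewrite -/b in b1 cb mb.
have sup v : cmod v < 1 -> cmod (Tg g (u (phi N)) v) <= q / 4.
  move=> v1; have DN : D N v = Tg g (u (phi N)) v by rewrite /D (hz v v1) subr0.
  rewrite -lee_fin -DN; exact: le_trans (Hinf_norm_ge (D N) v1) HN.
have := cderiv_le_sup (dT N) b1 sup; rewrite (cderiv_Tg dg (du _) b1) cmodM.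
have pk := testf_peak n (ltW (k0 (phi N))) b1; rewrite -/(u (phi N)) in pk.
have Wb := Wa (phi N); rewrite -/b in Wb.
have low : q <= (1 - cmod b) * (cmod (u (phi N) b) * cmod (cderiv g b)).
  rewrite mulrA; apply: ler_pM.
  - by apply: divr_ge0; [apply: divr_ge0; exact: ltW|rewrite exprn_ge0].
  - by rewrite divr_ge0 // ltW.
  - apply: (@le_trans _ _ ((1 - cmod b) * (k (phi N) / 2 ^+ n.+1))); last first.
      by apply: ler_wpM2l pk; exact: ltW (d0 (phi N)).
    rewrite mulrA; apply: ler_wpM2r; first by rewrite invr_ge0 exprn_ge0.
    rewrite /k -/b ler_pdivlMr ?mulr_gt0 //.
    by have -> : c / K * (K * W (cmod b)) = c * W (cmod b); first by field; rewrite gt_eqF.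
  - exact: mb.
lra.
Qed.

End CompactIntegralOperators.

(** * Moments of the weight and their series *)

Section Moments.
Variable R : realType.
Implicit Types (r s e d c : R) (n m k : nat).

Lemma bernoulli_sub x n : 0 <= x -> x <= 1 -> 1 - n%:R * x <= (1 - x) ^+ n :> R.
Proof.
move=> x0 x1; elim: n => [|n IH]; first by rewrite mul0r subr0 expr0.
have q0 : 0 <= 1 - x by rewrite subr_ge0.
rewrite exprS; apply: le_trans (ler_wpM2l q0 IH).
have : 0 <= n%:R * (x * x) :> R by rewrite mulr_ge0 // mulr_ge0.
rewrite -natr1; lra.
Qed.

Lemma expr_mul_le1 s m : 0 <= s -> s <= 1 -> s ^+ m * (1 + m%:R * (1 - s)) <= 1.
Proof.
move=> s0 s1; elim: m => [|m IH]; first by rewrite expr0 mul0r addr0 mulr1.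
apply: le_trans IH; rewrite exprSr -mulrA; apply: ler_wpM2l; first exact: exprn_ge0.
have : 0 <= m%:R * ((1 - s) * (1 - s)) :> R by rewrite mulr_ge0 // mulr_ge0 // subr_ge0.
have : 0 <= (1 - s) * (1 - s) by rewrite mulr_ge0 // subr_ge0.
rewrite -natr1; lra.
Qed.

(** [s ^+ m <= 1 / (1 + m (1 - s))], which is at most [d / (d + 1 - s)] once [m d >= 1]. Powers of
    [s] are thereby dominated by the kernel, and moments inherit the bound of its integral. *)
Lemma expr_le_kern d s m : 0 < d -> 1 <= m%:R * d -> 0 <= s -> s < 1 -> s ^+ m <= kern d s.
Proof.
move=> d0 md s0 s1; rewrite /kern ler_pdivlMr ?kern_den_gt0 //.
have h := ler_wpM2l (ltW d0) (expr_mul_le1 m s0 (ltW s1)); rewrite mulr1 in h.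
apply: le_trans h; rewrite mulrCA; apply: ler_wpM2l; first exact: exprn_ge0.
have : 0 <= (m%:R * d - 1) * (1 - s) by rewrite mulr_ge0 // subr_ge0 // ltW.
lra.
Qed.

Variable w : R -> R.
Hypothesis rw : radial_weight w.
Local Notation W := (omega_hat w).

Lemma pow_mco k : mco 0 1 (fun s : R => s ^+ k).
Proof.
apply: nondecreasing01_mco => // r s r0 rs _.
by rewrite lerXn2r ?nnegrE // (le_trans r0).
Qed.

Lemma pow_weight_ge0 k s : 0 <= s < 1 -> 0 <= s ^+ k * w s.
Proof.
by move=> s01; rewrite mulr_ge0 ?(weight_ge0 rw) // exprn_ge0 //; case/andP: s01.
Qed.

Lemma momentE k : EI 0 1 (fun s => s ^+ k * w s) = (moment w k)%:E.
Proof.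
rewrite /moment /Rintegral fineK //.
rewrite ge0_fin_numE; last by apply: EI_ge0 => s; exact: pow_weight_ge0.
apply: (@le_lt_trans _ _ (EI 0 1 w)); last by rewrite (omega_hatE rw (lexx 0)) ltry.
have mw := weight_mco rw (lexx 0) (lexx 1).
apply: EI_le => //; [exact: mcoM (pow_mco k) mw|exact: pow_weight_ge0|].
move=> s s01; case/andP: (s01) => s0 s1.
by rewrite ler_piMl ?(weight_ge0 rw) // exprn_ile1 // ltW.
Qed.

Lemma moment_ge k s : 0 <= s -> s < 1 -> s ^+ k * W s <= moment w k.
Proof.
move=> s0 s1; rewrite -lee_fin -momentE EFinM -(omega_hatE rw s0).
have mw := weight_mco rw s0 (lexx 1).
have mk := mcoM (pow_mco k) (weight_mco rw (lexx 0) (lexx 1)).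
rewrite -EIZ ?exprn_ge0 //; last exact: weight_ge0' rw _ s0.
apply: (@le_trans _ _ (EI s 1 (fun x => x ^+ k * w x))).
  apply: EI_le.
  - by apply: mcoM; [exact: mco_cst|exact: mw].
  - exact: mcoS s0 (lexx 1) mk.
  - by move=> x xs; rewrite mulr_ge0 ?exprn_ge0 // (weight_ge0' rw s0).
  - move=> x xs; apply: ler_wpM2r; first exact: (weight_ge0' rw s0).
    by case/andP: xs => sx _; rewrite lerXn2r ?nnegrE // (le_trans s0).
by apply: EI_sub => // x; exact: pow_weight_ge0.
Qed.

Lemma moment_gt0 k : 0 < moment w k.
Proof.
have h : 0 <= (2^-1 : R) by rewrite invr_ge0.
have h1 : (2^-1 : R) < 1 by lra.
apply: lt_le_trans (moment_ge k h h1); rewrite mulr_gt0 ?exprn_gt0 ?invr_gt0 //.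
by apply: (omega_hat_gt0 rw); rewrite h h1.
Qed.

Lemma moment_le n m k d (B : R) : 0 < d -> 1 <= m%:R * d -> (n * m <= k)%N ->
  (EI 0 1 (fun s => kern d s ^+ n * w s)%R <= B%:E)%E -> moment w k <= B.
Proof.
move=> d0 md mk H; rewrite -lee_fin -momentE; apply: le_trans H.
apply: EI_le.
- exact: mcoM (pow_mco k) (weight_mco rw (lexx 0) (lexx 1)).
- exact: kern_weight_mco.
- exact: pow_weight_ge0.
move=> s s01; case/andP: (s01) => s0 s1; apply: ler_wpM2r; first exact: (weight_ge0 rw).
apply: (@le_trans _ _ (s ^+ (n * m))); first by rewrite ler_wiXn2l // ltW.
by rewrite mulnC exprM lerXn2r ?nnegrE ?exprn_ge0 ?kern_ge0 // expr_le_kern.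
Qed.

Definition momentterm r k : R := r ^+ k / (k.+1%:R * moment w k).

Lemma momentterm_ge0 r k : 0 <= r -> 0 <= momentterm r k.
Proof.
by move=> r0; rewrite divr_ge0 ?exprn_ge0 // mulr_ge0 ?ler0n // ltW // moment_gt0.
Qed.

(** With [x = 1 / (2 k)] one has [(1 - x) ^+ k >= 1 / 2], so the moment is at least
    [W (1 - x) / 2 >= x / (2 e) = 1 / (4 e k)] as soon as [1 - x >= s]. The late terms are then at
    most [4 e r ^+ k], with a geometric sum; [B] collects the early terms at [r = 1]. *)
Lemma moment_series_small e : 0 < e -> (exists s, [/\ 0 <= s, s < 1 &
    forall r, s <= r -> r < 1 -> 1 - r <= e * W r]) ->
  exists B, forall r, 0 <= r -> r < 1 ->
    ((1 - r)%:E * \sum_(1 <= k <oo) (momentterm r k)%:E <= ((1 - r) * B + 4 * e)%:E)%E.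
Proof.
move=> e0 [s [s0 s1 Hs]].
have s1' : 0 < 1 - s by rewrite subr_gt0.
have [k0 k0s] : exists k0 : nat, (k0.+1%:R * 2 : R)^-1 <= 1 - s.
  exists (Num.bound (1 - s)^-1).
  rewrite -[leRHS]invrK lef_pV2 ?posrE ?invr_gt0 ?mulr_gt0 ?ltr0n //.
  have i0 : 0 <= (1 - s)^-1 by rewrite invr_ge0 ltW.
  have := Num.Theory.archi_boundP i0; rewrite -natr1; lra.
pose t r k := momentterm r k.
pose B := \sum_(1 <= k < k0.+1) t 1 k.
have term k r : (k0 < k)%N -> 0 <= r -> t r k <= 4 * e * r ^+ k.
  move=> kk r0; have kn : (0 < k)%N by exact: leq_trans kk.
  have k1 : 0 < k%:R :> R by rewrite ltr0n.
  have kE : k%:R * (k%:R * 2 : R)^-1 = 2^-1 by field; rewrite gt_eqF.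
  have x0 : 0 < (k%:R * 2 : R)^-1 by rewrite invr_gt0 mulr_gt0.
  have xs : (k%:R * 2 : R)^-1 <= 1 - s.
    by apply: le_trans k0s; rewrite lef_pV2 ?posrE ?mulr_gt0 ?ltr0n // ler_pM2r // ler_nat.
  have x1 : (k%:R * 2 : R)^-1 <= 1 by apply: le_trans xs _; rewrite gerBl.
  have y0 : 0 <= 1 - (k%:R * 2 : R)^-1 by rewrite subr_ge0.
  have y1 : 1 - (k%:R * 2 : R)^-1 < 1 by rewrite ltrBlDr ltrDl.
  have h1 := moment_ge k y0 y1.
  have h2 := bernoulli_sub k (ltW x0) x1.
  have h3 : 1 - (1 - (k%:R * 2 : R)^-1) <= e * W (1 - (k%:R * 2)^-1).
    by apply: Hs => //; lra.
  rewrite subKr in h3.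
  have W0 : 0 < W (1 - (k%:R * 2)^-1) by apply: (omega_hat_gt0 rw); rewrite y0 y1.
  have h4 : 2^-1 * W (1 - (k%:R * 2)^-1) <= moment w k.
    apply: le_trans h1; apply: ler_wpM2r; first exact: ltW.
    apply: le_trans h2; rewrite kE; lra.
  have h5 : 1 <= 4 * e * (k%:R * moment w k).
    have : k%:R * (k%:R * 2 : R)^-1 <= k%:R * (e * W (1 - (k%:R * 2)^-1)).
      by apply: ler_wpM2l h3; exact: ltW.
    rewrite kE => h6.
    have : (4 * e * k%:R) * (2^-1 * W (1 - (k%:R * 2)^-1)) <= (4 * e * k%:R) * moment w k.
      by apply: ler_wpM2l h4; rewrite mulr_ge0 ?ler0n // mulr_ge0 // ltW.
    by lra.
  rewrite /t /momentterm mulrC; apply: ler_wpM2r; first exact: exprn_ge0.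
  have m0 := moment_gt0 k.
  have X0 : 0 < k.+1%:R * moment w k by rewrite mulr_gt0 ?ltr0n.
  rewrite -[leLHS]mul1r ler_pdivrMr //; apply: le_trans h5 _.
  apply: ler_wpM2l; first by rewrite mulr_ge0 // ltW.
  by rewrite ler_pM2r // ler_nat.
have tpos r k : 0 <= r -> 0 <= t r k by exact: momentterm_ge0.
exists B => r r0 r1; have q0 : 0 < 1 - r by rewrite subr_gt0.
have P j : \sum_(1 <= k < k0.+1 + j) t r k <= B + 4 * e * ((1 - r ^+ j) / (1 - r)).
  elim: j => [|j IH].
    rewrite addn0 expr0 subrr mul0r mulr0 addr0; apply: ler_sum_nat => k _.
    rewrite /t /momentterm expr1n; apply: ler_wpM2r.
      by rewrite invr_ge0 mulr_ge0 ?ler0n // ltW // moment_gt0.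
    by rewrite exprn_ile1 // ltW.
  rewrite addnS big_nat_recr //=; apply: le_trans (lerD IH (term _ r _ r0)) _.
    by rewrite ltn_addr.
  rewrite -addrA lerD2l -mulrDr; apply: ler_wpM2l; first by rewrite mulr_ge0 // ltW.
  apply: (@le_trans _ _ ((1 - r ^+ j) / (1 - r) + r ^+ j)).
    by rewrite lerD2l; apply: ler_wiXn2l => //; [exact: ltW|exact: leq_addl].
  by rewrite le_eqVlt; apply/orP; left; apply/eqP; rewrite exprS; field; rewrite gt_eqF.
have S n : \sum_(1 <= k < n) t r k <= B + 4 * e / (1 - r).
  apply: (@le_trans _ _ (\sum_(1 <= k < k0.+1 + n) t r k)).
    case: n => [|n]; first by rewrite big_geq // sumr_ge0 // => k _; exact: tpos.
    rewrite (@big_cat_nat _ _ _ n.+1 1 (k0.+1 + n.+1)) //=; last exact: leq_addl.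
    by rewrite lerDl sumr_ge0 // => k _; exact: tpos.
  apply: le_trans (P n) _; rewrite lerD2l mulrA; apply: ler_wpM2r; first by rewrite invr_ge0 ltW.
  by rewrite ler_piMr ?mulr_ge0 ?(ltW e0) // gerBl exprn_ge0.
have L : (\sum_(1 <= k <oo) (t r k)%:E <= (B + 4 * e / (1 - r))%:E)%E.
  apply: lime_le; first by apply: is_cvg_nneseries => k _ _; rewrite lee_fin; exact: tpos.
  by apply: nearW => n; rewrite sumEFin lee_fin.
apply: le_trans (lee_wpmul2l _ L) _; first by rewrite lee_fin ltW.
rewrite -EFinM lee_fin mulrDr [(1 - r) * (_ / _)]mulrC divfK // gt_eqF //.
Qed.

(** Only the block [N <= k < 2 N] with [N] of order [1 / (1 - r)] is kept. There [r ^+ k] is bounded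
    below and each moment is at most [A * W r], so the block sums to at least a constant over [W r],
    and [(1 - r) / W r >= c]. *)
Lemma moment_series_large c n A : 0 < c -> 0 < A ->
  (forall d, 0 < d -> d <= 1 -> (EI 0 1 (fun s => kern d s ^+ n * w s)%R <= (A * W (1 - d))%:E)%E) ->
  forall r, 3 / 4 <= r -> r < 1 -> c * W r <= 1 - r ->
  ((c / (A * 2 * 2 ^+ (8 * n.+1)))%:E <= (1 - r)%:E * \sum_(1 <= k <oo) (momentterm r k)%:E)%E.
Proof.
move=> c0 A0 HA r r34 r1 cr; have r0 : 0 <= r by lra.
set d := 1 - r in cr *; have d0 : 0 < d by rewrite subr_gt0.
have d4 : d <= 1 / 4 by rewrite /d; lra.
have W0 : 0 < W r by apply: (omega_hat_gt0 rw); rewrite r0 r1.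
(* The scale [m] is small enough for [r ^+ m >= 1 / 2] and large enough for [s ^+ (4 * m) <= kern d s]. *)
pose m := Num.truncn (2 * d)^-1.
have i0 : 0 <= (2 * d)^-1 by rewrite invr_ge0 mulr_ge0 // ltW.
have [m1 m2] := andP (truncn_itv i0); rewrite -/m in m1 m2.
have dn : d != 0 by rewrite gt_eqF.
have idd : (2 * d)^-1 * d = 1 / 2 by field.
have md : m%:R * d <= 1 / 2 by rewrite -idd; apply: ler_wpM2r m1; exact: ltW.
have md4 : 1 <= (4 * m)%:R * d.
  have : (2 * d)^-1 * d < m.+1%:R * d by rewrite ltr_pM2r.
  rewrite idd natrM -(@natr1 R m) mulrDl mul1r; lra.
have rm : 1 / 2 <= r ^+ m.
  have := bernoulli_sub m (ltW d0) ltac:(lra); rewrite {2}/d subKr; lra.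
(* Taking [n.+1] keeps [N] positive when [n = 0]. As [2 N = m * (8 * n.+1)], the bound
   [r ^+ m >= 1 / 2] gives the power of 2 in the constant. *)
pose N := (n.+1 * (4 * m))%N.
have m0 : (0 < m)%N.
  rewrite lt0n; apply/eqP => E; move: md4; rewrite E muln0 mul0r; lra.
have N0 : (0 < N)%N by rewrite !muln_gt0 m0.
pose T := (2 ^+ (8 * n.+1))^-1 / ((2 * N)%:R * (A * W r)).
have AW : 0 < A * W r by rewrite mulr_gt0.
have p2 : 0 < (2 : R) ^+ (8 * n.+1) by rewrite exprn_gt0.
have term k : (N <= k < 2 * N)%N -> T <= momentterm r k.
  case/andP=> k1 k2; have mk := moment_gt0 k.
  have h1 : moment w k <= A * W r.
    have rd : r = 1 - d by rewrite /d subKr.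
    rewrite [in leRHS]rd; apply: (moment_le (n := n) d0 md4); last by apply: HA => //; lra.
    by apply: leq_trans k1; rewrite leq_mul2r leqnSn orbT.
  rewrite /T /momentterm; apply: ler_pM.
  - by rewrite invr_ge0 ltW.
  - by rewrite invr_ge0 mulr_ge0 ?ler0n // ltW.
  - apply: (@le_trans _ _ (r ^+ (2 * N))); last by apply: ler_wiXn2l => //; [exact: ltW|exact: ltnW k2].
    have -> : (2 * N = m * (8 * n.+1))%N by rewrite /N; ring.
    rewrite [leRHS]exprM -exprVn lerXn2r ?nnegrE ?invr_ge0 ?exprn_ge0 //; lra.
  - rewrite lef_pV2 ?posrE ?mulr_gt0 ?ltr0n ?muln_gt0 ?N0 //.
    by apply: ler_pM; rewrite ?ler0n ?(ltW mk) // ler_nat.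
have tpos k : 0 <= momentterm r k by exact: momentterm_ge0.
apply: (@le_trans _ _ (d * \sum_(1 <= k < 2 * N) momentterm r k)%:E); last first.
  rewrite EFinM; apply: lee_wpmul2l; first by rewrite lee_fin ltW.
  rewrite -sumEFin; apply: nneseries_lim_ge => k _ _; by rewrite lee_fin.
rewrite lee_fin; apply: (@le_trans _ _ (d * (N%:R * T))); last first.
  apply: ler_wpM2l; first exact: ltW.
  rewrite (@big_cat_nat _ _ _ N 1 (2 * N)) //=; last by rewrite leq_pmull.
  rewrite -[leLHS]add0r; apply: lerD; first by apply: sumr_ge0 => k _; exact: tpos.
  have -> : N%:R * T = \sum_(N <= k < 2 * N) T.
    by rewrite sumr_const_nat [in RHS]mul2n -addnn addnK mulr_natl.
  by apply: ler_sum_nat.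
have -> : d * (N%:R * T) = d / W r / (A * 2 * 2 ^+ (8 * n.+1)).
  rewrite /T natrM; field; rewrite !gt_eqF ?ltr0n //.
by apply: ler_wpM2r; rewrite ?invr_ge0 ?mulr_ge0 ?(ltW p2) ?(ltW A0) // ler_pdivlMr.
Qed.

End Moments.

(** * Positive upper limits at 1 *)

Section UpperLimit.
Variable R : realType.
Implicit Types (r s c : R).

(** A positive upper limit leaves room for a fixed real [c] below it: half of it if it is finite,
    and 1 if it is infinite, which has to be allowed for the series of moments. *)
Lemma limf_esup_left_gt0P (f : R -> \bar R) : (0 < limf_esup f (1 : R)^'-)%E <->
  exists2 c : R, 0 < c & forall s, s < 1 -> exists r, [/\ s < r, r < 1 & (c%:E <= f r)%E].
Proof.
rewrite limf_esupE; split=> [h|[c c0 H]].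
  have [c c0 hc] : exists2 c : R, 0 < c & (c%:E < ereal_inf [set ereal_sup (f @` V) | V in (1 : R)^'-])%E.
    move: h; set x := ereal_inf _; case: x => [x| |] // x0; last by exists 1; rewrite ?ltry.
    rewrite lte_fin in x0; exists (x / 2); first exact: divr_gt0.
    by rewrite lte_fin ltr_pdivrMr // ltr_pMr // ltr1n.
  exists c => // s s1.
  pose V : set R := [set r | s < r < 1].
  have V1 : (1 : R)^'- V.
    by near=> r; rewrite /V /=; apply/andP; split; near: r; [exact: nbhs_left_gt|exact: nbhs_left_lt].
  have le : (ereal_inf [set ereal_sup (f @` V') | V' in (1 : R)^'-] <= ereal_sup (f @` V))%E.
    by apply: ereal_inf_lbound; exists V.
  have [_ [r /= /andP[sr r1] <-] /ltW fr] := ereal_sup_gt (lt_le_trans hc le).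
  by exists r.
apply: (@lt_le_trans _ _ c%:E); first by rewrite lte_fin.
apply: le_ereal_inf_tmp => _ [V V1 <-].
have [s s1 HV] : exists2 s, s < 1 & forall r, s < r -> r < 1 -> V r.
  move: V1 => [d /= d0 HV]; exists (1 - d); first by rewrite ltrBlDr ltrDl.
  move=> r dr r1; apply: HV => //=.
  by rewrite gtr0_norm ?subr_gt0 // ltrBlDr addrC -ltrBlDr.
have [r [sr r1 fr]] := H s s1.
apply: le_trans fr _; apply: ereal_sup_ubound; exists r => //; exact: HV.
Unshelve. all: by end_near. Qed.

End UpperLimit.

(** * The equivalences *)

Section Equivalence.
Variables (R : realType) (w : R -> R).
Hypothesis rw : radial_weight w.
Local Notation W := (omega_hat w).

(** Condition (ii) without limits or quotients, the form in which it is both used and negated. *)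
Definition ratio_large := exists2 c : R, 0 < c &
  forall s, s < 1 -> exists r, [/\ s < r, r < 1 & c * W r <= 1 - r].

Lemma ratio_largeP : (0 < limf_esup (fun r : R => ((1 - r) / W r)%:E) (1 : R)^'-)%E <-> ratio_large.
Proof.
rewrite limf_esup_left_gt0P; split=> -[c c0 H]; exists c => // s s1.
  have s1' : Num.max s 0 < 1 by rewrite gt_max s1 ltr01.
  have [r []] := H _ s1'; rewrite gt_max lee_fin => /andP[sr r0] r1 h; exists r; split=> //.
  by rewrite -ler_pdivlMr // (omega_hat_gt0 rw) // r1 ltW.
have s1' : Num.max s 0 < 1 by rewrite gt_max s1 ltr01.
have [r []] := H _ s1'; rewrite gt_max => /andP[sr r0] r1 h; exists r; split=> //.
by rewrite lee_fin ler_pdivlMr // (omega_hat_gt0 rw) // r1 ltW.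
Qed.

Lemma not_ratio_large : ~ ratio_large -> forall e : R, 0 < e -> exists s, [/\ 0 <= s, s < 1 &
  forall r, s <= r -> r < 1 -> 1 - r <= e * W r].
Proof.
move=> H e e0; apply: contrapT => H'; apply: H; exists e => // s s1.
have t1 : Num.max s 0 < 1 by rewrite gt_max s1 ltr01.
have t0 : 0 <= Num.max s 0 by rewrite le_max lexx orbT.
(* The midpoint turns [s <= r] into the strict inequality that the negated hypothesis is about. *)
have [m0 sm m1] := midpoint_lt1 t0 t1.
apply: contrapT => H; apply: H'; exists ((1 + Num.max s 0) / 2); split=> //; first exact: ltW.
move=> r mr r1; have [//|h] := leP (1 - r) (e * W r); exfalso; apply: H; exists r; split=> //; last exact: ltW.
by apply: le_lt_trans (lt_le_trans sm mr); rewrite le_max lexx.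
Qed.

Local Notation compact_identity := (compact_operator (in_D1 w) (D1_norm w) (in_D1 (@one_weight R))
  (D1_norm (@one_weight R)) (fun f => f)).
Local Notation only_constant := (forall g : CC R -> CC R, analytic_disc g ->
  compact_operator (in_D1 w) (D1_norm w) (@in_Hinf R) (@Hinf_norm R) (Tg g) -> constant_disc g).

Lemma identity_compactP : ~ ratio_large -> compact_identity.
Proof. by move=> /not_ratio_large; exact: identity_compact. Qed.

Lemma compact_identity_not_only_constant : compact_identity -> ~ only_constant.
Proof.
move=> /Tg_id_compact H /(_ _ (@analytic_id R) H) [c Hc].
have z0 : cmod (0 : CC R) < 1 by rewrite cmod0 ltr01.
have z1 : cmod (rc (1 / 2) : CC R) < 1 by rewrite cmod_rc ger0_norm; lra.
have := Hc _ z0; rewrite -(Hc _ z1) => /esym/eqP; rewrite rc_eq0 => /eqP; lra.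
Qed.

Hypothesis Dw : Dhat w.

Lemma ratio_large_only_constant : ratio_large -> only_constant.
Proof. by move=> [c c0 H] g dg; exact: Tg_compact_constant rw g c Dw c0 H dg. Qed.

Local Notation S r := (\sum_(1 <= k <oo) (momentterm w r k)%:E)%E.

Lemma ratio_large_moments : ratio_large <->
  (0 < limf_esup (fun r : R => (1 - r)%:E * S r) (1 : R)^'-)%E.
Proof.
rewrite limf_esup_left_gt0P; split=> [[c c0 H]|[c c0 H]].
  have [n [A [A0 HA]]] := kern_integral_le rw Dw.
  exists (c / (A * 2 * 2 ^+ (8 * n.+1))); first by rewrite divr_gt0 // !mulr_gt0 ?exprn_gt0.
  move=> s s1; have s1' : Num.max s (3 / 4) < 1 by rewrite gt_max s1; lra.
  have [r []] := H _ s1'; rewrite gt_max => /andP[sr /ltW r34] r1 cr; exists r; split=> //.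
  exact: moment_series_large.
apply: contrapT => /not_ratio_large small.
(* Here [4 * e = c / 4], and for [r] close to 1 the term with [B] is at most [c / 2]; the total
   [3 c / 4] contradicts the lower bound [c]. *)
have e0 : 0 < c / 16 by rewrite divr_gt0.
have [B HB] := moment_series_small rw e0 (small _ e0).
have B1 : 0 < `|B| + 1 by rewrite ltr_wpDl.
have d0 : 0 < c / 2 / (`|B| + 1) by rewrite !divr_gt0.
have s1 : Num.max 0 (1 - c / 2 / (`|B| + 1)) < 1 by rewrite gt_max ltr01 ltrBlDr ltrDl.
have [r []] := H _ s1; rewrite gt_max => /andP[r0 sr] r1 h.
have := le_trans h (HB r (ltW r0) r1); rewrite lee_fin.
have q0 : 0 < 1 - r by rewrite subr_gt0.
have h1 : (1 - r) * B <= (1 - r) * (`|B| + 1).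
  by apply: ler_wpM2l; [exact: ltW|rewrite (le_trans (ler_norm B)) // lerDl].
have h2 : (1 - r) * (`|B| + 1) <= c / 2.
  by rewrite -ler_pdivlMr // ltW // ltrBlDr addrC -ltrBlDr.
lra.
Qed.

End Equivalence.

Theorem mainTheorem4 (R : realType) (w : R -> R) :
  radial_weight w -> Dhat w ->
  [<->
   (* (i) T_c(D^1_omega, H^infty) consists of constant functions only *)
   (forall g : CC R -> CC R, analytic_disc g ->
      compact_operator (in_D1 w) (D1_norm w) (@in_Hinf R) (@Hinf_norm R) (Tg g) ->
      constant_disc g);
   (* (ii) *)
   (0 < limf_esup (fun r : R => ((1 - r) / omega_hat w r)%:E) (1 : R)^'-)%E;
   (* (iii) *)
   (0 < limf_esup (fun r : R =>
         ((1 - r)%:E * \sum_(1 <= k <oo) ((r ^+ k / ((k.+1)%:R * moment w k))%:E))%E)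
         (1 : R)^'-)%E;
   (* (iv) the identity D^1_omega -> D^1_0 is not compact *)
   ~ compact_operator (in_D1 w) (D1_norm w) (in_D1 (@one_weight R)) (D1_norm (@one_weight R))
       (fun f => f)].
Proof.
move=> rw Dw.
have P2 := ratio_largeP rw; have P3 := ratio_large_moments rw Dw.
tfae.
- move=> H; apply/P2; apply: contrapT => /(identity_compactP rw) I.
  exact: compact_identity_not_only_constant I H.
- by move=> /P2/P3.
- move=> /P3 H I; apply: (compact_identity_not_only_constant I).
  exact: ratio_large_only_constant.
- move=> I; apply: (ratio_large_only_constant rw Dw).
  by apply: contrapT => /(identity_compactP rw).
Qed.
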